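(* Let $M^n$ be a closed connected manifold of dimension $n$ and let $(g_t)_{t\in[0,T]}$ be a smooth Ricci flow solution on $M$, i.e. a smooth $1$-parameter family of Riemannian metrics with $\partial_t g_t = -2\,\mathrm{Ric}_t$ for $t\in[0,T]$. Let $u_t(x)=u(x,t)$ be a smooth positive solution to the heat equation $\partial_t u_t = \Delta_t u_t$ on $M\times[0,T]$, with initial datum satisfying $u_0 \leq A$ for some constant $A>0$. If $|\mathrm{Ric}_t|_t\leq K$ on $M$ for all $t \in [0,T]$, for some constant $K \geq 0$, then $$ \frac{\Delta_t u_t}{u_t} \leq \left(\frac{n}{t}+ \frac{K}{\sqrt{2}}\right) +\left(\frac{5}{2t} +\left(2+\frac{1}{\sqrt{2}}\right)K\right)\log\!\left(\frac{A}{u_t}\right) \quad \text{on } M, \text{ for all } t \in (0,T] . $$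
   Context: Closed means compact without boundary. $\mathrm{Ric}_t$ is the Ricci tensor of $g_t$, $|\cdot|_t$ is the tensor norm induced by $g_t$ (for a symmetric $(0,2)$-tensor $h$, $|h|_t^2=\sum_{i,j}h(e_i,e_j)^2$ in a $g_t$-orthonormal frame $\{e_i\}$), and $\Delta_t=\mathrm{div}_t\circ\nabla^t$ is the Laplace--Beltrami operator of $(M,g_t)$ (the trace of the Hessian). *)

(* Defs.v *)
From HB Require Import structures.
From mathcomp Require Import all_boot all_order all_algebra.
From mathcomp Require Import all_classical all_reals all_analysis.
Set Implicit Arguments.
Unset Strict Implicit.
Unset Printing Implicit Defensive.
Import Order.TTheory GRing.Theory Num.Theory numFieldNormedType.Exports.
Local Open Scope classical_set_scope.
Local Open Scope ring_scope.

(** * Smooth maps between normed spaces *)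

(* All directional derivatives of order <= k exist and are continuous on the
   open set U.  On a finite-dimensional V (the only use below) this is the
   usual class C^k. *)
Fixpoint Ck (R : realType) (V W : normedModType R) (k : nat)
    (U : set V) (f : V -> W) : Prop :=
  (forall x, U x -> {for x, continuous f}) /\
  match k with
  | 0 => True
  | k'.+1 => forall v : V,
      (forall x, U x -> derivable f x v) /\ Ck k' U ('D_v f)
  end.

Definition smooth_open (R : realType) (V W : normedModType R)
    (U : set V) (f : V -> W) : Prop :=
  forall k, Ck k U f.

(* Smoothness on an arbitrary subset S: locally the restriction of a smooth
   map defined on an open set.  For S = [0, T] x U this is smoothness up to
   the end times 0 and T. *)
Definition smooth_on (R : realType) (V W : normedModType R)
    (S : set V) (f : V -> W) : Prop :=
  forall x, S x -> exists (U : set V) (F : V -> W),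
    [/\ open U, U x, smooth_open U F
      & forall y, U y -> S y -> F y = f y].

(* f'(t) = l for f defined on I; one-sided at an end point of an interval I. *)
Definition has_derivative_within (R : realType) (I : set R) (f : R -> R)
    (t l : R) : Prop :=
  (f s - f t) / (s - t) @[s --> within (I `\ t) (nbhs t)] --> l.

(** * Smooth manifolds *)

Record chart (R : realType) (n : nat) (M : topologicalType) := Chart {
  cdom : set M;
  cimg : set 'rV[R]_n;
  cmap : M -> 'rV[R]_n;
  cinv : 'rV[R]_n -> M;
  cdom_open : open cdom;
  cimg_open : open cimg;
  cmap_img : forall p, cdom p -> cimg (cmap p);
  cinv_dom : forall x, cimg x -> cdom (cinv x);
  cmapK : forall p, cdom p -> cinv (cmap p) = p;
  cinvK : forall x, cimg x -> cmap (cinv x) = x;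
  cmap_continuous : forall p, cdom p -> {for p, continuous cmap};
  cinv_continuous : forall x, cimg x -> {for x, continuous cinv} }.

Definition transition (R : realType) (n : nat) (M : topologicalType)
    (c c' : chart R n M) : 'rV[R]_n -> 'rV[R]_n :=
  cmap c' \o cinv c.

Definition overlap (R : realType) (n : nat) (M : topologicalType)
    (c c' : chart R n M) : set 'rV[R]_n :=
  cimg c `&` cinv c @^-1` cdom c'.

(* The atlas need not be maximal: any atlas determines the smooth structure.
   The separation and compactness axioms are kept separate. *)
Record smooth_atlas (R : realType) (n : nat) (M : topologicalType) :=
  SmoothAtlas {
    charts : set (chart R n M);
    charts_cover : forall p, exists2 c, charts c & cdom c p;
    charts_compatible : forall c c', charts c -> charts c' ->
      smooth_open (overlap c c') (transition c c') }.

(** * Local Riemannian geometry on an open subset of R^n *)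

(* 'D_(e_i) f for the i-th standard basis (row) vector e_i. *)
Definition partial (R : realType) (n : nat) (i : 'I_n)
    (f : 'rV[R]_n -> R) : 'rV[R]_n -> R :=
  'D_(delta_mx 0 i : 'rV[R]_n) f.

Section LocalGeometry.
Context (R : realType) (n : nat).
Implicit Types (G : 'rV[R]_n -> 'M[R]_n) (f : 'rV[R]_n -> R)
  (X : 'rV[R]_n -> 'rV[R]_n) (x : 'rV[R]_n).

(* Gamma^k_{ij} *)
Definition christoffel G (k i j : 'I_n) x : R :=
  2%:R^-1 * \sum_l invmx (G x) k l *
    (partial i (fun y => G y j l) x + partial j (fun y => G y i l) x
     - partial l (fun y => G y i j) x).

(* R_{ijk}^l, where R(d_i, d_j) d_k = R_{ijk}^l d_l and
   R(X, Y) = [nabla_X, nabla_Y] - nabla_[X, Y]. *)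
Definition riemann G (i j k l : 'I_n) x : R :=
  partial i (christoffel G l j k) x - partial j (christoffel G l i k) x
  + \sum_m (christoffel G l i m x * christoffel G m j k x
            - christoffel G l j m x * christoffel G m i k x).

(* Ric(Y, Z) = tr (X |-> R(X, Y) Z), positive on round spheres. *)
Definition ricci G x : 'M[R]_n :=
  \matrix_(j, k) \sum_i riemann G i j k i x.

Definition gradient G f x : 'rV[R]_n :=
  \row_i \sum_j invmx (G x) i j * partial j f x.

(* div X = nabla_i X^i *)
Definition divergence G X x : R :=
  \sum_i (partial i (fun y => X y 0 i) x
          + \sum_k christoffel G i i k x * X x 0 k).

Definition laplacian G f : 'rV[R]_n -> R := divergence G (gradient G f).

(* Row i of E holds the coordinates of the vector e_i. *)
Definition orthonormal_frame (B : 'M[R]_n) : set 'M[R]_n :=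
  [set E | E *m B *m E^T = 1%:M].

(* The norm of a symmetric (0,2)-tensor h with respect to the inner product B:
   (sum_ij h(e_i, e_j)^2)^(1/2) in a B-orthonormal frame.  The value does not
   depend on the frame, which is picked by choice. *)
Definition tensor_norm (B h : 'M[R]_n) : R :=
  let E := get (orthonormal_frame B) in
  Num.sqrt (\sum_i \sum_j (E *m h *m E^T) i j ^+ 2).

End LocalGeometry.

(** * Metrics and flows on a manifold *)

(* A (0,2)-tensor field is given by its components in each chart c, as
   functions of the coordinates x in [cimg c]; values elsewhere are junk. *)
Definition tensor_field (R : realType) (n : nat) (M : topologicalType) :=
  chart R n M -> 'rV[R]_n -> 'M[R]_n.

Record riemannian_metric (R : realType) (n : nat) (M : topologicalType)
    (S : smooth_atlas R n M) (g : tensor_field R n M) : Prop := {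
  metric_smooth : forall c, charts S c -> forall i j,
    smooth_open (cimg c) (fun x => g c x i j);
  metric_sym : forall c, charts S c -> forall x, cimg c x -> (g c x)^T = g c x;
  metric_posdef : forall c, charts S c -> forall x, cimg c x ->
    forall v : 'rV[R]_n, v != 0 -> 0 < (v *m g c x *m v^T) 0 0;
  (* g_ij = (d y^k / d x^i) (d y^l / d x^j) g'_kl *)
  metric_change : forall c c', charts S c -> charts S c' -> forall x, overlap c c' x ->
    let J : 'M[R]_n :=
      \matrix_(i, k) partial i (fun y => transition c c' y 0 k) x in
    g c x = J *m g c' (transition c c' x) *m J^T }.

(* The metrics g t matter only for t in [0, T]. *)
Record ricci_flow (R : realType) (n : nat) (M : topologicalType)
    (S : smooth_atlas R n M) (T : R) (g : R -> tensor_field R n M) : Prop := {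
  flow_metric : forall t, 0 <= t <= T -> riemannian_metric S (g t);
  flow_smooth : forall c, charts S c -> forall i j,
    smooth_on (`[0, T]%classic `*` cimg c)
      (fun z : (R * 'rV[R]_n)%type => g z.1 c z.2 i j);
  flow_eq : forall c, charts S c -> forall t x, 0 <= t <= T -> cimg c x ->
    forall i j, has_derivative_within `[0, T]%classic (fun s => g s c x i j) t
      (- 2%:R * ricci (g t c) x i j) }.

(* The Laplace-Beltrami operator and the norm of the Ricci tensor at p,
   computed in a chart c around p; both are independent of c. *)
Definition laplace_beltrami (R : realType) (n : nat) (M : topologicalType)
    (g : tensor_field R n M) (f : M -> R) (c : chart R n M) (p : M) : R :=
  laplacian (g c) (f \o cinv c) (cmap c p).

Definition ricci_norm (R : realType) (n : nat) (M : topologicalType)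
    (g : tensor_field R n M) (c : chart R n M) (p : M) : R :=
  tensor_norm (g c (cmap c p)) (ricci (g c) (cmap c p)).

Record heat_solution (R : realType) (n : nat) (M : topologicalType)
    (S : smooth_atlas R n M) (T : R) (g : R -> tensor_field R n M)
    (u : R -> M -> R) : Prop := {
  heat_smooth : forall c, charts S c ->
    smooth_on (`[0, T]%classic `*` cimg c)
      (fun z : (R * 'rV[R]_n)%type => u z.1 (cinv c z.2));
  heat_eq : forall c, charts S c -> forall t p, 0 <= t <= T -> cdom c p ->
    has_derivative_within `[0, T]%classic (fun s => u s p) t
      (laplace_beltrami (g t) (u t) c p) }.

(* Main.v *)
(* With L = log (A / u), w = |grad u|^2 / u and beta = 1 / sqrt 2, apply the maximum
   principle successively to
     q2 = t w - u L,
     q3 = t Delta u + (t / 2 + beta K t^2) w - (n + beta K t) u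
          - (5/2 + (2 + beta) K t) u L,
   which are nonpositive at t = 0.  Along the flow, the Bochner formula and the
   contracted Bianchi identity give, for the heat operator H = d/dt - Delta and
   h = u Hess (log u),
     H (u L) = w,   H w = - 2 |h|^2 / u,
     H (Delta u) = 2 <Ric, h> + 2 Ric (grad u, grad u) / u.
   Hence H q2 <= 0 and q2 <= 0.  Where q3 > 0, the bound t w <= u L forces
   n u < t (Delta u - w) = t tr h, so that |h|^2 >= (tr h)^2 / n dominates the
   terms of order zero, while AM-GM absorbs 2 t K |h| into
   2 beta K t^2 |h|^2 / u + beta K u; thus H q3 <= 0 there and q3 <= 0.

   The evolution equations are proved in an arbitrary commutative ring with
   commuting derivations, then evaluated in the ring of smooth functions on
   (0, T) x U for a chart domain U. *)
Require Import Defs.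
From HB Require Import structures.
From mathcomp Require Import all_boot all_order all_algebra.
From mathcomp Require Import all_classical all_reals all_analysis.
From mathcomp Require Import ring lra.
Set Implicit Arguments.
Unset Strict Implicit.
Unset Printing Implicit Defensive.
Import Order.TTheory GRing.Theory Num.Theory numFieldNormedType.Exports.
Local Open Scope classical_set_scope.
Local Open Scope ring_scope.

(** * Riemannian geometry in a differential ring *)

(** Two obstacles shape the proof. The maximum principle lives on M, so [q3] must not depend on the
    chart, and it contains the Laplacian. Instead of transforming second derivatives under a change
    of coordinates, the heat equation is used: the Laplacian of u at p is the time derivative of u
    at p, which involves no chart. This is done at interior times, where the one-sided derivatives
    are ordinary ones and where the derivations of the ring make sense. Hence the maximum principle
    is run for t < T; at t = 0 the factor t removes the Laplacian from [q3], and t = T is reached by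
    continuity. Secondly, H q <= 0 is not strict, so q - e t with a small e > 0 is maximised instead
    of q. The constants: 2 beta^2 = 1 is the condition under which 2 t |h| <= beta (2 t^2 |h|^2 / u
    + u) is a perfect square; the summand t / 2 in the coefficient of w yields - t |h|^2 / u, which
    pays for tr h = Delta u - w; the coefficient of u L pays for the remaining multiples of w. *)

Lemma trmxD (A : nmodType) (m n : nat) (X Y : 'M[A]_(m, n)) :
  (X + Y)^T = X^T + Y^T.
Proof. exact: raddfD. Qed.

Lemma trmxN (A : zmodType) (m n : nat) (X : 'M[A]_(m, n)) : (- X)^T = - X^T.
Proof. exact: raddfN. Qed.

Lemma trmxZ (A : pzRingType) (m n : nat) a (X : 'M[A]_(m, n)) :
  (a *: X)^T = a *: X^T.
Proof. exact: linearZ. Qed.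

Lemma mxtraceN (A : pzRingType) (n : nat) (X : 'M[A]_n) : \tr (- X) = - \tr X.
Proof. exact: raddfN. Qed.

Lemma mxtraceB (A : pzRingType) (n : nat) (X Y : 'M[A]_n) :
  \tr (X - Y) = \tr X - \tr Y.
Proof. exact: raddfB. Qed.

(* Matrix products are atoms for [ring] once every sum has been expanded. *)
Ltac mx_ring :=
  rewrite ?(map_mxD, map_mxN, trmxD, trmxN, trmx_mul, trmxK, mulmxDl, mulmxDr,
    mulmxBl, mulmxBr, mulmxN, mulNmx, mulmxA);
  repeat match goal with |- context [mulmx ?X ?Y] =>
    let Z := fresh "Z" in set Z := mulmx X Y; clearbody Z end;
  repeat match goal with |- context [bigop ?i ?r ?F] =>
    let Z := fresh "Z" in set Z := bigop i r F; clearbody Z end;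
  let a := fresh "a" in let b := fresh "b" in
  apply/matrixP => a b; rewrite !mxE;
  repeat match goal with |- context [fun_of_matrix ?X a b] =>
    let Z := fresh "Z" in set Z := fun_of_matrix X a b; clearbody Z end;
  ring.

Section DifferentialRing.
Context (A : comPzRingType) (n : nat) (d : 'I_n -> {additive A -> A}).
Hypothesis dM : forall i a b, d i (a * b) = d i a * b + a * d i b.
Hypothesis dC : forall i j a, d i (d j a) = d j (d i a).

Lemma d1 i : d i 1 = 0.
Proof.
have := dM i 1 1; rewrite !mulr1 mul1r => /eqP; rewrite -subr_eq subrr.
by move/eqP.
Qed.

Lemma derivation_mxM (e : {additive A -> A}) (p q r : nat)
    (X : 'M[A]_(p, q)) (Y : 'M[A]_(q, r)) :
  (forall a b, e (a * b) = e a * b + a * e b) ->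
  map_mx e (X *m Y) = map_mx e X *m Y + X *m map_mx e Y.
Proof.
move=> eM; apply/matrixP => a b; rewrite !mxE raddf_sum -big_split /=.
by apply: eq_bigr => k _; rewrite eM !mxE.
Qed.

Lemma dmxM i (p q r : nat) (X : 'M[A]_(p, q)) (Y : 'M[A]_(q, r)) :
  map_mx (d i) (X *m Y) = map_mx (d i) X *m Y + X *m map_mx (d i) Y.
Proof. exact: derivation_mxM. Qed.

Lemma dmxC i j (p q : nat) (X : 'M[A]_(p, q)) :
  map_mx (d i) (map_mx (d j) X) = map_mx (d j) (map_mx (d i) X).
Proof. by apply/matrixP => a b; rewrite !mxE dC. Qed.

Lemma dmx1 i : map_mx (d i) (1%:M : 'M[A]_n) = 0.
Proof.
apply/matrixP => a b; rewrite !mxE; case: (a == b); rewrite /= ?mulr1n ?mulr0n.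
  exact: d1.
by rewrite raddf0.
Qed.

Lemma d_mxtrace i (X : 'M[A]_n) : d i (\tr X) = \tr (map_mx (d i) X).
Proof. by rewrite raddf_sum; apply: eq_bigr => k _; rewrite mxE. Qed.

(* [Gam i j k] is the Christoffel symbol Gamma^k_ij, [curv i j k l] below is
   R_ijk^l, and [cov2], [covF] are covariant derivatives of a (0,2)-tensor and of
   the curvature. *)
Context (G H : 'M[A]_n) (Gam : 'I_n -> 'M[A]_n).
Hypothesis G_sym : G^T = G.
Hypothesis GH : G *m H = 1%:M.
Hypothesis HG : H *m G = 1%:M.
Hypothesis Gam_sym : forall i j k, Gam i j k = Gam j i k.
Hypothesis dG : forall i, map_mx (d i) G = Gam i *m G + G *m (Gam i)^T.

Lemma H_sym : H^T = H.
Proof.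
have : H^T *m G = 1%:M by rewrite -{1}G_sym -trmx_mul GH trmx1.
by move=> e; rewrite -[LHS]mulmx1 -GH mulmxA e mul1mx.
Qed.

(** Differentiating [H *m G = 1%:M] carries metric compatibility from [G] to its inverse. From here
    on [H] is parallel and passes through covariant derivatives. *)
Lemma dH i : map_mx (d i) H = - (H *m Gam i) - (Gam i)^T *m H.
Proof.
have e : map_mx (d i) (H *m G) = 0 by rewrite HG dmx1.
move: e; rewrite dmxM dG => /(congr1 (mulmx^~ H)).
rewrite mul0mx mulmxDl -mulmxA GH mulmx1 mulmxDr !mulmxDl -!mulmxA GH mulmx1.
rewrite !mulmxA HG mul1mx => /eqP; rewrite addr_eq0 => /eqP ->.
by rewrite opprD.
Qed.

(** The commutator has the sign opposite to the usual one because [Gam i] has its lower index as row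
    and its upper index as column, so that matrix products compose in reverse order. *)
Definition curv i j : 'M[A]_n :=
  map_mx (d i) (Gam j) - map_mx (d j) (Gam i) - Gam i *m Gam j + Gam j *m Gam i.

Lemma curvC i j : curv i j = - curv j i.
Proof. rewrite /curv; mx_ring. Qed.

(** The derivations [d i] and [d j] commute on [G]; expanding both orders by [dG] leaves exactly the
    curvature terms. *)
Lemma curv_antisym i j : curv i j *m G = - (G *m (curv i j)^T).
Proof.
have e := dmxC i j G.
move: e; rewrite !dG !map_mxD !dmxM !dG -!map_trmx => e.
apply/eqP; rewrite -subr_eq0 opprK; apply/eqP.
move/eqP: e; rewrite -subr_eq0 => /eqP <-.
rewrite /curv; mx_ring.
Qed.

Lemma H_curv i j : H *m curv i j = - ((curv i j)^T *m H).
Proof.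
have /(congr1 (fun X => H *m X *m H)) := curv_antisym i j.
by rewrite mulmxN mulNmx !mulmxA HG mul1mx -!mulmxA GH mulmx1.
Qed.

(** A Jacobi identity: only the two matrix indices are differentiated covariantly here. The
    connection terms for [m], [i], [j] are added in [covF]. *)
Lemma curv_bianchi2 m i j :
  let D k X := map_mx (d k) X - Gam k *m X + X *m Gam k in
  D m (curv i j) + D i (curv j m) + D j (curv m i) = 0.
Proof.
rewrite /= /curv !(map_mxD, map_mxB, map_mxN, dmxM).
rewrite (dmxC i m) (dmxC j m) (dmxC j i).
mx_ring.
Qed.

Definition ric : 'M[A]_n := \matrix_(j, k) \sum_i curv i j k i.

Definition cov2 k (X : 'M[A]_n) : 'M[A]_n :=
  map_mx (d k) X - Gam k *m X - X *m (Gam k)^T.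

(** The metric trace commutes with covariant differentiation because [H] is parallel. *)
Lemma d_trH k X : d k (\tr (H *m X)) = \tr (H *m cov2 k X).
Proof.
rewrite d_mxtrace dmxM dH /cov2 !(mulmxDl, mulmxBr, mulNmx) !raddfD !raddfN /=.
rewrite -(mulmxA _^T) (mxtrace_mulC _^T) !mulmxA; ring.
Qed.

Definition covF m i j : 'M[A]_n :=
  map_mx (d m) (curv i j) - Gam m *m curv i j + curv i j *m Gam m
  - \sum_p Gam m i p *: curv p j - \sum_p Gam m j p *: curv i p.

Lemma covFC m i j : covF m i j = - covF m j i.
Proof.
rewrite /covF; move: curv curvC => F FC; rewrite (FC j i) map_mxN mulmxN mulNmx.
have e (k l : 'I_n) : \sum_p Gam m k p *: F p l = - \sum_p Gam m k p *: F l p.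
  by rewrite -sumrN; apply: eq_bigr => p _; rewrite (FC p) scalerN.
rewrite (e i j) (e j i); mx_ring.
Qed.

(** Compared with [curv_bianchi2], the new terms let the connection act on the first two indices of
    the curvature. They cancel in pairs, since [Gam] has no torsion and [curv] is antisymmetric. *)
Lemma covF_bianchi m i j : covF m i j + covF i j m + covF j m i = 0.
Proof.
rewrite -[RHS](curv_bianchi2 m i j) /covF /=; move: curv curvC => F FC.
have e (a b c : 'I_n) : \sum_p Gam a b p *: F p c = - \sum_p Gam b a p *: F c p.
  by rewrite -sumrN; apply: eq_bigr => p _; rewrite (FC p) scalerN Gam_sym.
rewrite (e m i j) (e i j m) (e j m i); mx_ring.
Qed.

(** Contraction commutes with covariant differentiation: the connection term of the upper index
    cancels that of the lower index contracted with it. *)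
Lemma covF_trace m i k : \sum_j covF m j i k j = cov2 m ric i k.
Proof.
have E j : covF m j i k j = d m (curv j i k j) - \sum_p Gam m k p * curv j i p j
    + \sum_p curv j i k p * Gam m p j - \sum_p Gam m j p * curv p i k j
    - \sum_p Gam m i p * curv j p k j.
  rewrite /covF !mxE; congr (_ - _ - _); rewrite summxE; apply: eq_bigr => p _;
  by rewrite mxE.
rewrite (eq_bigr _ (fun j _ => E j)) !big_split /= !sumrN.
rewrite [X in _ + X - _ - _]exchange_big /=.
have -> : \sum_j \sum_i0 curv i0 i k j * Gam m j i0
        = \sum_j \sum_p Gam m j p * curv p i k j.
  by apply: eq_bigr => j _; apply: eq_bigr => p _; rewrite mulrC.
rewrite addrK /cov2 !mxE (raddf_sum (d m)) -!addrA; congr (_ + _).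
rewrite addrC; congr (- _ + - _).
  rewrite exchange_big; apply: eq_bigr => p _; rewrite !mxE mulr_sumr.
  by apply: eq_bigr => j _.
rewrite exchange_big; apply: eq_bigr => p _; rewrite !mxE mulr_suml.
by apply: eq_bigr => j _; rewrite mulrC.
Qed.

(** The antisymmetry [H_curv], differentiated covariantly; [H] being parallel, it contributes
    nothing. *)
Lemma H_covF m i j : H *m covF m i j = - ((covF m i j)^T *m H).
Proof.
have HcurvT k l : (curv k l)^T *m H = - (H *m curv k l) by rewrite H_curv opprK.
have sumE (a : 'I_n -> A) (F : 'I_n -> 'M[A]_n) :
    (forall p, (F p)^T *m H = - (H *m F p)) ->
    (\sum_p a p *: F p)^T *m H = - (H *m \sum_p a p *: F p).
  move=> hF; rewrite raddf_sum mulmx_suml mulmx_sumr -sumrN.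
  apply: eq_bigr => p _.
  by rewrite /= linearZ -scalemxAl hF scalerN -scalemxAr.
have e : map_mx (d m) ((curv i j)^T *m H) = map_mx (d m) (- (H *m curv i j)).
  by rewrite HcurvT.
move: e; rewrite map_mxN !dmxM dH // -map_trmx => e.
rewrite /covF.
have e1 := sumE (Gam m i) (fun p => curv p j) (fun p => HcurvT p j).
have e2 := sumE (Gam m j) (fun p => curv i p) (fun p => HcurvT i p).
have e3 := HcurvT i j.
move: (\sum_p Gam m i p *: curv p j) (\sum_p Gam m j p *: curv i p) e1 e2.
move: (curv i j) e e3 => F e e3 X Y e1 e2.
have e5 : (Gam m)^T *m F^T *m H = - ((Gam m)^T *m H *m F).
  by rewrite -mulmxA e3 mulmxN mulmxA.
have e6 : F^T *m H *m Gam m = - (H *m F *m Gam m) by rewrite e3 mulNmx.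
rewrite ?(trmxD, trmxN, trmx_mul, mulmxDl, mulmxBl, mulmxBr, mulmxDr, mulNmx, mulmxN).
rewrite e1 e2 e5.
move/eqP: e; rewrite !(mulmxDr, mulmxBr, mulmxN, mulmxDl, mulmxBl, mulNmx) !mulmxA e6.
rewrite -subr_eq0 => /eqP e; apply/eqP; rewrite -subr_eq0 -e; apply/eqP.
mx_ring.
Qed.

Lemma cov2_sym k X : X^T = X -> (cov2 k X)^T = cov2 k X.
Proof. move=> e; rewrite /cov2 -{4 5 6}e; mx_ring. Qed.

(** The divergence of Ricci is half the differential of the scalar curvature. Of the three terms of
    the second Bianchi identity, contracted twice, two give the divergence and one gives minus the
    differential. *)
Lemma contracted_bianchi i : ric^T = ric ->
  (\sum_j \sum_k H j k * cov2 j ric i k) *+ 2 = \tr (H *m cov2 i ric).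
Proof.
move=> ric_sym; have HS j k : H j k = H k j by rewrite -[in LHS]H_sym mxE.
pose D2 := \sum_m \sum_j \sum_k H j k * covF m i j k m.
pose D3 := \sum_j \sum_k H j k * cov2 j ric i k.
(* Antisymmetry in the last pair exchanges the two contractions: the derivative index becomes
   contracted through [H], and the upper index with a form index, which makes [ric] appear. *)
have E1 : D2 = D3.
  rewrite /D2 /D3.
  transitivity (\sum_m \sum_j \sum_k covF m j i k j * H k m).
    apply: eq_bigr => m _; apply: eq_bigr => j _.
    have /matrixP/(_ j m) := H_covF m i j; rewrite !mxE => ->.
    rewrite -sumrN; apply: eq_bigr => k _.
    by rewrite (covFC m j) !mxE mulNr.
  apply: eq_bigr => m _; rewrite exchange_big; apply: eq_bigr => k _ /=.
  by rewrite -mulr_suml covF_trace HS mulrC.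
have E2 : \sum_m \sum_j \sum_k H j k * covF i j m k m = - \tr (H *m cov2 i ric).
  rewrite exchange_big /= -sumrN; apply: eq_bigr => j _.
  rewrite exchange_big !mxE -sumrN; apply: eq_bigr => k _ /=.
  rewrite -mulr_sumr (eq_bigr (fun m => - covF i m j k m)); last first.
    by move=> m _; rewrite covFC !mxE.
  rewrite sumrN covF_trace mulrN; congr (- (_ * _)).
  by rewrite -[in LHS](cov2_sym i ric_sym) mxE.
have E3 : \sum_m \sum_j \sum_k H j k * covF j m i k m = D3.
  rewrite exchange_big; apply: eq_bigr => j _.
  rewrite exchange_big; apply: eq_bigr => k _ /=.
  by rewrite -mulr_sumr covF_trace.
have : D2 + \sum_m \sum_j \sum_k H j k * covF i j m k m
       + \sum_m \sum_j \sum_k H j k * covF j m i k m = 0.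
  rewrite -!big_split big1 // => m _; rewrite -!big_split big1 // => j _.
  rewrite -!big_split big1 // => k _ /=.
  have /matrixP/(_ k m) := covF_bianchi m i j; rewrite !mxE => e.
  by rewrite -!mulrDr e mulr0.
rewrite E1 E2 E3 -/D3 addrAC => /eqP; rewrite subr_eq0 => /eqP <-.
by rewrite mulr2n.
Qed.

(** * Gradient, Hessian, Laplacian and the Bochner formula *)

Definition gr (f : A) : 'cV[A]_n := \col_k d k f.
Definition hess (f : A) : 'M[A]_n :=
  \matrix_(i, j) (d j (d i f) - \sum_p Gam j i p * d p f).
Definition lap (f : A) : A := \tr (H *m hess f).
Definition ip (f g : A) : A := ((gr f)^T *m H *m gr g) 0 0.

Lemma hess_sym f : (hess f)^T = hess f.
Proof.
apply/matrixP => i j; rewrite !mxE dC; congr (_ - _).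
by apply: eq_bigr => p _; rewrite Gam_sym.
Qed.

Lemma col_hess k f : col k (hess f) = map_mx (d k) (gr f) - Gam k *m gr f.
Proof.
apply/matrixP => i j; rewrite !mxE; congr (_ - _).
by apply: eq_bigr => p _; rewrite !mxE.
Qed.

Lemma dgr k f : map_mx (d k) (gr f) = col k (hess f) + Gam k *m gr f.
Proof. by rewrite col_hess subrK. Qed.

Lemma ipC f g : ip f g = ip g f.
Proof.
have e : (gr f)^T *m H *m gr g = ((gr g)^T *m H *m gr f)^T.
  by rewrite !trmx_mul trmxK H_sym mulmxA.
by rewrite /ip e [LHS]mxE.
Qed.

Lemma tr_dyad (u v : 'cV[A]_n) : \tr (H *m (u *m v^T)) = (v^T *m H *m u) 0 0.
Proof. by rewrite mulmxA mxtrace_mulC mulmxA /mxtrace big_ord1. Qed.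

Lemma hessM f g : hess (f * g) =
  f *: hess g + g *: hess f + gr f *m (gr g)^T + gr g *m (gr f)^T.
Proof.
apply/matrixP => i j; rewrite !mxE !big_ord1 !mxE !dM !raddfD /= !dM.
rewrite (eq_bigr (fun p => f * (Gam j i p * d p g) + g * (Gam j i p * d p f))).
  rewrite big_split -!mulr_sumr /=; ring.
by move=> p _; rewrite dM; ring.
Qed.

Lemma lapM f g : lap (f * g) = f * lap g + g * lap f + ip f g *+ 2.
Proof.
rewrite /lap hessM !mulmxDr -!scalemxAr !mxtraceD !mxtraceZ !tr_dyad.
rewrite -/(ip g f) -/(ip f g) (ipC g f); ring.
Qed.

Lemma lapD f g : lap (f + g) = lap f + lap g.
Proof.
rewrite /lap -mxtraceD -mulmxDr; congr (\tr (_ *m _)).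
apply/matrixP => i j; rewrite !mxE !raddfD /= -addrACA -opprD; congr (_ - _).
by rewrite -big_split; apply: eq_bigr => p _; rewrite raddfD mulrDr.
Qed.

(** Bridges the trace of the Hessian, convenient for algebra, and the divergence of the gradient,
    which is how the Laplacian is defined in coordinates. They agree because [H] is parallel. *)
Lemma lap_div f : lap f =
  \sum_i (d i ((H *m gr f) i 0) + \sum_k Gam i k i * (H *m gr f) k 0).
Proof.
set w := gr f; apply: eq_bigr => i _.
have -> : d i ((H *m w) i 0) = map_mx (d i) (H *m w) i 0 by rewrite [RHS]mxE.
have -> : map_mx (d i) (H *m w) = H *m col i (hess f) - (Gam i)^T *m (H *m w).
  by rewrite dmxM dH dgr -/w; move: (col i _) => c; mx_ring.
have -> : \sum_k Gam i k i * (H *m w) k 0 = ((Gam i)^T *m (H *m w)) i 0.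
  by rewrite [RHS]mxE; apply: eq_bigr => k _; rewrite [_^T _ _]mxE.
have -> : (H *m hess f) i i = (H *m col i (hess f)) i 0.
  by rewrite !mxE; apply: eq_bigr => k _; rewrite [col _ _ _ _]mxE.
by move: (H *m col _ _) (_ *m (H *m w)) => Y Z; rewrite !mxE subrK.
Qed.

Lemma lapN f : lap (- f) = - lap f.
Proof.
rewrite /lap -raddfN -mulmxN; congr (\tr (_ *m _)).
apply/matrixP => i j; rewrite !mxE !raddfN /= opprB addrC; congr (_ + _).
by rewrite -sumrN; apply: eq_bigr => p _; rewrite raddfN mulrN opprK.
Qed.

(** The derivative of [H] cancels the connection terms of both gradients; the two Hessian terms that
    survive are equal by symmetry. *)
Lemma gr_ip f : gr (ip f f) = (hess f *m H *m gr f) *+ 2.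
Proof.
apply/matrixP => k j; rewrite {j}ord1 mxE /ip.
set w := gr f.
have -> : d k ((w^T *m H *m w) 0 0) = map_mx (d k) (w^T *m H *m w) 0 0.
  by rewrite [RHS]mxE.
rewrite !dmxM dH -map_trmx dgr -/w.
have -> : ((col k (hess f) + Gam k *m w)^T *m H +
   w^T *m (- (H *m Gam k) - (Gam k)^T *m H)) *m w +
  w^T *m H *m (col k (hess f) + Gam k *m w) =
  (col k (hess f))^T *m H *m w + w^T *m H *m col k (hess f).
  by move: (col k _) => c; mx_ring.
have e : w^T *m H *m col k (hess f) = ((col k (hess f))^T *m H *m w)^T.
  by rewrite !trmx_mul trmxK H_sym mulmxA.
have e2 : (col k (hess f))^T = row k (hess f) by rewrite tr_col hess_sym.
rewrite e e2 -!row_mul mulr2n; move: (hess f *m H *m w) => Y.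
by rewrite !mxE.
Qed.

(** The Ricci identity for the 1-form df. The connection acting on the second derivative index gives
    a term symmetric in [i] and [k], which drops out. *)
Lemma hess_comm f i k j :
  cov2 i (hess f) j k = cov2 k (hess f) j i - (curv i k *m gr f) j 0.
Proof.
set w := gr f.
have E a b : cov2 a (hess f) j b =
    (map_mx (d a) (map_mx (d b) w - Gam b *m w)
     - Gam a *m (map_mx (d b) w - Gam b *m w)) j 0
    - \sum_p Gam a b p * hess f j p.
  rewrite -(col_hess b) /cov2 !mxE; congr (_ - _ - _).
    by apply: eq_bigr => p _; rewrite !mxE.
  by apply: eq_bigr => p _; rewrite !mxE mulrC.
rewrite !E (eq_bigr (fun p => Gam k i p * hess f j p)); last first.
  by move=> p _; rewrite Gam_sym.
move: (\sum_p _) => z.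
pose P a b := map_mx (d a) (map_mx (d b) w - Gam b *m w)
              - Gam a *m (map_mx (d b) w - Gam b *m w).
have e : P i k = P k i - curv i k *m w.
  rewrite /P !map_mxB !dmxM (dmxC i k) /curv; mx_ring.
rewrite -/(P i k) -/(P k i) e.
move: (P k i) (curv i k *m w) => Q Y; rewrite !mxE; ring.
Qed.

(** [ric] contracts the upper index of the curvature; after raising an index, [H_curv] brings this
    expression to that form at the price of a sign. *)
Lemma ric_curv k j : \sum_i (H *m curv i k) i j = - (ric *m H) k j.
Proof.
rewrite [in RHS]mxE -sumrN.
transitivity (\sum_i \sum_m - (curv i k m i * H m j)).
  apply: eq_bigr => i _; rewrite H_curv !mxE -sumrN.
  by apply: eq_bigr => m _; rewrite !mxE.
rewrite exchange_big; apply: eq_bigr => m _ /=.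
by rewrite sumrN -mulr_suml !mxE.
Qed.

Definition ricq (f : A) : A := ((gr f)^T *m H *m ric *m H *m gr f) 0 0.
Definition normsq (X : 'M[A]_n) : A := \tr (H *m X *m H *m X).

(** Differentiating [gr_ip] once more and tracing gives the squared Hessian and a third-order term.
    Commuting derivatives in the latter by [hess_comm] produces the gradient of the Laplacian and,
    through [ric_curv], the Ricci term. *)
Lemma bochner f : lap (ip f f) = (normsq (hess f) + ip f (lap f) + ricq f) *+ 2.
Proof.
set w := gr f; set S := hess f.
have Hess2 i : map_mx (d i) (S *m H *m w) - Gam i *m (S *m H *m w) =
   cov2 i S *m H *m w + S *m H *m col i S.
  by rewrite !dmxM dH dgr -/w -/S /cov2; move: (col i S) => c; mx_ring.
have -> : lap (ip f f) = (\sum_i \sum_j H i j *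
   (cov2 i S *m H *m w + S *m H *m col i S) j 0) *+ 2.
  rewrite /lap /mxtrace -sumrMnl; apply: eq_bigr => i _.
  rewrite mxE -sumrMnl; apply: eq_bigr => j _.
  rewrite -mulrnAr; congr (_ * _).
  have -> : hess (ip f f) j i = col i (hess (ip f f)) j 0 by rewrite [RHS]mxE.
  rewrite col_hess gr_ip -Hess2 -/S -/w.
  move: (S *m H *m w) => Y; rewrite mulr2n !(map_mxD, mulmxDr).
  move: (Gam i *m Y) (map_mx _ Y) => Y1 Y2; rewrite !mxE; ring.
congr (_ *+ 2).
have -> : \sum_i \sum_j H i j * (cov2 i S *m H *m w + S *m H *m col i S) j 0 =
  \sum_i \sum_j H i j * (cov2 i S *m H *m w) j 0 + normsq S.
  rewrite /normsq -!(mulmxA H) -big_split; apply: eq_bigr => i _ /=.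
  rewrite [(H *m _) i i]mxE -big_split; apply: eq_bigr => j _ /=.
  rewrite -mulrDr; congr (_ * _).
  have -> : (S *m H *m S) j i = (S *m H *m col i S) j 0.
    by rewrite !mxE; apply: eq_bigr => k _; rewrite [col _ _ _ _]mxE.
  by move: (_ *m w) (_ *m col i S) => Y1 Y2; rewrite mxE.
have -> : \sum_i \sum_j H i j * (cov2 i S *m H *m w) j 0 =
    \sum_k (H *m w) k 0 * (d k (lap f) + (ric *m H *m w) k 0).
  transitivity (\sum_k \sum_i \sum_j (H *m w) k 0 * (H i j * cov2 i S j k)).
    rewrite [RHS]exchange_big; apply: eq_bigr => i _ /=.
    rewrite [RHS]exchange_big; apply: eq_bigr => j _ /=.
    rewrite -mulmxA [(_ *m (H *m w)) j 0]mxE mulr_sumr.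
    by apply: eq_bigr => k _; ring.
  apply: eq_bigr => k _; under eq_bigr do rewrite -mulr_sumr.
  rewrite -mulr_sumr; congr (_ * _).
  rewrite /lap d_trH -/S.
  have -> : \tr (H *m cov2 k S) = \sum_i \sum_j H i j * cov2 k S j i.
    by apply: eq_bigr => i _; rewrite mxE.
  have -> : (ric *m H *m w) k 0 = - \sum_i \sum_j H i j * (curv i k *m w) j 0.
    have e : \sum_i \sum_j H i j * (curv i k *m w) j 0 =
             \sum_l (\sum_i (H *m curv i k) i l) * w l 0.
      rewrite (eq_bigr (fun i => \sum_l (H *m curv i k) i l * w l 0)).
        by rewrite exchange_big; apply: eq_bigr => l _; rewrite mulr_suml.
      move=> i _; transitivity ((H *m (curv i k *m w)) i 0).
        by rewrite [RHS]mxE.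
      by rewrite mulmxA [LHS]mxE.
    rewrite e [LHS]mxE -sumrN; apply: eq_bigr => l _.
    by rewrite ric_curv mulNr opprK.
  rewrite -sumrN -big_split; apply: eq_bigr => i _ /=.
  rewrite -sumrN -big_split; apply: eq_bigr => j _ /=.
  by rewrite hess_comm; ring.
rewrite addrC -addrA; congr (_ + _).
rewrite /ip /ricq -/w.
have -> : w^T *m H = (H *m w)^T by rewrite trmx_mul H_sym.
have -> : (H *m w)^T *m ric *m H *m w = (H *m w)^T *m (ric *m H *m w).
  by rewrite !mulmxA.
move: (ric *m H *m w) (H *m w) => Y1 Y2.
rewrite !mxE -big_split; apply: eq_bigr => k _.
by rewrite !mxE mulrDr.
Qed.

(** * Evolution of the metric, the connection and the Laplacian under the Ricci flow *)

Context (dt : {additive A -> A}).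
Hypothesis dtM : forall a b, dt (a * b) = dt a * b + a * dt b.
Hypothesis dtC : forall i a, dt (d i a) = d i (dt a).
Hypothesis two_inj : forall a : A, a *+ 2 = 0 -> a = 0.
Hypothesis flow : map_mx dt G = - (ric *+ 2).

Lemma dt1 : dt 1 = 0.
Proof.
have := dtM 1 1; rewrite !mulr1 mul1r => /eqP; rewrite -subr_eq subrr.
by move/eqP.
Qed.

Lemma two_inj_eq (a b : A) : a *+ 2 = b *+ 2 -> a = b.
Proof.
by move/eqP; rewrite -subr_eq0 -mulrnBl => /eqP/two_inj/eqP; rewrite subr_eq0 => /eqP.
Qed.

(** The symmetry is read off from the flow equation, whose left side is the derivative of a
    symmetric matrix; [two_inj] removes the factor 2. *)
Lemma ric_sym : ric^T = ric.
Proof.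
have e i j : ric i j *+ 2 = - dt (G i j).
  move: flow; move: ric => Y /matrixP/(_ i j); rewrite !mulr2n !mxE => ->.
  by rewrite opprK.
apply/matrixP => i j; rewrite mxE; apply: two_inj_eq.
by rewrite !e -[in LHS]G_sym mxE.
Qed.

Lemma dtmxM (p q r : nat) (X : 'M[A]_(p, q)) (Y : 'M[A]_(q, r)) :
  map_mx dt (X *m Y) = map_mx dt X *m Y + X *m map_mx dt Y.
Proof. exact: derivation_mxM. Qed.

Lemma dt_H : map_mx dt H = (H *m ric *m H) *+ 2.
Proof.
have e : map_mx dt (H *m G) = 0.
  apply/matrixP => a b; rewrite HG !mxE.
  by case: (a == b); rewrite ?mulr1n ?mulr0n ?raddf0 ?dt1.
move: e; rewrite dtmxM flow => /(congr1 (mulmx^~ H)).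
rewrite mul0mx mulmxDl -mulmxA GH mulmx1 mulmxN mulNmx => /eqP.
by rewrite subr_eq0 => /eqP ->; rewrite !mulr2n mulmxDr mulmxDl.
Qed.

(** The time derivative of the compatibility relation [dG]: once the connection terms are collected,
    only the variation of the connection is left. *)
Lemma cov2_flow i : cov2 i (map_mx dt G) =
  map_mx dt (Gam i) *m G + (map_mx dt (Gam i) *m G)^T.
Proof.
have e : map_mx (d i) (map_mx dt G) = map_mx dt (map_mx (d i) G).
  by apply/matrixP => a b; rewrite !mxE dtC.
rewrite /cov2 e dG map_mxD !dtmxM -map_trmx trmx_mul G_sym.
mx_ring.
Qed.

Lemma cov2Mn i X m : cov2 i (X *+ m) = cov2 i X *+ m.
Proof.
elim: m => [|m IH].
  by rewrite !mulr0n /cov2 raddf0 mulmx0 mul0mx !subr0.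
rewrite !mulrSr -IH /cov2; mx_ring.
Qed.

Lemma cov2N i X : cov2 i (- X) = - cov2 i X.
Proof. rewrite /cov2; mx_ring. Qed.

(* Under the flow [dt Gam] is a combination of covariant derivatives of [ric], and
   its trace vanishes by the contracted Bianchi identity. *)
Lemma dt_Gam_trace p : \sum_i \sum_j H i j * dt (Gam i j p) = 0.
Proof.
have HS j k : H j k = H k j by rewrite -[in LHS]H_sym mxE.
pose C i := map_mx dt (Gam i) *m G.
have CS i j k : C i j k = C j i k.
  by rewrite !mxE; apply: eq_bigr => q _; rewrite !mxE Gam_sym.
have cE i j k : cov2 i (map_mx dt G) j k = C i j k + C i k j.
  by rewrite cov2_flow -/(C i); move: (C i) => Z; rewrite !mxE.
(* Let x and y be the two traces of [C], and D the divergence of [ric]. Tracing [cE] in two ways,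
   with the flow and the contracted Bianchi identity, gives x + y = - 2 D and 2 y = - 4 D, hence 2 x
   = 0. *)
have C0 k : \sum_i \sum_j H i j * C i j k = 0.
  apply: two_inj.
  have e1 : \sum_i \sum_j H i j * cov2 i (map_mx dt G) j k =
      \sum_i \sum_j H i j * C i j k + \sum_i \sum_j H i j * C i k j.
    rewrite -big_split; apply: eq_bigr => i _; rewrite -big_split.
    by apply: eq_bigr => j _; rewrite cE mulrDr.
  have e2 : \tr (H *m cov2 k (map_mx dt G)) =
      (\sum_i \sum_j H i j * C i k j) *+ 2.
    rewrite mulr2n.
    transitivity (\sum_i \sum_j H i j * (C k j i + C k i j)).
      by apply: eq_bigr => i _; rewrite mxE; apply: eq_bigr => j _; rewrite cE.
    under eq_bigr do under eq_bigr do rewrite mulrDr.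
    under eq_bigr do rewrite big_split /=.
    rewrite big_split /=; congr (_ + _).
      rewrite exchange_big; apply: eq_bigr => i _; apply: eq_bigr => j _.
      by rewrite HS CS.
    by apply: eq_bigr => i _; apply: eq_bigr => j _; rewrite CS.
  have e3 : \sum_i \sum_j H i j * cov2 i (map_mx dt G) j k =
      - ((\sum_i \sum_j H i j * cov2 i ric k j) *+ 2).
    rewrite -sumrMnl -sumrN; apply: eq_bigr => i _.
    rewrite -sumrMnl -sumrN; apply: eq_bigr => j _.
    rewrite flow cov2N cov2Mn -[in LHS](cov2_sym i ric_sym) mulr2n.
    by move: (cov2 i ric) => Y; rewrite !mxE; ring.
  have e4 : \tr (H *m cov2 k (map_mx dt G)) = - (\tr (H *m cov2 k ric) *+ 2).
    by rewrite flow cov2N cov2Mn mulmxN mulr2n mulmxDr !raddfN raddfD.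
  have e5 := contracted_bianchi k ric_sym.
  rewrite e1 in e3; rewrite e2 -e5 in e4.
  move: e3 e4; move: (\sum_i _) (\sum_i _) (\sum_i _) => t y x e3 e4.
  have -> : x *+ 2 = (x + y) *+ 2 - y *+ 2 by ring.
  by rewrite e3 e4; ring.
have e i j : dt (Gam i j p) = \sum_k C i j k * H k p.
  have : map_mx dt (Gam i) = C i *m H by rewrite /C -mulmxA GH mulmx1.
  by move/matrixP/(_ j p); rewrite !mxE.
transitivity (\sum_k (\sum_i \sum_j H i j * C i j k) * H k p).
  under [RHS]eq_bigr do rewrite mulr_suml.
  rewrite [RHS]exchange_big; apply: eq_bigr => i _ /=.
  under [RHS]eq_bigr do rewrite mulr_suml.
  rewrite [RHS]exchange_big; apply: eq_bigr => j _ /=.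
  by rewrite e mulr_sumr; apply: eq_bigr => k _; rewrite mulrA.
by rewrite big1 // => k _; rewrite C0 mul0r.
Qed.

(** The Laplacian varies through the inverse metric, which yields the Ricci term, and through the
    connection, whose contribution is the trace annihilated by [dt_Gam_trace]. *)
Lemma dt_lap f : dt (lap f) = lap (dt f) + \tr (H *m ric *m H *m hess f) *+ 2.
Proof.
have e : map_mx dt (hess f) =
    hess (dt f) - \matrix_(i, j) \sum_p dt (Gam j i p) * d p f.
  apply/matrixP => i j; rewrite !mxE raddfB /= !dtC -addrA -opprD; congr (_ - _).
  by rewrite raddf_sum -big_split; apply: eq_bigr => p _; rewrite dtM dtC addrC.
have -> : dt (lap f) = \tr (map_mx dt (H *m hess f)).
  by rewrite /lap raddf_sum; apply: eq_bigr => i _; rewrite [RHS]mxE.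
rewrite dtmxM dt_H e mulmxBr !raddfD !raddfN /=.
have -> : \tr (H *m \matrix_(i, j) (\sum_p dt (Gam j i p) * d p f)) = 0.
  transitivity (\sum_p (\sum_i \sum_j H i j * dt (Gam i j p)) * d p f).
    under [RHS]eq_bigr do rewrite mulr_suml.
    rewrite [RHS]exchange_big; apply: eq_bigr => i _ /=; rewrite mxE.
    under [RHS]eq_bigr do rewrite mulr_suml.
    rewrite [RHS]exchange_big; apply: eq_bigr => j _ /=.
    by rewrite mxE mulr_sumr; apply: eq_bigr => p _; rewrite mulrA.
  by rewrite big1 // => p _; rewrite dt_Gam_trace mul0r.
by rewrite subr0 addrC mulr2n mulmxDl mxtraceD.
Qed.

Lemma dt_ip f : dt (ip f f) = (ip f (dt f) + ricq f) *+ 2.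
Proof.
have e : map_mx dt (gr f) = gr (dt f) by apply/matrixP => a b; rewrite !mxE dtC.
have -> : dt (ip f f) = map_mx dt ((gr f)^T *m H *m gr f) 0 0.
  by rewrite [RHS]mxE.
rewrite !dtmxM dt_H -map_trmx e.
have -> : ((gr (dt f))^T *m H + (gr f)^T *m ((H *m ric *m H) *+ 2)) *m gr f
    + (gr f)^T *m H *m gr (dt f) =
  (gr (dt f))^T *m H *m gr f + (gr f)^T *m H *m gr (dt f) +
  ((gr f)^T *m H *m ric *m H *m gr f) *+ 2.
  rewrite !mulr2n; mx_ring.
have E (X Y Z : 'M[A]_1) : (X + Y + Z *+ 2) 0 0 = X 0 0 + Y 0 0 + Z 0 0 *+ 2.
  by rewrite !mulr2n !mxE.
rewrite E -/(ip (dt f) f) -/(ip f (dt f)) -/(ricq f) (ipC (dt f)); ring.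
Qed.

Definition box (f : A) : A := dt f - lap f.

Lemma boxD f g : box (f + g) = box f + box g.
Proof. by rewrite /box raddfD lapD opprD addrACA. Qed.

Lemma boxN f : box (- f) = - box f.
Proof. by rewrite /box raddfN lapN opprD. Qed.

Lemma boxM f g : box (f * g) = f * box g + g * box f - ip f g *+ 2.
Proof. by rewrite /box dtM lapM; ring. Qed.

Lemma ip_const c f : (forall i, d i c = 0) -> ip c f = 0.
Proof.
move=> dc; have e : gr c = 0 by apply/matrixP => a b; rewrite !mxE.
by rewrite /ip e trmx0 !mul0mx mxE.
Qed.

Lemma lap_const c : (forall i, d i c = 0) -> lap c = 0.
Proof.
move=> dc; rewrite /lap; have -> : hess c = 0; last by rewrite mulmx0 mxtrace0.
apply/matrixP => a b; rewrite !mxE dc raddf0 big1 ?subr0 // => p _.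
by rewrite dc mulr0.
Qed.

Lemma boxMc c f : (forall i, d i c = 0) -> box (c * f) = dt c * f + c * box f.
Proof. by move=> dc; rewrite boxM ip_const // /box (lap_const dc); ring. Qed.

(** * A positive solution of the heat equation, its inverse and its logarithm *)

Context (u v L : A).
Hypothesis heat : dt u = lap u.
Hypothesis uv : u * v = 1.
Hypothesis dL : forall i, d i L = - (v * d i u).
Hypothesis dtL : dt L = - (v * dt u).

Lemma dv i : d i v = - (v ^+ 2 * d i u).
Proof.
have := congr1 (d i) uv; rewrite dM d1 => /(congr1 (fun x => v * x)).
rewrite mulrDr mulr0 mulrA mulrA (mulrC v u) uv mul1r => e.
by apply/eqP; rewrite -subr_eq0 opprK addrC -e; apply/eqP; ring.
Qed.

Definition wq : A := v * ip u u.
(* With [v = 1 / u], this is u Hess (log u). *)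
Definition hq : 'M[A]_n := hess u - v *: (gr u *m (gr u)^T).
Definition ricS (X : 'M[A]_n) : A := \tr (H *m ric *m H *m X).

Lemma box_u : box u = 0.
Proof. by rewrite /box heat subrr. Qed.

Lemma tr_hq : \tr (H *m hq) = lap u - wq.
Proof.
by rewrite /hq mulmxBr -scalemxAr mxtraceB mxtraceZ tr_dyad.
Qed.

(** By the heat equation only the commutator of [dt] and [lap] is left. Splitting the Hessian of [u]
    into [hq] and the gradient dyad separates the two Ricci terms. *)
Lemma box_lap : box (lap u) = (ricS hq + v * ricq u) *+ 2.
Proof.
rewrite /box dt_lap heat addrAC subrr add0r; congr (_ *+ 2).
rewrite /ricS /hq mulmxBr -scalemxAr mxtraceB mxtraceZ.
have -> : \tr (H *m ric *m H *m (gr u *m (gr u)^T)) = ricq u.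
  by rewrite mulmxA mxtrace_mulC !mulmxA /mxtrace big_ord1.
by rewrite subrK.
Qed.

(** The Ricci term of the Bochner formula is cancelled exactly by the variation of the inverse
    metric under the flow, so no curvature bound is needed for this quantity. *)
Lemma box_ip : box (ip u u) = - (normsq (hess u) *+ 2).
Proof. by rewrite /box dt_ip bochner heat; ring. Qed.

Lemma gr_v : gr v = - (v ^+ 2 *: gr u).
Proof. by apply/matrixP => i j; rewrite !mxE dv. Qed.

Lemma gr_L : gr L = - (v *: gr u).
Proof. by apply/matrixP => i j; rewrite !mxE dL. Qed.

Lemma ip_v f : ip v f = - (v ^+ 2 * ip u f).
Proof. by rewrite /ip gr_v trmxN trmxZ !mulNmx -!scalemxAl !mxE. Qed.

Lemma ip_L f : ip L f = - (v * ip u f).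
Proof. by rewrite /ip gr_L trmxN trmxZ !mulNmx -!scalemxAl !mxE. Qed.

Lemma box_v : box v = - (v ^+ 3 * ip u u *+ 2).
Proof.
have e : box 1 = 0.
  by rewrite /box dt1 lap_const ?subrr // => i; rewrite d1.
move: e; rewrite -uv boxM box_u mulr0 addr0 ipC ip_v => e.
have -> : box v = v * (u * box v - - (v ^+ 2 * ip u u) *+ 2) - v ^+ 3 * ip u u *+ 2.
  by rewrite mulrBr mulrA (mulrC v u) uv; ring.
by rewrite e; ring.
Qed.

Definition Sq : A := ((gr u)^T *m H *m hess u *m H *m gr u) 0 0.

Lemma ip_gr_ip : ip u (ip u u) = Sq *+ 2.
Proof.
rewrite /ip -/(ip u u) gr_ip /Sq !mulr2n mulmxDr !mulmxA.
by move: (_ *m gr u) => Y; rewrite mxE.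
Qed.

Lemma normsq_hq : normsq hq = normsq (hess u) - v * Sq *+ 2 + v ^+ 2 * ip u u ^+ 2.
Proof.
rewrite /normsq /hq; set w := gr u; set S := hess u.
have e : \tr (H *m (S - v *: (w *m w^T)) *m H *m (S - v *: (w *m w^T))) =
  \tr (H *m S *m H *m S) - v * \tr (H *m S *m H *m w *m w^T)
  - v * \tr (H *m w *m w^T *m H *m S)
  + v ^+ 2 * \tr (H *m w *m w^T *m H *m w *m w^T).
  rewrite expr2 -!mxtraceZ -!mxtraceB -mxtraceD; congr (\tr _).
  rewrite !(mulmxBr, mulmxBl, =^~ scalemxAl, =^~ scalemxAr) !mulmxA.
  mx_ring.
rewrite e; congr (_ + _).
  rewrite -addrA -opprD -mulrDr -mulrnAr; congr (_ - _ * _).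
  rewrite mulr2n; congr (_ + _).
    by rewrite mxtrace_mulC !mulmxA /mxtrace big_ord1.
  by rewrite -!mulmxA mulmxA mxtrace_mulC !mulmxA /mxtrace big_ord1.
congr (_ * _); rewrite mxtrace_mulC !mulmxA /mxtrace big_ord1 /ip -/w.
have -> : w^T *m H *m w *m w^T *m H *m w = (w^T *m H *m w) *m (w^T *m H *m w).
  by rewrite !mulmxA.
by rewrite [LHS]mxE big_ord1 expr2.
Qed.

(** The product rule yields three terms, which are those of the expanded square in [normsq_hq]: the
    nonpositivity comes from completing the square. *)
Lemma box_wq : box wq = - (v * normsq hq *+ 2).
Proof.
by rewrite /wq boxM box_ip box_v ip_v ip_gr_ip normsq_hq; ring.
Qed.

(** The logarithm enters only through its derivation rules [dL] and [dtL]. The term [u * box L]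
    contributes [- wq], and the cross term contributes [wq *+ 2]. *)
Lemma box_uL : box (u * L) = wq.
Proof.
have e : box L = - (v ^+ 2 * ip u u).
  have gL : hess L = - (v *: hess u) + v ^+ 2 *: (gr u *m (gr u)^T).
    apply/matrixP => i j; rewrite !mxE big_ord1 !mxE dL raddfN /= dM dv.
    rewrite (eq_bigr (fun p => - v * (Gam j i p * d p u))).
      by rewrite -mulr_sumr; ring.
    by move=> p _; rewrite dL; ring.
  rewrite /box dtL heat /lap gL mulmxDr mulmxN -!scalemxAr mxtraceD mxtraceN.
  by rewrite !mxtraceZ tr_dyad -/(ip u u); ring.
rewrite boxM box_u e ipC ip_L /wq mulr0 addr0.
rewrite [u * _](_ : _ = - (u * v * v * ip u u)); last by ring.
by rewrite uv; ring.
Qed.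

Definition uL : A := u * L.

(** The factor [tau] is chosen so that its time derivative produces one copy of [wq], which cancels
    the one coming from [uL]. *)
Lemma box_q2 tau : (forall i, d i tau = 0) -> dt tau = 1 ->
  box (tau * wq - uL) = - (tau * v * normsq hq *+ 2).
Proof.
by move=> dtau tau1; rewrite boxD boxN boxMc // box_uL box_wq tau1; ring.
Qed.

Definition q3 (c a b tau : A) : A := tau * lap u + c * wq - a * u - b * uL.

Lemma box_q3 c a b tau :
  (forall i, d i c = 0) -> (forall i, d i a = 0) -> (forall i, d i b = 0) ->
  (forall i, d i tau = 0) -> dt tau = 1 ->
  box (q3 c a b tau) = lap u + tau * (ricS hq + v * ricq u) *+ 2
    + dt c * wq - c * (v * normsq hq) *+ 2 - dt a * u - dt b * uL - b * wq.
Proof.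
move=> dc da db dtau tau1; rewrite /q3 !(boxD, boxN).
rewrite (boxMc _ dtau) (boxMc _ dc) (boxMc _ da) (boxMc _ db).
by rewrite box_uL box_wq box_u box_lap tau1; ring.
Qed.

(** * Images of the identities under a ring morphism, to be used with evaluation at a point *)

Context (B : comPzRingType) (phi : {rmorphism A -> B}).

Lemma map_curv i j : map_mx phi (curv i j) =
  map_mx phi (map_mx (d i) (Gam j)) - map_mx phi (map_mx (d j) (Gam i))
  - map_mx phi (Gam i) *m map_mx phi (Gam j)
  + map_mx phi (Gam j) *m map_mx phi (Gam i).
Proof. by rewrite /curv map_mxD !map_mxB !map_mxM. Qed.

Lemma map_ric j k : phi (ric j k) = \sum_i (map_mx phi (curv i j)) k i.
Proof. by rewrite mxE rmorph_sum; apply: eq_bigr => i _; rewrite [RHS]mxE. Qed.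

Lemma map_ip f g : phi (ip f g) =
  ((map_mx phi (gr f))^T *m map_mx phi H *m map_mx phi (gr g)) 0 0.
Proof. by rewrite map_trmx -!map_mxM [RHS]mxE. Qed.

Lemma map_lap f : phi (lap f) = \tr (map_mx phi H *m map_mx phi (hess f)).
Proof. by rewrite -map_mxM trace_map_mx. Qed.

Lemma map_hess f i j : phi (hess f i j) =
  phi (d j (d i f)) - \sum_p phi (Gam j i p) * phi (d p f).
Proof.
rewrite mxE rmorphB rmorph_sum; congr (_ - _).
by apply: eq_bigr => p _; rewrite rmorphM.
Qed.

Lemma map_lap_div f : phi (lap f) =
  \sum_i (phi (d i ((H *m gr f) i 0)) +
          \sum_k phi (Gam i k i) * phi ((H *m gr f) k 0)).
Proof.
rewrite lap_div rmorph_sum; apply: eq_bigr => i _; rewrite rmorphD rmorph_sum.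
by congr (_ + _); apply: eq_bigr => k _; rewrite rmorphM.
Qed.

Lemma map_Hgr f i : phi ((H *m gr f) i 0) =
  \sum_j phi (H i j) * phi (d j f).
Proof. by rewrite mxE rmorph_sum; apply: eq_bigr => j _; rewrite rmorphM mxE. Qed.

Lemma map_box f : phi (box f) = phi (dt f) - phi (lap f).
Proof. exact: rmorphB. Qed.

Lemma map_wq : phi wq = phi v * phi (ip u u).
Proof. exact: rmorphM. Qed.

Lemma map_uL : phi uL = phi u * phi L.
Proof. exact: rmorphM. Qed.

Lemma map_normsq X : phi (normsq X) =
  \tr (map_mx phi H *m map_mx phi X *m map_mx phi H *m map_mx phi X).
Proof. by rewrite -!map_mxM trace_map_mx. Qed.

Lemma map_ricS X : phi (ricS X) =
  \tr (map_mx phi H *m map_mx phi ric *m map_mx phi H *m map_mx phi X).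
Proof. by rewrite -!map_mxM trace_map_mx. Qed.

Lemma map_ricq f : phi (ricq f) =
  ((map_mx phi (gr f))^T *m map_mx phi H *m map_mx phi ric *m map_mx phi H
   *m map_mx phi (gr f)) 0 0.
Proof. by rewrite map_trmx -!map_mxM [RHS]mxE. Qed.

Lemma map_hq_sym : (map_mx phi hq)^T = map_mx phi hq.
Proof.
rewrite map_trmx; congr map_mx; rewrite /hq trmxD trmxN trmxZ trmx_mul trmxK.
by rewrite hess_sym.
Qed.

Lemma map_tr_hq : \tr (map_mx phi H *m map_mx phi hq) = phi (lap u) - phi wq.
Proof. by rewrite -map_mxM trace_map_mx tr_hq rmorphB. Qed.

Lemma map_q2 tau : phi (tau * wq - uL) = phi tau * phi wq - phi uL.
Proof. by rewrite rmorphB rmorphM. Qed.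

Lemma map_q3 c a b tau : phi (q3 c a b tau) = phi tau * phi (lap u)
  + phi c * phi wq - phi a * phi u - phi b * phi uL.
Proof. by rewrite /q3 !rmorphB rmorphD !rmorphM. Qed.

Lemma map_box_q2 tau : (forall i, d i tau = 0) -> dt tau = 1 ->
  phi (box (tau * wq - uL)) = - (phi tau * phi v * phi (normsq hq) *+ 2).
Proof. by move=> dtau tau1; rewrite box_q2 // rmorphN rmorphMn !rmorphM. Qed.

Lemma map_box_q3 c a b tau :
  (forall i, d i c = 0) -> (forall i, d i a = 0) -> (forall i, d i b = 0) ->
  (forall i, d i tau = 0) -> dt tau = 1 ->
  phi (box (q3 c a b tau)) = phi (lap u)
    + phi tau * (phi (ricS hq) + phi v * phi (ricq u)) *+ 2
    + phi (dt c) * phi wq - phi c * (phi v * phi (normsq hq)) *+ 2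
    - phi (dt a) * phi u - phi (dt b) * phi uL - phi b * phi wq.
Proof.
move=> dc da db dtau tau1; rewrite box_q3 // !rmorphB 2!rmorphD [phi (_ *+ 2)]rmorphMn.
by rewrite [phi (_ * _ *+ 2)]rmorphMn !rmorphM rmorphD rmorphM.
Qed.

End DifferentialRing.

(** * Pointwise inequalities *)

Definition posdef (R : numDomainType) (n : nat) (B : 'M[R]_n) :=
  forall v : 'rV[R]_n, v != 0 -> 0 < (v *m B *m v^T) 0 0.

(** Needed because [tensor_norm] picks its frame with [get], which returns a genuine frame only if
    one exists. Induction on the dimension by Schur complements. *)
Lemma exists_orthonormal_frame (R : realType) (n : nat) (B : 'M[R]_n) :
  B^T = B -> posdef B -> orthonormal_frame B !=set0.
Proof.
elim: n B => [|n IH] B Bsym Bpos.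
  by exists 0; apply/matrixP => -[].
pose B' : 'M[R]_(1 + n) := B.
pose a := B 0 0; pose b : 'rV[R]_n := ursubmx B'; pose D : 'M[R]_n := drsubmx B'.
have dlE : dlsubmx B' = b^T by rewrite /b trmx_ursub [B'^T]Bsym.
have ulE : ulsubmx B' = a%:M.
  apply/matrixP => i j; rewrite !ord1 !mxE eqxx mulr1n /a.
  by congr (B _ _); apply: val_inj.
have BE : B' = block_mx a%:M b b^T D by rewrite -dlE -ulE submxK.
have a_gt0 : 0 < a.
  have := Bpos (delta_mx 0 0); rewrite -rowE trmx_delta -colE !mxE; apply.
  by apply/eqP => /matrixP/(_ 0 0); rewrite !mxE !eqxx => /eqP; rewrite oner_eq0.
(* Elimination of the first row and column: conjugating by [P] leaves the pivot [a] and the Schur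
   complement [D'], which inherits symmetry and positivity. The pivot is normalised at the end by
   the inverse of its square root. *)
pose P : 'M[R]_(1 + n) := block_mx 1%:M 0 (- a^-1 *: b^T) 1%:M.
pose D' := D - a^-1 *: (b^T *m b).
have PBP : P *m B' *m P^T = block_mx a%:M 0 0 D'.
  rewrite BE /P tr_block_mx !mulmx_block !trmx1 !trmx0 linearZ /= trmxK.
  rewrite !(mul1mx, mulmx1, mul0mx, mulmx0, addr0, add0r).
  rewrite -!scalemxAl -!scalemxAr !mul_scalar_mx !mul_mx_scalar !scalerA.
  have e : - a^-1 * a = -1 by rewrite mulNr mulVf // gt_eqF.
  rewrite !e !scaleN1r !addNr mul0mx scaler0 add0r.
  by congr block_mx; rewrite /D' scaleNr addrC.
have /IH : D'^T = D'.
  have Dsym : D^T = D by rewrite /D trmx_drsub [B'^T]Bsym.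
  by rewrite /D' linearB /= linearZ /= trmx_mul trmxK Dsym.
case.
  move=> v v0.
  have := Bpos (row_mx 0 v *m P : 'rV[R]_(1 + n)).
  have rP : row_mx 0 v *m P = row_mx (v *m (- a^-1 *: b^T)) v.
    by rewrite /P mul_row_block !mul0mx !mulmx1 !add0r.
  rewrite -[(_ *m B)]/(_ *m B') trmx_mul !mulmxA -(mulmxA _ P) -(mulmxA _ (P *m _)) PBP.
  have -> : row_mx (0 : 'M[R]_1) v *m block_mx a%:M 0 0 D' *m (row_mx 0 v)^T =
      v *m D' *m v^T.
    rewrite (mul_row_block 0 v a%:M 0 0 D') !mul0mx !mulmx0 addr0 !add0r.
    rewrite tr_row_mx mul_row_col.
    by rewrite mul0mx add0r.
  apply; apply: contra_neq v0; rewrite rP => e0.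
  by rewrite -(row_mxKr (v *m (- a^-1 *: b^T)) v) e0; apply/matrixP => i j; rewrite !mxE.
move=> E' E'P.
pose Q (s : R) : 'M[R]_(1 + n) := block_mx s%:M 0 0 E'.
have QQ s : Q s *m block_mx a%:M 0 0 D' *m (Q s)^T = block_mx (s * a * s)%:M 0 0 1%:M.
  rewrite /Q tr_block_mx !mulmx_block !trmx0.
  by rewrite !(mul0mx, mulmx0, addr0, add0r) E'P tr_scalar_mx -!scalar_mxM.
exists (Q (Num.sqrt a)^-1 *m P).
rewrite /orthonormal_frame /= -[(_ *m B)]/(_ *m B') trmx_mul !mulmxA.
rewrite -(mulmxA _ P) -(mulmxA _ (P *m _)) PBP QQ.
have -> : (Num.sqrt a)^-1 * a * (Num.sqrt a)^-1 = 1.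
  rewrite -{2}(sqr_sqrtr (ltW a_gt0)) expr2 mulrA mulVf ?mul1r ?mulfV //;
  by rewrite gt_eqF // sqrtr_gt0.
by rewrite -scalar_mx_block.
Qed.

Section FrobeniusNorm.
Context (R : realType).

Definition frob (n : nat) (P : 'M[R]_n) : R := \sum_i \sum_j P i j ^+ 2.

Lemma frob_ge0 n (P : 'M[R]_n) : 0 <= frob P.
Proof. by apply: sumr_ge0 => i _; apply: sumr_ge0 => j _; rewrite sqr_ge0. Qed.

(** Lagrange's identity: twice the defect is a sum of squares. *)
Lemma cauchy_schwarz (I : finType) (a b : I -> R) :
  (\sum_i a i * b i) ^+ 2 <= (\sum_i a i ^+ 2) * (\sum_i b i ^+ 2).
Proof.
have : 0 <= \sum_i \sum_j (a i * b j - a j * b i) ^+ 2.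
  by apply: sumr_ge0 => i _; apply: sumr_ge0 => j _; rewrite sqr_ge0.
have -> : \sum_i \sum_j (a i * b j - a j * b i) ^+ 2 =
  ((\sum_i a i ^+ 2) * (\sum_i b i ^+ 2) - (\sum_i a i * b i) ^+ 2) *+ 2.
  transitivity (\sum_i \sum_j (a i ^+ 2 * b j ^+ 2 + b i ^+ 2 * a j ^+ 2
      - (a i * b i * (a j * b j)) *+ 2)).
    by apply: eq_bigr => i _; apply: eq_bigr => j _; ring.
  under eq_bigr do rewrite sumrB big_split /= sumrMnl -!mulr_sumr.
  rewrite sumrB big_split /= sumrMnl -!mulr_suml; ring.
by rewrite pmulrn_lge0 // subr_ge0.
Qed.

Lemma trace_frob n (P Q : 'M[R]_n) : Q^T = Q ->
  `|\tr (P *m Q)| <= Num.sqrt (frob P) * Num.sqrt (frob Q).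
Proof.
move=> Qs; rewrite -sqrtrM ?frob_ge0 // -sqrtr_sqr ler_wsqrtr //.
rewrite /frob !pair_bigA /=.
have -> : \tr (P *m Q) = \sum_(p : 'I_n * 'I_n) P p.1 p.2 * Q p.1 p.2.
  rewrite -(pair_bigA _ (fun i j => P i j * Q i j)) /=.
  apply: eq_bigr => i _; rewrite mxE; apply: eq_bigr => j _.
  by rewrite -[in LHS]Qs mxE.
exact: cauchy_schwarz.
Qed.

Lemma frob_trace n (Q : 'M[R]_n) : Q^T = Q -> \tr (Q *m Q) = frob Q.
Proof.
move=> Qs; apply: eq_bigr => i _; rewrite mxE; apply: eq_bigr => j _.
by rewrite -{2}Qs mxE expr2.
Qed.

(** Cauchy-Schwarz for the diagonal against the constant 1; the squares on the diagonal are part of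
    the full sum. *)
Lemma trace_sqr_le n (Q : 'M[R]_n) : (\tr Q) ^+ 2 <= n%:R * frob Q.
Proof.
have := cauchy_schwarz (fun _ : 'I_n => 1) (fun i => Q i i).
rewrite (eq_bigr (fun i => Q i i)); last by move=> i _; rewrite mul1r.
move=> /le_trans; apply.
rewrite expr1n sumr_const card_ord ler_wpM2l ?ler0n //.
apply: ler_sum => i _; rewrite (bigD1 i) //= lerDl.
by apply: sumr_ge0 => j _; rewrite sqr_ge0.
Qed.

Lemma frob_dyad n (e : 'cV[R]_n) : frob (e *m e^T) = (e^T *m e) 0 0 ^+ 2.
Proof.
rewrite -frob_trace; last by rewrite trmx_mul trmxK.
rewrite -!mulmxA mxtrace_mulC.
have -> : e^T *m (e *m e^T) *m e = (e^T *m e) *m (e^T *m e) by rewrite !mulmxA.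
by rewrite /mxtrace big_ord1 [LHS]mxE big_ord1 expr2.
Qed.

Lemma dot_ge0 n (e : 'cV[R]_n) : 0 <= (e^T *m e) 0 0.
Proof. by rewrite mxE; apply: sumr_ge0 => i _; rewrite mxE -expr2 sqr_ge0. Qed.

(** The quadratic form is a trace against the dyad of [e], whose Frobenius norm is the squared
    length of [e]. *)
Lemma quad_frob n (P : 'M[R]_n) (e : 'cV[R]_n) :
  (e^T *m P *m e) 0 0 <= Num.sqrt (frob P) * (e^T *m e) 0 0.
Proof.
have := @trace_frob _ P (e *m e^T); rewrite trmx_mul trmxK => /(_ erefl).
rewrite frob_dyad sqrtr_sqr (ger0_norm (dot_ge0 _)); apply: le_trans.
by rewrite mulmxA mxtrace_mulC mulmxA /mxtrace big_ord1 ler_norm.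
Qed.

End FrobeniusNorm.

Section Metric.
Context (R : realType) (n : nat) (B H : 'M[R]_n).
Hypothesis B_sym : B^T = B.
Hypothesis B_pos : posdef B.
Hypothesis HB : H *m B = 1%:M.

Let E := get (orthonormal_frame B).

Lemma frameP : E *m B *m E^T = 1%:M.
Proof. exact: (getPex (exists_orthonormal_frame B_sym B_pos)). Qed.

(** Factoring the inverse metric through the frame turns contractions with [H] into plain matrix
    products of frame components, where the Frobenius inequalities apply. *)
Lemma inv_frame : H = E^T *m E.
Proof.
have e : B *m E^T *m E = 1%:M by apply: mulmx1C; rewrite mulmxA frameP.
by rewrite -[LHS]mulmx1 -e !mulmxA HB mul1mx.
Qed.

Lemma posdef_inv (w : 'cV[R]_n) : 0 <= (w^T *m H *m w) 0 0.
Proof.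
rewrite inv_frame mulmxA -trmx_mul -mulmxA; exact: dot_ge0.
Qed.

Lemma tensor_normE X : tensor_norm B X = Num.sqrt (frob (E *m X *m E^T)).
Proof. by []. Qed.

Lemma trHH X Y : \tr (H *m X *m H *m Y) =
  \tr ((E *m X *m E^T) *m (E *m Y *m E^T)).
Proof. by rewrite inv_frame -!mulmxA mxtrace_mulC !mulmxA. Qed.

Lemma frame_sym X : X^T = X -> (E *m X *m E^T)^T = E *m X *m E^T.
Proof. by move=> Xs; rewrite !trmx_mul trmxK Xs mulmxA. Qed.

Lemma trHH_norm X : X^T = X -> \tr (H *m X *m H *m X) = tensor_norm B X ^+ 2.
Proof.
move=> Xs; rewrite trHH frob_trace ?frame_sym // tensor_normE sqr_sqrtr //.
exact: frob_ge0.
Qed.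

Lemma trHH_le X Y : Y^T = Y ->
  `|\tr (H *m X *m H *m Y)| <= tensor_norm B X * tensor_norm B Y.
Proof. by move=> Ys; rewrite trHH; apply: trace_frob; exact: frame_sym. Qed.

Lemma trH_sqr_le X : X^T = X -> (\tr (H *m X)) ^+ 2 <= n%:R * tensor_norm B X ^+ 2.
Proof.
move=> Xs; rewrite tensor_normE sqr_sqrtr ?frob_ge0 //.
by rewrite inv_frame -mulmxA mxtrace_mulC trace_sqr_le.
Qed.

Lemma quadH_le X (w : 'cV[R]_n) :
  (w^T *m H *m X *m H *m w) 0 0 <= tensor_norm B X * (w^T *m H *m w) 0 0.
Proof.
have := quad_frob (E *m X *m E^T) (E *m w).
by rewrite tensor_normE inv_frame trmx_mul !mulmxA.
Qed.

End Metric.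

(* At a point, [X], [w], [s], [rs], [rq], [UL] stand for the values of Delta u,
   |grad u|^2 / u, |u Hess (log u)|, <Ric, u Hess (log u)>, Ric (grad u, grad u) / u
   and u log (A / u); the conclusion bounds the value of the heat operator on
   the quantity assumed to be positive. *)
Lemma box_q3_le0 (R : realType) (n : nat) (K be t u v X w s y rs rq UL : R) :
  0 <= K -> 0 < be -> 2%:R * be ^+ 2 = 1 -> 0 < t -> 0 < u -> u * v = 1 ->
  0 <= w -> 0 <= s -> y = X - w -> y ^+ 2 <= n%:R * s ^+ 2 ->
  rs <= K * s -> rq <= K * w -> t * w <= UL ->
  let c := t / 2%:R + be * K * t ^+ 2 in
  let a := n%:R + be * K * t in
  let b := 5%:R / 2%:R + (2%:R + be) * K * t in
  0 < t * X + c * w - a * u - b * UL ->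
  X + t * (rs + rq) *+ 2 + (1 / 2%:R + 2%:R * be * K * t) * w
    - c * (v * s ^+ 2) *+ 2 - be * K * u - (2%:R + be) * K * UL - b * w <= 0.
Proof.
move=> K0 be0 be2 t0 u0 uv w0 s0 yE ys rsK rqK tw c a b q3.
have v0 : 0 < v by rewrite -(pmulr_rgt0 _ u0) uv.
have Kt : 0 <= K * t by rewrite mulr_ge0 // ltW.
have bKt : 0 <= be * (K * t) by rewrite mulr_ge0 // ltW.
have b0 : 0 <= b by rewrite /b; nra.
have bUL : b * (t * w) <= b * UL by rewrite ler_wpM2l.
(* Replacing [UL] by [t * w] in [q3], the coefficient of [t * w] is 1 + 1/2 - 5/2 < 0, plus [K * t]
   times be - (2 + be) < 0. Hence [t * y] exceeds [a * u], which is at least [n%:R * u]. *)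
have ty : n%:R * u < t * y.
  have h1 : 0 <= be * (K * t) * u by rewrite mulr_ge0 // ltW.
  have h2 : 0 <= t * w by rewrite mulr_ge0 // ltW.
  have h3 : 0 <= K * t * (t * w) by rewrite mulr_ge0.
  move: q3 bUL; rewrite /c /a /b yE => q3 bUL.
  nra.
have y0 : 0 < y.
  rewrite -(pmulr_rgt0 _ t0); apply: le_lt_trans ty.
  by rewrite mulr_ge0 ?ler0n // ltW.
(* In dimension 0 the trace bound would force [y ^+ 2 <= 0]. Positivity is needed to cancel [n]
   next. *)
have n0 : (0 < n)%N.
  case: (posnP n) => // e; move: ys; rewrite e mul0r => /(lt_le_trans _).
  by move=> /(_ 0); rewrite exprn_gt0 // ltxx => /(_ isT).
(* Chain n u y <= t y^2 <= t n s^2, cancel n, and multiply by v = 1 / u. *)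
have tz : y <= t * (v * s ^+ 2).
  have e1 : u * y <= t * s ^+ 2.
    have nn : 0 < n%:R :> R by rewrite ltr0n.
    rewrite -(ler_pM2l nn).
    have e2 : n%:R * u * y <= t * y * y by rewrite ler_wpM2r // ltW.
    have e3 : t * y ^+ 2 <= t * (n%:R * s ^+ 2) by rewrite ler_wpM2l // ltW.
    rewrite expr2 in e3; lra.
  have := ler_wpM2l (ltW v0) e1.
  have -> : v * (u * y) = y by rewrite (mulrA v) (mulrC v) uv mul1r.
  by rewrite mulrCA.
(* AM-GM: [0 <= v * (2 * be * t * s - u)^2], where [2 * be^2 = 1] *)
have ts : 2%:R * t * s <= be * (2%:R * t ^+ 2 * (v * s ^+ 2) + u).
  have e : 0 <= be * v * (2%:R * be * t * s - u) ^+ 2.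
    by rewrite mulr_ge0 ?sqr_ge0 // mulr_ge0 // ltW.
  have -> : be * (2%:R * t ^+ 2 * (v * s ^+ 2) + u) =
      2%:R * t * s + be * v * (2%:R * be * t * s - u) ^+ 2.
    have -> : be * v * (2%:R * be * t * s - u) ^+ 2 =
        be * ((2%:R * be ^+ 2) * (2%:R * t ^+ 2 * (v * s ^+ 2)))
        - (2%:R * be ^+ 2) * (2%:R * t * s) * (u * v) + be * (u * v) * u by ring.
    by rewrite be2 uv; ring.
  by rewrite lerDl.
have Kts := ler_wpM2l K0 ts.
have trs : t * rs <= t * (K * s) by rewrite ler_wpM2l // ltW.
have trq : t * rq <= t * (K * w) by rewrite ler_wpM2l // ltW.
have KUL : K * (t * w) <= K * UL by rewrite ler_wpM2l.
have beKUL : be * (K * (t * w)) <= be * (K * UL) by rewrite ler_wpM2l // ltW.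
have Ktw : 0 <= K * t * w by rewrite mulr_ge0.
move: (v * s ^+ 2) tz ts Kts => z tz ts Kts.
have XE : X = y + w by rewrite yE subrK.
(* With z = v s^2, the part t z of 2 c z absorbs y by [tz], and the part 2 be K t^2 z together with
   be K u absorbs the Ricci term in s by [Kts]. The rest is w times 1 + 1/2 - 5/2, and at most K t w
   times 2 + 2 be - 2 (2 + be); both factors are negative. *)
rewrite XE /c /b; nra.
Qed.

(** * Directional derivatives of C^k functions *)

Section DirectionalDerivatives.
Context (R : realType) (V : normedModType R).
Implicit Types (f g : V -> R) (x v w : V) (U : set V) (k : nat).

Lemma Ck_continuous k U f x : Ck k U f -> U x -> {for x, continuous f}.
Proof. by case: k => [|k] [h _]; exact: h. Qed.

Lemma Ck_derivable k U f x v : Ck k.+1 U f -> U x -> derivable f x v.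
Proof. by move=> [_ /(_ v)[h _]]; exact: h. Qed.

Lemma Ck_derive k U f v : Ck k.+1 U f -> Ck k U ('D_v f).
Proof. by move=> [_ /(_ v)[_]]. Qed.

Lemma CkW k U f : Ck k.+1 U f -> Ck k U f.
Proof.
elim: k f => [|k IH] f [fc fd]; first by split.
split => // v; have [dv Dv] := fd v; split => //; exact: IH.
Qed.

Lemma near_open U x (P : V -> Prop) :
  open U -> U x -> (forall y, U y -> P y) -> \forall y \near x, P y.
Proof. by move=> oU Ux UP; apply: filterS (open_nbhs_nbhs (conj oU Ux)). Qed.

(** Passes regularity from local extensions to the function itself. The induction replaces [F] by
    its derivative, which agrees with that of [f] because [U] and [N] are open. *)
Lemma Ck_local k N f : open N ->
  (forall x, N x -> exists U F, [/\ open U, U x, Ck k U F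
      & forall y, U y -> N y -> F y = f y]) -> Ck k N f.
Proof.
move=> oN; elim: k f => [|k IH] f H.
  split=> // x Nx; have [U [F [oU Ux FU Ff]]] := H x Nx.
  have Fc := Ck_continuous FU Ux.
  have e : {near x, F =1 f}.
    by apply: (near_open (openI oU oN)) => // y [Uy Ny]; exact: Ff.
  have := Fc; rewrite /prop_for /continuous_at (nbhs_singleton e).
  by apply: cvg_trans; exact: near_eq_cvg.
split=> [x Nx|v].
  suff fN : Ck k N f by exact: (Ck_continuous fN).
  apply: IH => y Ny; have [U [F [oU Uy FU Ff]]] := H y Ny.
  by exists U, F; split => //; exact: CkW.
split=> [x Nx|].
  have [U [F [oU Ux FU Ff]]] := H x Nx.
  apply: (near_eq_derivable _ (Ck_derivable FU Ux)).
  by apply: (near_open (openI oU oN)) => // y [Uy Ny]; exact: Ff.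
apply: IH => x Nx; have [U [F [oU Ux FU Ff]]] := H x Nx.
exists U, ('D_v F); split => //; first exact: Ck_derive.
move=> y Uy Ny; apply: near_eq_derive.
by apply: (near_open (openI oU oN)) => // z [Uz Nz]; exact: Ff.
Qed.

Lemma Ck_eq k U f g : open U -> (forall x, U x -> f x = g x) ->
  Ck k U f -> Ck k U g.
Proof.
move=> oU fg fU; apply: Ck_local => // x Ux.
by exists U, f; split=> // y Uy _; exact: fg.
Qed.

Lemma Ck_sub k U U' f : U' `<=` U -> Ck k U f -> Ck k U' f.
Proof.
elim: k f => [|k IH] f UU' [fc fd]; first by split=> // x /UU'; exact: fc.
split=> [x /UU'|v]; first exact: fc.
by have [dv Dv] := fd v; split=> [x /UU'|]; [exact: dv|exact: IH].
Qed.

Lemma Ck_cst k U (c : R) : open U -> Ck k U (fun=> c).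
Proof.
move=> oU; elim: k c => [|k IH] c; first by split=> // x _; exact: cvg_cst.
split=> [x _|v]; first exact: cvg_cst.
split=> [x _|]; first exact: derivable_cst.
by apply: Ck_eq (IH 0) => // x _; rewrite derive_cst.
Qed.

Lemma Ck_add k U f g : open U -> Ck k U f -> Ck k U g ->
  Ck k U (fun x => f x + g x).
Proof.
move=> oU; elim: k f g => [|k IH] f g [fc fd] [gc gd].
  by split=> // x Ux; apply: cvgD; [exact: fc|exact: gc].
split=> [x Ux|v]; first by apply: cvgD; [exact: fc|exact: gc].
have [df Df] := fd v; have [dg Dg] := gd v; split=> [x Ux|].
  by apply: derivableD; [exact: df|exact: dg].
apply: Ck_eq (IH _ _ Df Dg) => // x Ux.
by rewrite -deriveD //; [exact: df|exact: dg].
Qed.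

Lemma Ck_mul k U f g : open U -> Ck k U f -> Ck k U g ->
  Ck k U (fun x => f x * g x).
Proof.
move=> oU; elim: k f g => [|k IH] f g fU gU.
  split=> // x Ux.
  by apply: cvgM; [exact: (Ck_continuous fU)|exact: (Ck_continuous gU)].
split=> [x Ux|v].
  by apply: cvgM; [exact: (Ck_continuous fU)|exact: (Ck_continuous gU)].
split=> [x Ux|].
  by apply: derivableM; [exact: (Ck_derivable fU)|exact: (Ck_derivable gU)].
apply: (@Ck_eq _ _ (fun x => f x * 'D_v g x + g x * 'D_v f x)) => // [x Ux|].
  by symmetry; apply: (@deriveM R V f g x v);
    [exact: (Ck_derivable fU)|exact: (Ck_derivable gU)].
apply: Ck_add => //; apply: IH; by [exact: CkW|exact: Ck_derive].
Qed.

Lemma Ck_opp k U f : open U -> Ck k U f -> Ck k U (fun x => - f x).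
Proof.
move=> oU fU; apply: (@Ck_eq _ _ (fun x => -1 * f x)) => // [x Ux|].
  by rewrite mulN1r.
by apply: Ck_mul => //; exact: Ck_cst.
Qed.

Lemma Ck_inv k U f : open U -> (forall x, U x -> f x != 0) -> Ck k U f ->
  Ck k U (fun x => (f x)^-1).
Proof.
move=> oU f0; elim: k => [|k IH] fU.
  by split=> // x Ux; apply: cvgV; [exact: f0|exact: (Ck_continuous fU)].
split=> [x Ux|v]; first by apply: cvgV; [exact: f0|exact: (Ck_continuous fU)].
split=> [x Ux|]; first by apply: derivableV; [exact: f0|exact: (Ck_derivable fU)].
have fi := IH (CkW fU).
apply: (@Ck_eq _ _ (fun x => - ((f x)^-1 * (f x)^-1 * 'D_v f x))) => // [x Ux|].
  rewrite deriveV; [|exact: f0|exact: (Ck_derivable fU)].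
  by rewrite -mulNr expr2 invfM.
apply: Ck_opp => //; apply: Ck_mul => //; last exact: Ck_derive.
exact: Ck_mul.
Qed.

Lemma is_derive_line f x v (s l : R) :
  is_derive (s *: v + x) v f l -> is_derive s 1 (fun h : R => f (h *: v + x)) l.
Proof.
move=> [dl lE].
have e : (fun h => h^-1 *: ((f \o shift (s *: v + x)) (h *: v) - f (s *: v + x))) =
   (fun h : R => h^-1 *: (((fun h : R => f (h *: v + x)) \o shift s) (h *: (1 : R))
     - f (s *: v + x))).
  apply/funext => h /=; congr (_ *: (f _ - _)).
  by rewrite addrA -scalerDl; congr (_ *: _ + _); rewrite [h *: _]mulr1.
by split; rewrite /derivable /derive -?e.
Qed.

Lemma derive_line f x v : 'D_v f x = 'D_1 (fun h : R => f (h *: v + x)) 0.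
Proof.
rewrite /derive; set g1 := fun h => h^-1 *: _; set g2 := fun h => h^-1 *: _.
suff -> : g1 = g2 by [].
apply/funext => h; rewrite /g1 /g2 /=.
by rewrite scale0r add0r addr0 [h *: (1 : R)]mulr1.
Qed.

Lemma derivable_scale f x v (c : R) :
  derivable f x v -> is_derive x (c *: v) f (c * 'D_v f x).
Proof.
move=> df; pose g h := f (h *: v + x).
have dg : is_derive (0 * c) 1 g ('D_v f x).
  by apply: (@is_derive_line f x v); rewrite mul0r scale0r add0r; exact: derivableP.
have dc : is_derive (0 : R) 1 (fun h : R => h * c) c.
  have := @is_deriveM _ _ (fun h : R => h) (fun=> c) 0 1 1 0 _ _.
  move=> /(_ _ _)/is_derive_eq; apply.
  by rewrite scaler0 add0r [c *: _]mulr1.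
have [dgc gcE] := @is_derive1_comp R g _ 0 _ _ dg dc.
have e : g \o ( *%R^~ c) = fun h : R => f (h *: (c *: v) + x).
  by apply/funext => h /=; rewrite /g scalerA.
rewrite e in dgc gcE; split; first by apply/derivable1P.
by rewrite derive_line gcE mulrC.
Qed.

Lemma is_derive_ln f x v : 0 < f x -> derivable f x v ->
  is_derive x v (fun y => ln (f y)) ((f x)^-1 * 'D_v f x).
Proof.
move=> f0 dfx; have df : is_derive (0 : R) 1 (fun h => f (h *: v + x)) ('D_v f x).
  by apply: (@is_derive_line f x v); rewrite scale0r add0r; exact: derivableP.
have dl : is_derive (f (0 *: v + x)) 1 (@ln R) (f x)^-1.
  by rewrite scale0r add0r; exact: is_derive1_ln.
have [dc cE] := @is_derive1_comp R _ (fun h : R => f (h *: v + x)) 0 _ _ dl df.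
by split; [apply/derivable1P|rewrite derive_line].
Qed.

Lemma Ck_ln k U f : open U -> (forall x, U x -> 0 < f x) -> Ck k U f ->
  Ck k U (fun x => ln (f x)).
Proof.
move=> oU f0.
have c x : {for x, continuous f} -> U x -> {for x, continuous (fun x => ln (f x))}.
  move=> fc Ux; apply: (@continuous_comp _ _ _ f (@ln R)) => //.
  by apply: continuous_ln; exact: f0.
case: k => [|k] fU.
  by split=> // x Ux; apply: c => //; exact: (Ck_continuous fU).
split=> [x Ux|v]; first by apply: c => //; exact: (Ck_continuous fU).
have D x : U x -> is_derive x v (fun x => ln (f x)) ((f x)^-1 * 'D_v f x).
  by move=> Ux; apply: is_derive_ln; [exact: f0|exact: (Ck_derivable fU)].
split=> [x Ux|]; first by have [] := D x Ux.
apply: (@Ck_eq _ _ (fun x => (f x)^-1 * 'D_v f x)) => // [x Ux|].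
  by have [_ ->] := D x Ux.
apply: Ck_mul => //; last exact: Ck_derive.
apply: Ck_inv => //; last exact: CkW.
by move=> x Ux; rewrite gt_eqF // f0.
Qed.

Lemma mvt_line f x v :
  (forall s : R, 0 <= s <= 1 -> derivable f (s *: v + x) v) ->
  exists2 s : R, 0 <= s <= 1 & f (v + x) - f x = 'D_v f (s *: v + x).
Proof.
move=> df; pose g h := f (h *: v + x).
have dg (s : R) : 0 <= s <= 1 -> is_derive s 1 g ('D_v f (s *: v + x)).
  by move=> s01; apply: (@is_derive_line f x v); exact/derivableP/df.
have [||s] := @MVT R g (fun s : R => 'D_v f (s *: v + x)) 0 1 ltr01.
- by move=> s; rewrite in_itv /= => /andP[s0 s1]; apply: dg; rewrite !ltW.
- apply: derivable_within_continuous => s; rewrite in_itv /= => s01.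
  by have [] := dg s s01.
rewrite in_itv /= => /andP[s0 s1].
rewrite /g scale1r scale0r add0r subr0 mulr1 => e.
by exists s => //; rewrite !ltW.
Qed.

Lemma near_normP x (P : V -> Prop) : (\forall y \near x, P y) ->
  exists2 e : R, 0 < e & forall y, `|y - x| < e -> P y.
Proof.
move=> /nbhs_ballP[e /= e0 eP]; exists e => // y xy; apply: eP.
by rewrite -ball_normE /ball_ /= distrC.
Qed.

(** Additivity in the direction is not built into directional derivatives; it comes from their
    continuity. The increment along [v + w] is split at [h *: w + x], and the mean value theorem
    writes the first piece as a derivative along [v] at a point tending to [x]. *)
Lemma derive_add U f x v w : open U -> U x -> Ck 1 U f ->
  'D_(v + w) f x = 'D_v f x + 'D_w f x.
Proof.
move=> oU Ux fU.
have cD : {for x, continuous ('D_v f)}.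
  by apply: (Ck_continuous (k := 0)) Ux; exact: Ck_derive.
apply: cvg_lim => //.
have dw : (h^-1 *: (f (h *: w + x) - f x)) @[h --> 0^'] --> 'D_w f x.
  exact: (Ck_derivable fU Ux).
suff dv : (h^-1 *: (f (h *: (v + w) + x) - f (h *: w + x))) @[h --> 0^'] --> 'D_v f x.
  rewrite [X in X @ _ --> _](_ : _ = fun h : R =>
    h^-1 *: (f (h *: (v + w) + x) - f (h *: w + x)) +
    h^-1 *: (f (h *: w + x) - f x)); first exact: cvgD.
  by apply/funext => h; rewrite /= -scalerDr addrA subrK.
apply/cvgrPdist_lt => e e0.
have nU : \forall y \near x, U y by exact: (near_open oU Ux).
have nD : \forall y \near x, `|'D_v f x - 'D_v f y| < e.
  by move/cvgrPdist_lt: cD; apply.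
have [d d0 dP] := near_normP (filterI nU nD).
have c0 : 0 < `|v| + `|w| + 1 by rewrite ltr_wpDl // addr_ge0.
near=> h.
have h0 : h != 0 by near: h; exact: nbhs_dnbhs_neq.
have hd : `|h| * (`|v| + `|w| + 1) < d.
  by rewrite -ltr_pdivlMr //; near: h; apply: dnbhs0_lt; rewrite divr_gt0.
have yP (s : R) : 0 <= s <= 1 ->
    U (s *: (h *: v) + (h *: w + x)) /\
    `|'D_v f x - 'D_v f (s *: (h *: v) + (h *: w + x))| < e.
  move=> /andP[s0 s1]; apply: dP; rewrite addrA addrK.
  apply: le_lt_trans hd; apply: (le_trans (ler_normD _ _)).
  rewrite !normrZ (ger0_norm s0) mulrCA -mulrDr ler_wpM2l //.
  by rewrite -addrA lerD // ?ler_wpDr // ler_piMl.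
have [s s01|s s01 e1] := @mvt_line f (h *: w + x) (h *: v).
  have [Uy _] := yP s s01.
  by have [] := derivable_scale h (Ck_derivable (v := v) fU Uy).
have [Uy ey] := yP s s01.
have [_ e2] := derivable_scale h (Ck_derivable (v := v) fU Uy).
by rewrite (scalerDr h v w) -addrA e1 e2 [_ *: _]mulrA mulVf // mul1r.
Unshelve. all: by end_near. Qed.

Lemma derive_sum_dir (I : Type) (r : seq I) (a : I -> R) (e : I -> V) U f x :
  open U -> U x -> Ck 1 U f ->
  'D_(\sum_(i <- r) a i *: e i) f x = \sum_(i <- r) a i * 'D_(e i) f x.
Proof.
move=> oU Ux fU; elim: r => [|i r IH]; first by rewrite !big_nil derive0.
rewrite !big_cons (derive_add _ _ oU Ux fU) IH; congr (_ + _).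
by have [_] := derivable_scale (a i) (Ck_derivable (v := e i) fU Ux).
Qed.

(** The mean value theorem twice: along [v] for the increment [p] in direction [w], then along [w]
    for the derivative along [v]. *)
Lemma second_difference U f x v w : open U -> Ck 2 U f ->
  (forall s s' : R, 0 <= s <= 1 -> 0 <= s' <= 1 -> U (s *: v + s' *: w + x)) ->
  exists s s' : R, [/\ 0 <= s <= 1, 0 <= s' <= 1 &
   f (v + w + x) - f (v + x) - f (w + x) + f x
     = 'D_w ('D_v f) (s *: v + s' *: w + x)].
Proof.
move=> oU fU H; pose p y := f (w + y) - f y.
have i01 : (0 : R) <= 1 <= (1 : R) by rewrite ler01 lexx.
have i00 : (0 : R) <= 0 <= (1 : R) by rewrite ler01 lexx.
have dU y : U y -> derivable f y v by exact: (Ck_derivable (CkW fU)).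
have U0 (s : R) : 0 <= s <= 1 -> U (s *: v + x).
  by move=> s01; have := H s 0 s01 i00; rewrite scale0r addr0.
have U1 (s : R) : 0 <= s <= 1 -> U (w + (s *: v + x)).
  by move=> s01; have := H s 1 s01 i01; rewrite scale1r addrAC addrC.
have dfw (s : R) : 0 <= s <= 1 -> is_derive (s *: v + x) v (fun y => f (w + y))
    ('D_v f (w + (s *: v + x))).
  move=> s01; have dUs := dU _ (U1 s s01); move: (s *: v + x) dUs => z dUs.
  have e : (fun h : R => h^-1 *: ((f \o shift (w + z)) (h *: v) - f (w + z))) =
      (fun h : R => h^-1 *: (((fun y => f (w + y)) \o shift z) (h *: v) - f (w + z))).
    by apply/funext => h /=; rewrite addrCA.
  by split; rewrite /derivable /derive -?e.
have [s s01|s s01 e1] := @mvt_line p x v.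
  apply: derivableB; first by have [] := dfw s s01.
  exact/dU/U0.
have e2 : 'D_v p (s *: v + x) = 'D_v f (w + (s *: v + x)) - 'D_v f (s *: v + x).
  have [dw <-] := dfw s s01; apply: deriveB => //; exact/dU/U0.
have [s' s'01|s' s'01 e3] := @mvt_line ('D_v f) (s *: v + x) w.
  apply: (Ck_derivable (Ck_derive v fU)).
  by rewrite addrA (addrC (s' *: w)); exact: H.
exists s, s'; split=> //.
rewrite -[s *: v + _ + _]addrA (addrCA (s *: v)) -e3 -e2 -e1 /p.
rewrite (addrA w) (addrC w v); ring.
Qed.

Lemma Ck_ball U x : open U -> U x ->
  exists2 d : R, 0 < d & forall y, `|y - x| < d -> U y.
Proof. by move=> oU Ux; apply: near_normP; exact: (near_open oU Ux). Qed.

(** Schwarz's theorem. The second difference is symmetric in the two directions, so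
    [second_difference] used both ways yields a point for each mixed derivative, both near [x],
    where the values coincide; continuity concludes. *)
Lemma derive_comm U f x v w : open U -> U x -> Ck 2 U f ->
  'D_v ('D_w f) x = 'D_w ('D_v f) x.
Proof.
move=> oU Ux fU.
apply/eqP; rewrite -subr_eq0 -normr_eq0; apply/eqP.
apply/le_anti/andP; split=> //; apply/ler_addgt0Pl => e e0; rewrite addr0.
have c1 : {for x, continuous ('D_v ('D_w f))}.
  by apply: (Ck_continuous (k := 0)) Ux; do 2 apply: Ck_derive.
have c2 : {for x, continuous ('D_w ('D_v f))}.
  by apply: (Ck_continuous (k := 0)) Ux; do 2 apply: Ck_derive.
have e20 : 0 < e / 2%:R by rewrite divr_gt0.
have n1 : \forall y \near x, `|'D_v ('D_w f) x - 'D_v ('D_w f) y| < e / 2%:R.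
  by move/cvgrPdist_lt: c1; apply.
have n2 : \forall y \near x, `|'D_w ('D_v f) x - 'D_w ('D_v f) y| < e / 2%:R.
  by move/cvgrPdist_lt: c2; apply.
have [d1 d10 P1] := near_normP n1; have [d2 d20 P2] := near_normP n2.
have [d3 d30 P3] := Ck_ball oU Ux.
pose d := Num.min d1 (Num.min d2 d3).
have d0 : 0 < d by rewrite !lt_min d10 d20 d30.
have c0 : 0 < `|v| + `|w| + 1 by rewrite ltr_wpDl // addr_ge0.
have [h h0 hd] : exists2 h : R, 0 < h & h * (`|v| + `|w| + 1) < d.
  exists (d / 2%:R / (`|v| + `|w| + 1)); first by rewrite !divr_gt0.
  by rewrite divfK ?gt_eqF // ltr_pdivrMr // ltr_pMr // ltr1n.
have near_x (s s' : R) (a b : V) : 0 <= s <= 1 -> 0 <= s' <= 1 ->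
    `|a| + `|b| = `|v| + `|w| -> `|s *: (h *: a) + s' *: (h *: b) + x - x| < d.
  move=> /andP[s0 s1] /andP[s'0 s'1] ab; rewrite addrK.
  apply: le_lt_trans hd; apply: (le_trans (ler_normD _ _)).
  rewrite !normrZ (ger0_norm s0) (ger0_norm s'0) (gtr0_norm h0) !(mulrCA _ h).
  rewrite -mulrDr ler_wpM2l ?(ltW h0) // -ab.
  apply: (@le_trans _ _ (`|a| + `|b|)); last by rewrite lerDl.
  by apply: lerD; rewrite ler_piMl.
have dd1 y : `|y - x| < d -> `|y - x| < d1 by rewrite !lt_min => /and3P[].
have dd2 y : `|y - x| < d -> `|y - x| < d2 by rewrite !lt_min => /and3P[].
have dd3 y : `|y - x| < d -> `|y - x| < d3 by rewrite !lt_min => /and3P[].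
have D2 a b y : U y -> 'D_(h *: b) ('D_(h *: a) f) y = h ^+ 2 * 'D_b ('D_a f) y.
  move=> Uy.
  have -> : 'D_(h *: b) ('D_(h *: a) f) y = 'D_(h *: b) (fun y => h * 'D_a f y) y.
    apply: near_eq_derive; apply: (near_open oU Uy) => z Uz.
    by have [_] := derivable_scale h (Ck_derivable (v := a) (CkW fU) Uz).
  have dDa := Ck_derivable (v := b) (Ck_derive a fU) Uy.
  have [dh Dh] := derivable_scale h dDa.
  have -> : 'D_(h *: b) (fun y => h * 'D_a f y) y = h * 'D_(h *: b) ('D_a f) y.
    exact: (@deriveZ _ _ _ ('D_a f) h).
  by rewrite Dh mulrA expr2.
have Us (s s' : R) (a b : V) : 0 <= s <= 1 -> 0 <= s' <= 1 ->
    `|a| + `|b| = `|v| + `|w| -> U (s *: (h *: a) + s' *: (h *: b) + x).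
  by move=> s01 s'01 ab; apply/P3/dd3/near_x.
have [|s [s' [s01 s'01 E1]]] := @second_difference U f x (h *: v) (h *: w) oU fU.
  by move=> s s' s01 s'01; exact: Us.
have [|r [r' [r01 r'01 E2]]] := @second_difference U f x (h *: w) (h *: v) oU fU.
  by move=> r r' r01 r'01; apply: Us => //; rewrite addrC.
rewrite D2 in E1; last exact: Us.
rewrite D2 in E2; last by apply: Us => //; rewrite addrC.
have E : 'D_w ('D_v f) (s *: (h *: v) + s' *: (h *: w) + x) =
         'D_v ('D_w f) (r *: (h *: w) + r' *: (h *: v) + x).
  have h20 : h ^+ 2 != 0 by rewrite expf_neq0 // gt_eqF.
  apply: (mulfI h20); rewrite -E1 -E2 (addrC (h *: w) (h *: v)); ring.
have B1 := P2 _ (dd2 _ (near_x _ _ _ _ s01 s'01 erefl)).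
have B2 := P1 _ (dd1 _ (near_x _ _ _ _ r01 r'01 (addrC _ _))).
rewrite E in B1; move: B1 B2.
move: ('D_v _ (_ + x)) ('D_v _ x) ('D_w _ x) => a b c B1 B2.
apply/ltW; rewrite (splitr e); apply: le_lt_trans (ltrD B2 B1).
have -> : b - c = (b - a) + (a - c) by ring.
by apply: (le_trans (ler_normD _ _)); rewrite lerD // distrC.
Qed.

(** Were the second derivative positive, the first would be positive just beyond [x] along [v], and
    the mean value theorem would give a larger value there. *)
Lemma second_derivative_at_max U f x v : open U -> U x -> Ck 2 U f ->
  (forall y, U y -> f y <= f x) -> 'D_v f x = 0 /\ 'D_v ('D_v f) x <= 0.
Proof.
move=> oU Ux fU fmax.
have [d d0 dU] := Ck_ball oU Ux.
have c0 : 0 < `|v| + 1 by rewrite ltr_wpDl.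
pose e := d / (`|v| + 1).
have e0 : 0 < e by rewrite divr_gt0.
have Uh (h : R) : `|h| < e -> U (h *: v + x).
  move=> he; apply: dU; rewrite addrK normrZ.
  apply: (@le_lt_trans _ _ (`|h| * (`|v| + 1))); last by rewrite -ltr_pdivlMr.
  by rewrite ler_wpM2l // lerDl.
pose g (h : R) : R := f (h *: v + x); pose g' (h : R) : R := 'D_v f (h *: v + x).
have dg (h : R) : `|h| < e -> is_derive h (1 : R) g (g' h).
  by move=> he; apply: (@is_derive_line f x v); apply/derivableP/(Ck_derivable fU)/Uh.
have ie : 0 \in `]-e, e[%R by rewrite in_itv /= oppr_lt0 e0.
have g'0 : g' 0 = 0.
  have [|||_ E0] := @derive1_at_max R g (-e) e 0 _ _ ie.
  - by rewrite (le_trans (y := 0)) ?oppr_le0 // ltW.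
  - by move=> t; rewrite in_itv /= -ltr_norml => /dg[].
  - move=> t; rewrite in_itv /= -ltr_norml => te.
    by rewrite /g scale0r add0r; apply: fmax; exact: Uh.
  have h0e : `|0 : R| < e by rewrite normr0.
  by rewrite -[RHS]E0; have [_ ->] := dg 0 h0e.
have Dx : 'D_v f x = 0 by rewrite -g'0 /g' scale0r add0r.
split=> //; rewrite leNgt; apply/negP => l0.
have : (h^-1 *: ('D_v f (h *: v + x) - 'D_v f x)) @[h --> 0^'] --> 'D_v ('D_v f) x.
  exact: (Ck_derivable (Ck_derive v fU) Ux).
move=> /cvgr_gt /(_ _ l0) /=; rewrite near_withinE => /nbhs_ballP[r /= r0 rP].
pose h := Num.min r e / 2%:R.
have m0 : 0 < Num.min r e by rewrite lt_min r0 e0.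
have h0 : 0 < h by rewrite divr_gt0.
have hm : h < Num.min r e by rewrite ltr_pdivrMr // ltr_pMr // ltr1n.
have gpos c : c \in `]0, h[%R -> 0 < g' c.
  rewrite in_itv /= => /andP[c_gt0 ch].
  have cr : c < r by rewrite (lt_trans ch) // (lt_le_trans hm) // ge_min lexx.
  have := rP c; rewrite -ball_normE /ball_ /= sub0r normrN gtr0_norm // => /(_ cr).
  by rewrite gt_eqF // Dx subr0 => /(_ isT); rewrite pmulr_rgt0 // invr_gt0.
have he c : c \in `[0, h]%R -> `|c| < e.
  rewrite in_itv /= => /andP[c1 ch]; rewrite ger0_norm // (le_lt_trans ch) //.
  by rewrite (lt_le_trans hm) // ge_min lexx orbT.
have [||c ch e1] := @MVT R g g' 0 h h0.
- by move=> c ch; apply/dg/he; exact: subset_itv_oo_cc ch.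
- by apply: derivable_within_continuous => c /he /dg[].
have : g h <= g 0 by rewrite /g scale0r add0r; apply/fmax/Uh/he; rewrite in_itv /= lexx ltW.
by rewrite -subr_le0 e1 subr0 leNgt mulr_gt0 // gpos.
Qed.

End DirectionalDerivatives.

(** A chain rule built from directional derivatives alone: the mean value theorem on the segment
    from [y] to [phi h] gives a derivative in direction [phi h - y] at an intermediate point, which
    [derive_sum_dir] expands in coordinates. *)
Lemma derive_along_curve (R : realType) (n : nat) (f : 'rV[R]_n -> R)
    (U : set 'rV[R]_n) (phi : R -> 'rV[R]_n) :
  open U -> Ck 1 U f -> U (phi 0) -> derivable phi 0 1 ->
  is_derive (0 : R) (1 : R) (f \o phi)
    (\sum_k ('D_1 phi 0) 0 k * partial k f (phi 0)).
Proof.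
move=> oU fU Uy dphi; set y := phi 0.
have cphi : {for 0, continuous phi}.
  by apply: differentiable_continuous; exact/derivable1_diffP.
have [d d0 dU] := Ck_ball oU Uy.
have near_d : \forall h \near (0 : R), `|phi h - y| < d.
  by move/cvgrPdist_lt: cphi => /(_ _ d0); apply: filterS => h; rewrite distrC.
(* Far from [y] the implication is vacuous and any point serves, so that the intermediate point
   becomes a total function [xi]. *)
have exi (h : R) : exists z, `|phi h - y| < d ->
    [/\ U z, `|z - y| <= `|phi h - y| & f (phi h) - f y = 'D_(phi h - y) f z].
  have [hd|hd] := pselect (`|phi h - y| < d); last by exists y.
  have sP (s : R) : 0 <= s <= 1 -> `|s *: (phi h - y) + y - y| <= `|phi h - y|.
    by move=> /andP[s0 s1]; rewrite addrK normrZ ger0_norm // ler_piMl.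
  have sU (s : R) : 0 <= s <= 1 -> U (s *: (phi h - y) + y).
    by move=> s01; apply: dU; exact: le_lt_trans (sP _ s01) hd.
  have [s s01|s s01] := @mvt_line R _ f y (phi h - y).
    exact: (Ck_derivable fU (sU s s01)).
  rewrite subrK => e; exists (s *: (phi h - y) + y) => _.
  by split=> //; [exact: sU|exact: sP].
have [xi xiP] := choice exi.
have cxi : xi @ 0^' --> y.
  apply/cvgrPdist_lt => e e0; rewrite near_withinE.
  move/cvgrPdist_lt: cphi => /(_ _ e0) ce.
  near=> h => h0; rewrite distrC.
  have hd : `|phi h - y| < d by near: h.
  have [_ le_h _] := xiP h hd; apply: le_lt_trans le_h _.
  by rewrite distrC; near: h.
have dcoord k : (h^-1 * (phi h 0 k - y 0 k)) @[h --> (0 : R)^'] --> ('D_1 phi 0) 0 k.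
  have dk : derivable (fun h => phi h 0 k) 0 1 by move/derivable_mxP: dphi; apply.
  rewrite derive_mx // mxE; move: (dk); rewrite /derivable /derive.
  have -> : (fun h : R => h^-1 *: (((fun h => phi h 0 k) \o shift 0) (h *: (1 : R))
      - phi 0 0 k)) = (fun h : R => h^-1 * (phi h 0 k - y 0 k)).
    by apply/funext => h /=; rewrite [h *: (1 : R)]mulr1 addr0.
  by [].
have lim : (h^-1 *: (f (phi h) - f y)) @[h --> (0 : R)^'] -->
    \sum_k ('D_1 phi 0) 0 k * partial k f y.
  have : (\sum_k (h^-1 * (phi h 0 k - y 0 k)) * partial k f (xi h)) @[h --> (0 : R)^']
      --> \sum_k ('D_1 phi 0) 0 k * partial k f y.
    apply: cvg_big => [|k _]; first exact: add_continuous.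
    apply: cvgM; first exact: dcoord.
    apply: (cvg_comp _ _ cxi); apply: (Ck_continuous (k := 0)) Uy.
    exact: Ck_derive.
  apply: cvg_trans; apply: near_eq_cvg; rewrite near_withinE; near=> h => h0.
  have hd : `|phi h - y| < d by near: h.
  have [Uxi _ ->] := xiP h hd.
  rewrite [phi h - y]row_sum_delta (derive_sum_dir _ _ _ oU Uxi fU) scaler_sumr.
  by apply: eq_bigr => k _; rewrite !mxE -mulrA.
have e : (fun h : R => h^-1 *: (((f \o phi) \o shift 0) (h *: (1 : R)) - (f \o phi) 0)) =
    (fun h => h^-1 *: (f (phi h) - f y)).
  by apply/funext => h /=; rewrite [h *: (1 : R)]mulr1 addr0.
split; first by rewrite /derivable e; apply/cvg_ex; eexists; exact: lim.
by rewrite /derive e; exact: cvg_lim.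
Unshelve. all: by end_near. Qed.

(** * The ring of smooth functions on an open set *)

Section SmoothFunctions.
Context (R : realType) (V : normedModType R) (N : set V).
Implicit Types f g : V -> R.

(* Functions that vanish off [N], so that Leibniz equality is equality on [N]. *)
Record sfun (oN : open N) := Sfun {
  sfun_val :> V -> R;
  sfun_smooth : smooth_open N sfun_val;
  sfun_out : forall x, ~ N x -> sfun_val x = 0 }.

Context (oN : open N).

Lemma sfun_ext (f g : sfun oN) : (forall x, N x -> f x = g x) -> f = g.
Proof.
case: f g => [f fs f0] [g gs g0] /= fg.
have e : f = g.
  apply/funext => x; have [Nx|nNx] := pselect (N x); first exact: fg.
  by rewrite f0 // g0.
subst g; congr Sfun; exact: Prop_irrelevance.
Qed.

Definition cutoff f x := if pselect (N x) then f x else 0.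

Lemma cutoffE f x : N x -> cutoff f x = f x.
Proof. by rewrite /cutoff; case: pselect. Qed.

Lemma cutoff_out f x : ~ N x -> cutoff f x = 0.
Proof. by rewrite /cutoff; case: pselect. Qed.

Lemma cutoff_smooth f : smooth_open N f -> smooth_open N (cutoff f).
Proof. by move=> fs k; apply: Ck_eq (fs k) => // x Nx; rewrite cutoffE. Qed.

Lemma smooth_cst (c : R) : smooth_open N (fun=> c).
Proof. by move=> k; exact: Ck_cst. Qed.

Lemma zero_smooth : smooth_open N (cutoff (fun=> 0)).
Proof. exact/cutoff_smooth/smooth_cst. Qed.

Definition sfun_zero : sfun oN := Sfun oN zero_smooth (@cutoff_out _).

(** The zero default makes this total, so ring operations can be written on plain functions, with
    smoothness invoked only when they are evaluated. *)
Definition germ f : sfun oN :=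
  match pselect (smooth_open N f) with
  | left fs => Sfun oN (cutoff_smooth fs) (@cutoff_out f)
  | right _ => sfun_zero
  end.

Lemma germE f x : smooth_open N f -> N x -> germ f x = f x.
Proof. by rewrite /germ; case: pselect => //= *; exact: cutoffE. Qed.

Lemma smooth_add f g : smooth_open N f -> smooth_open N g ->
  smooth_open N (fun x => f x + g x).
Proof. by move=> fs gs k; exact: Ck_add. Qed.

Lemma smooth_mul f g : smooth_open N f -> smooth_open N g ->
  smooth_open N (fun x => f x * g x).
Proof. by move=> fs gs k; exact: Ck_mul. Qed.

Lemma smooth_opp f : smooth_open N f -> smooth_open N (fun x => - f x).
Proof. by move=> fs k; exact: Ck_opp. Qed.

Lemma smooth_derive f v : smooth_open N f -> smooth_open N ('D_v f).
Proof. by move=> fs k; apply: Ck_derive; exact: fs. Qed.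

Definition sfun_one := germ (fun=> 1).
Definition sfun_add (f g : sfun oN) := germ (fun x => f x + g x).
Definition sfun_mul (f g : sfun oN) := germ (fun x => f x * g x).
Definition sfun_opp (f : sfun oN) := germ (fun x => - f x).
Definition der v (f : sfun oN) : sfun oN := germ ('D_v f).

Lemma zeroE x : sfun_zero x = 0.
Proof. by rewrite /= /cutoff; case: pselect. Qed.
Lemma oneE x : N x -> sfun_one x = 1.
Proof. by move=> Nx; rewrite germE //; exact: smooth_cst. Qed.
Lemma addE (f g : sfun oN) x : N x -> sfun_add f g x = f x + g x.
Proof. by move=> Nx; rewrite germE //; apply: smooth_add; exact: sfun_smooth. Qed.
Lemma mulE (f g : sfun oN) x : N x -> sfun_mul f g x = f x * g x.
Proof. by move=> Nx; rewrite germE //; apply: smooth_mul; exact: sfun_smooth. Qed.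
Lemma oppE (f : sfun oN) x : N x -> sfun_opp f x = - f x.
Proof. by move=> Nx; rewrite germE //; apply: smooth_opp; exact: sfun_smooth. Qed.

HB.instance Definition _ := gen_eqMixin (sfun oN).
HB.instance Definition _ := gen_choiceMixin (sfun oN).

Lemma sfun_addA : associative sfun_add.
Proof. by move=> f g h; apply: sfun_ext => x Nx; rewrite !addE // addrA. Qed.
Lemma sfun_addC : commutative sfun_add.
Proof. by move=> f g; apply: sfun_ext => x Nx; rewrite !addE // addrC. Qed.
Lemma sfun_add0 : left_id sfun_zero sfun_add.
Proof. by move=> f; apply: sfun_ext => x Nx; rewrite addE // zeroE add0r. Qed.
Lemma sfun_addN : left_inverse sfun_zero sfun_opp sfun_add.
Proof.
by move=> f; apply: sfun_ext => x Nx; rewrite addE // oppE // zeroE addNr.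
Qed.
HB.instance Definition _ := GRing.isZmodule.Build (sfun oN)
  sfun_addA sfun_addC sfun_add0 sfun_addN.

Lemma sfun_mulA : associative sfun_mul.
Proof. by move=> f g h; apply: sfun_ext => x Nx; rewrite !mulE // mulrA. Qed.
Lemma sfun_mulC : commutative sfun_mul.
Proof. by move=> f g; apply: sfun_ext => x Nx; rewrite !mulE // mulrC. Qed.
Lemma sfun_mul1 : left_id sfun_one sfun_mul.
Proof. by move=> f; apply: sfun_ext => x Nx; rewrite mulE // oneE // mul1r. Qed.
Lemma sfun_mulD : left_distributive sfun_mul +%R.
Proof.
move=> f g h; apply: sfun_ext => x Nx.
by rewrite mulE // !addE // !mulE // mulrDl.
Qed.
HB.instance Definition _ := GRing.Zmodule_isComPzRing.Build (sfun oN)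
  sfun_mulA sfun_mulC sfun_mul1 sfun_mulD.

Definition ev x (Nx : N x) (f : sfun oN) : R := f x.

Lemma ev_zmod x (Nx : N x) : zmod_morphism (ev Nx).
Proof. by move=> f g; rewrite /ev [LHS]addE // oppE. Qed.
HB.instance Definition _ x (Nx : N x) :=
  GRing.isZmodMorphism.Build (sfun oN) R (ev Nx) (ev_zmod Nx).

Lemma ev_monoid x (Nx : N x) : monoid_morphism (ev Nx).
Proof. by split=> [|f g]; rewrite /ev; [exact: oneE|exact: mulE]. Qed.
HB.instance Definition _ x (Nx : N x) :=
  GRing.isMonoidMorphism.Build (sfun oN) R (ev Nx) (ev_monoid Nx).

Lemma sfun_derivable (f : sfun oN) x v : N x -> derivable f x v.
Proof. exact: (Ck_derivable (sfun_smooth f 1)). Qed.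

Lemma derE v (f : sfun oN) x : N x -> der v f x = 'D_v f x.
Proof. by move=> Nx; rewrite germE //; apply: smooth_derive; exact: sfun_smooth. Qed.

Lemma derive_near f g x v : N x -> (forall y, N y -> f y = g y) ->
  'D_v f x = 'D_v g x.
Proof. by move=> Nx fg; apply: near_eq_derive; exact: (near_open oN Nx). Qed.

Lemma der_zmod v : zmod_morphism (der v).
Proof.
move=> f g; apply: sfun_ext => x Nx.
rewrite derE // [RHS]addE // oppE // !derE //.
rewrite -(deriveB (@sfun_derivable f x v Nx) (@sfun_derivable g x v Nx)).
by apply: derive_near => // y Ny; rewrite [LHS]addE // oppE.
Qed.
HB.instance Definition _ v :=
  GRing.isZmodMorphism.Build (sfun oN) (sfun oN) (der v) (der_zmod v).

Lemma derM v (f g : sfun oN) : der v (f * g) = der v f * g + f * der v g.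
Proof.
apply: sfun_ext => x Nx; rewrite derE // [RHS]addE // [X in X + _]mulE //.
rewrite [X in _ + X]mulE // !derE //.
have e : forall y, N y -> (f * g) y = ((f : V -> R) * (g : V -> R)) y.
  by move=> y Ny; rewrite [LHS]mulE.
rewrite (derive_near _ Nx e).
rewrite (deriveM (@sfun_derivable f x v Nx) (@sfun_derivable g x v Nx)) addrC.
by congr (_ + _); exact: mulrC.
Qed.

Lemma derC v w (f : sfun oN) : der v (der w f) = der w (der v f).
Proof.
apply: sfun_ext => x Nx; transitivity ('D_v (der w f) x); first exact: derE.
symmetry; transitivity ('D_w (der v f) x); first exact: derE.
have e1 : 'D_v (der w f) x = 'D_v ('D_w f) x.
  by apply: derive_near => // y Ny; exact: derE.
have e2 : 'D_w (der v f) x = 'D_w ('D_v f) x.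
  by apply: derive_near => // y Ny; exact: derE.
by rewrite e1 e2; exact: (derive_comm _ _ oN Nx (sfun_smooth f 2)).
Qed.

End SmoothFunctions.

#[global] Opaque sfun_zero sfun_one sfun_add sfun_mul sfun_opp germ der.

(** * Functions smooth up to the end times *)

Section SmoothOn.
Context (R : realType) (V : normedModType R) (S : set V).
Implicit Types f g : V -> R.

(** The local extension [F] may leave the region where [op] is smooth, even if [f] does not; hence
    the smaller neighbourhood [W]. *)
Lemma smooth_on_lift (op : R -> R) f :
  (forall x (U : set V) F, S x -> open U -> U x -> smooth_open U F -> F x = f x ->
    exists2 W : set V, open W & [/\ W x, W `<=` U & smooth_open W (op \o F)]) ->
  smooth_on S f -> smooth_on S (op \o f).
Proof.
move=> H fs x Sx; have [U [F [oU Ux Fs Ff]]] := fs x Sx.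
have [W oW [Wx WU Ws]] := H x U F Sx oU Ux Fs (Ff x Ux Sx).
by exists W, (op \o F); split=> // y Wy Sy /=; rewrite Ff //; exact: WU.
Qed.

Lemma smooth_on_eq f g : (forall x, S x -> f x = g x) ->
  smooth_on S f -> smooth_on S g.
Proof.
move=> fg fs x Sx; have [U [F [oU Ux Fs Ff]]] := fs x Sx.
by exists U, F; split=> // y Uy Sy; rewrite Ff // fg.
Qed.

Lemma smooth_on_cst (c : R) : smooth_on S (fun=> c).
Proof.
move=> x Sx; exists setT, (fun=> c); split=> //; first exact: openT.
exact/smooth_cst/openT.
Qed.

Lemma smooth_on_bin (op : R -> R -> R) f g :
  (forall U (F G : V -> R), open U -> smooth_open U F -> smooth_open U G ->
    smooth_open U (fun x => op (F x) (G x))) ->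
  smooth_on S f -> smooth_on S g -> smooth_on S (fun x => op (f x) (g x)).
Proof.
move=> H fs gs x Sx.
have [U [F [oU Ux Fs Ff]]] := fs x Sx; have [W [G [oW Wx Gs Gg]]] := gs x Sx.
exists (U `&` W), (fun x => op (F x) (G x)); split=> //; first exact: openI.
  apply: H; first exact: openI.
    by move=> k; apply: Ck_sub (Fs k); exact: subIsetl.
  by move=> k; apply: Ck_sub (Gs k); exact: subIsetr.
by move=> y [Uy Wy] Sy; rewrite Ff // Gg.
Qed.

Lemma smooth_on_add f g : smooth_on S f -> smooth_on S g ->
  smooth_on S (fun x => f x + g x).
Proof.
by apply: (smooth_on_bin (op := +%R)) => U F G oU Fs Gs; exact: smooth_add.
Qed.

Lemma smooth_on_mul f g : smooth_on S f -> smooth_on S g ->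
  smooth_on S (fun x => f x * g x).
Proof.
by apply: (smooth_on_bin (op := *%R)) => U F G oU Fs Gs; exact: smooth_mul.
Qed.

Lemma smooth_on_opp f : smooth_on S f -> smooth_on S (fun x => - f x).
Proof.
move=> fs; apply: (@smooth_on_eq (fun x => -1 * f x)) => [x _|].
  by rewrite mulN1r.
by apply: smooth_on_mul => //; exact: smooth_on_cst.
Qed.

Lemma smooth_on_sub f g : smooth_on S f -> smooth_on S g ->
  smooth_on S (fun x => f x - g x).
Proof. by move=> fs gs; apply: smooth_on_add => //; exact: smooth_on_opp. Qed.

Lemma smooth_on_sum (I : Type) (r : seq I) (P : pred I) (f : I -> V -> R) :
  (forall i, P i -> smooth_on S (f i)) ->
  smooth_on S (fun x => \sum_(i <- r | P i) f i x).
Proof.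
move=> H; elim: r => [|i r IH].
  by apply: (smooth_on_eq _ (smooth_on_cst 0)) => x _; rewrite big_nil.
case Pi : (P i).
  apply: (smooth_on_eq _ (smooth_on_add (H i Pi) IH)) => x _.
  by rewrite big_cons Pi.
by apply: (smooth_on_eq _ IH) => x _; rewrite big_cons Pi.
Qed.

Lemma smooth_on_prod (I : Type) (r : seq I) (f : I -> V -> R) :
  (forall i, smooth_on S (f i)) ->
  smooth_on S (fun x => \prod_(i <- r) f i x).
Proof.
move=> H; elim: r => [|i r IH].
  by apply: (smooth_on_eq _ (smooth_on_cst 1)) => x _; rewrite big_nil.
by apply: (smooth_on_eq _ (smooth_on_mul (H i) IH)) => x _; rewrite big_cons.
Qed.

Lemma open_preimage (U : set V) (F : V -> R) (P : set R) x : open U -> U x ->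
  smooth_open U F -> open P -> P (F x) ->
  exists2 W : set V, open W & [/\ W x, W `<=` U & forall y, W y -> P (F y)].
Proof.
move=> oU Ux Fs oP PFx.
have Fc : {for x, continuous F} by exact: (Ck_continuous (Fs 0)).
have : nbhs x (U `&` F @^-1` P).
  apply: filterI; first exact: open_nbhs_nbhs.
  by apply: Fc; exact: open_nbhs_nbhs.
rewrite nbhsE => -[W [oW Wx] WP]; exists W => //; split=> // y /WP[] //.
Qed.

Lemma smooth_on_inv f : (forall x, S x -> f x != 0) -> smooth_on S f ->
  smooth_on S (fun x => (f x)^-1).
Proof.
move=> f0; apply: (smooth_on_lift (op := @GRing.inv R)) => x U F Sx oU Ux Fs Ff.
have [||W oW [Wx WU W0]] := open_preimage (P := [set y : R | y != 0]) oU Ux Fs.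
- exact: open_neq.
- by rewrite /= Ff; exact: f0.
exists W => //; split=> // k; apply: Ck_inv => //; exact: Ck_sub (Fs k).
Qed.

Lemma smooth_on_ln f : (forall x, S x -> 0 < f x) -> smooth_on S f ->
  smooth_on S (fun x => ln (f x)).
Proof.
move=> f0; apply: (smooth_on_lift (op := @ln R)) => x U F Sx oU Ux Fs Ff.
have [||W oW [Wx WU W0]] := open_preimage (P := [set y : R | 0 < y]) oU Ux Fs.
- exact: open_gt.
- by rewrite /= Ff; exact: f0.
exists W => //; split=> // k; apply: Ck_ln => //; exact: Ck_sub (Fs k).
Qed.

Lemma smooth_on_det n (A : V -> 'M[R]_n) :
  (forall i j, smooth_on S (fun x => A x i j)) -> smooth_on S (fun x => \det (A x)).
Proof.
move=> H; apply: smooth_on_sum => s _; apply: smooth_on_mul.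
  exact: smooth_on_cst.
exact: smooth_on_prod.
Qed.

(** Cramer's formula reduces the inverse to determinants, which are polynomial in the entries. *)
Lemma smooth_on_invmx n (A : V -> 'M[R]_n) :
  (forall i j, smooth_on S (fun x => A x i j)) ->
  (forall x, S x -> \det (A x) != 0) ->
  forall i j, smooth_on S (fun x => invmx (A x) i j).
Proof.
move=> H A0 i j.
apply: (@smooth_on_eq (fun x => (\det (A x))^-1 * cofactor (A x) j i)) => [x Sx|].
  by rewrite /invmx unitmxE unitfE A0 // !mxE.
apply: smooth_on_mul; first by apply: smooth_on_inv => //; exact: smooth_on_det.
apply: smooth_on_mul; first exact: smooth_on_cst.
apply: smooth_on_det => k l.
by apply: (smooth_on_eq _ (H (lift j k) (lift i l))) => x _; rewrite !mxE.
Qed.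

Lemma smooth_on_cvg f x : S x -> smooth_on S f ->
  f y @[y --> within S (nbhs x)] --> f x.
Proof.
move=> Sx fs; have [U [F [oU Ux Fs Ff]]] := fs x Sx.
have Fc : {for x, continuous F} by exact: (Ck_continuous (Fs 0)).
rewrite -(Ff x Ux Sx); apply: (cvg_trans _ (cvg_within_filter S Fc)).
apply: near_eq_cvg; rewrite near_withinE.
by apply: (near_open oU Ux) => y Uy Sy; exact: Ff.
Qed.

Lemma smooth_on_open (N : set V) f : open N -> N `<=` S -> smooth_on S f ->
  smooth_open N f.
Proof.
move=> oN NS fs k; apply: Ck_local => // x Nx.
have [U [F [oU Ux Fs Ff]]] := fs x (NS x Nx); exists U, F; split=> // y Uy Ny.
by apply: Ff => //; exact: NS.
Qed.

End SmoothOn.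

(** * Time slices and the two kinds of derivative on space-time *)

Section SpaceTime.
Context (R : realType) (n : nat) (T : R) (U : set 'rV[R]_n).
Hypothesis oU : open U.
Local Notation V := (R * 'rV[R]_n)%type.
Local Notation S := (`[0, T]%classic `*` U).

Lemma derive_slice (F : V -> R) t x (e : 'rV[R]_n) :
  'D_e (fun y => F (t, y)) x = 'D_((0 : R), e) F (t, x).
Proof.
rewrite /derive; set g1 := fun h => h^-1 *: _; set g2 := fun h => h^-1 *: _.
suff -> : g1 = g2 by [].
apply/funext => h; rewrite /g1 /g2 /=; congr (_ *: (F _ - _)).
by apply: injective_projections; rewrite /= ?mulr0 ?add0r // [_ *: _]mulr0 add0r.
Qed.

Lemma derivable_slice (F : V -> R) t x (e : 'rV[R]_n) :
  derivable F (t, x) ((0 : R), e) -> derivable (fun y => F (t, y)) x e.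
Proof.
rewrite /derivable; set g1 := fun h => h^-1 *: _; set g2 := fun h => h^-1 *: _.
suff -> : g1 = g2 by [].
apply/funext => h; rewrite /g1 /g2 /=; congr (_ *: (F _ - _)).
by apply: injective_projections; rewrite /= ?mulr0 ?add0r // [_ *: _]mulr0 add0r.
Qed.

Lemma pair_continuous (t : R) (x : 'rV[R]_n) :
  {for x, continuous (fun y : 'rV[R]_n => (t, y) : V)}.
Proof.
have c1 : (fun _ : 'rV[R]_n => t) @ (nbhs x) --> t.
  exact: (@cvg_cst _ _ _ _ (nbhs_filter x)).
have c2 : (fun y : 'rV[R]_n => y) @ x --> x by exact: cvg_id.
exact: (cvg_pair c1 c2).
Qed.

Lemma open_slice (W : set V) t : open W -> open [set y | W (t, y)].
Proof.
move=> oW; rewrite openE => y Wy; rewrite /interior /=.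
have c := @pair_continuous t y; exact: (c W (open_nbhs_nbhs (conj oW Wy))).
Qed.

Lemma Ck_slice k (W : set V) (F : V -> R) t :
  Ck k W F -> Ck k [set y | W (t, y)] (fun y => F (t, y)).
Proof.
elim: k F => [|k IH] F FW.
  split=> // x Wx; apply: continuous_comp; first exact: pair_continuous.
  exact: (Ck_continuous FW).
split=> [x Wx|e].
  apply: continuous_comp; first exact: pair_continuous.
  exact: (Ck_continuous FW).
split=> [x Wx|]; first by apply: derivable_slice; exact: (Ck_derivable FW).
have := IH _ (Ck_derive ((0 : R), e) FW).
have -> // : 'D_e (fun y => F (t, y)) = (fun y => 'D_((0 : R), e) F (t, y)).
by apply/funext => y; exact: derive_slice.
Qed.

Definition sm (f : R -> 'rV[R]_n -> R) := smooth_on S (fun z : V => f z.1 z.2).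

Lemma sm_slice f t : sm f -> 0 <= t <= T -> smooth_open U (f t).
Proof.
move=> fs tT k; apply: Ck_local => // x Ux.
have Stx : S (t, x) by split=> //=; rewrite in_itv.
have [W [F [oW Wx Fs Ff]]] := fs _ Stx.
exists [set y | W (t, y)], (fun y => F (t, y)); split=> //.
- exact: open_slice.
- exact: Ck_slice.
- by move=> y Wy Uy; rewrite Ff //; split=> //=; rewrite in_itv.
Qed.

(** This covers the end times as well: a slice at fixed time is open in space, so the spatial
    derivatives of [f] and of its extension agree there. *)
Lemma sm_derive f e : sm f -> sm (fun t => 'D_e (f t)).
Proof.
move=> fs z Sz; have [W [F [oW Wz Fs Ff]]] := fs z Sz.
exists W, ('D_((0 : R), e) F); split=> //.
  by move=> k; apply: Ck_derive; exact: Fs.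
move=> [t x] Wtx [tT Ux] /=; rewrite -derive_slice; apply: near_eq_derive.
apply: (near_open (openI oU (@open_slice W t oW))) => // y [Uy Wy].
by rewrite Ff.
Qed.

Lemma sm_eq f g : (forall t x, 0 <= t <= T -> U x -> f t x = g t x) -> sm f -> sm g.
Proof.
by move=> fg; apply: smooth_on_eq => -[t x] [/= tT Ux]; apply: fg.
Qed.

Lemma has_derivative_within_derive (f : R -> R) t l : 0 < t < T ->
  has_derivative_within `[0, T]%classic f t l -> is_derive t (1 : R) f l.
Proof.
move=> /andP[t0 tT] H.
have C : (h^-1 *: ((f \o shift t) (h *: (1 : R)) - f t)) @[h --> (0 : R)^'] --> l.
  have e : (fun h : R => h^-1 *: ((f \o shift t) (h *: (1 : R)) - f t)) =
      (fun s => (f s - f t) / (s - t)) \o (fun h => h + t).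
    by apply/funext => h /=; rewrite [h *: (1 : R)]mulr1 addrK [_ *: _]mulrC.
  rewrite e; apply: cvg_comp H => A /= /nbhs_ballP[d /= d0 dA].
  have m0 : 0 < Num.min d (Num.min t (T - t)) by rewrite !lt_min d0 t0 subr_gt0.
  suff : \forall h \near (0 : R)^', A ((f (h + t) - f t) / (h + t - t)) by [].
  near=> h.
  have h0 : h != 0 by near: h; exact: nbhs_dnbhs_neq.
  have hm : `|h| < Num.min d (Num.min t (T - t)) by near: h; exact: dnbhs0_lt.
  move: hm; rewrite !lt_min => /and3P[hd ht hT]; apply: dA.
    by rewrite -ball_normE /ball_ /= opprD addrCA subrr addr0 normrN.
  split; last by move/eqP; rewrite -subr_eq0 addrK (negbTE h0).
  rewrite in_itv /=; move: ht hT; rewrite !ltr_norml => /andP[h1 _] /andP[_ h2].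
  by apply/andP; split; [rewrite -lerBlDr sub0r ltW|rewrite -lerBrDr ltW].
by split; [apply/cvg_ex; exists l|exact: cvg_lim].
Unshelve. all: by end_near. Qed.

Lemma derive_time (f : R -> 'rV[R]_n -> R) t x :
  'D_((1 : R), (0 : 'rV[R]_n)) (fun z : V => f z.1 z.2) (t, x) = 'D_1 (f ^~ x) t.
Proof.
rewrite /derive; set g1 := fun h => h^-1 *: _; set g2 := fun h => h^-1 *: _.
suff -> : g1 = g2 by [].
by apply/funext => h; rewrite /g1 /g2 /= scaler0 add0r.
Qed.

End SpaceTime.

(** * Christoffel symbols and the differential ring of space-time *)

Lemma posdef_det (R : realType) (n : nat) (B : 'M[R]_n) : posdef B -> \det B != 0.
Proof.
move=> Bpos; rewrite -unitfE -unitmxE -row_free_unit -kermx_eq0.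
apply/eqP/row_matrixP => i; rewrite row0; apply/eqP; apply: contraT => v0.
have := Bpos _ v0; have -> : row i (kermx B) *m B = 0.
  by apply/sub_kermxP; exact: row_sub.
by rewrite mul0mx mxE ltxx.
Qed.

Lemma christoffel_sym (R : realType) (n : nat) (G : 'rV[R]_n -> 'M[R]_n)
    (U : set 'rV[R]_n) x (k i j : 'I_n) :
  open U -> U x -> (forall y, U y -> (G y)^T = G y) ->
  christoffel G k i j x = christoffel G k j i x.
Proof.
move=> oU Ux Gs; rewrite /christoffel; congr (_ * _); apply: eq_bigr => l _.
rewrite [X in _ - X](_ : _ = partial l (fun y => G y j i) x); first by ring.
apply: near_eq_derive; apply: (near_open oU Ux) => y Uy.
by rewrite -[in LHS](Gs y Uy) mxE.
Qed.

(** Lowering the upper index cancels the inverse metric ([E] below); in the sum over the two orders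
    of the indices only the derivative along [i] remains. *)
Lemma christoffel_metric (R : realType) (n : nat) (G : 'rV[R]_n -> 'M[R]_n)
    (U : set 'rV[R]_n) x (i : 'I_n) :
  open U -> U x -> (forall y, U y -> (G y)^T = G y) -> \det (G x) != 0 ->
  let Gam := \matrix_(j, k) christoffel G k i j x in
  \matrix_(j, k) partial i (fun y => G y j k) x = Gam *m G x + G x *m Gam^T.
Proof.
move=> oU Ux Gs G0 Gam.
have pS a b c : partial a (fun y => G y b c) x = partial a (fun y => G y c b) x.
  apply: near_eq_derive; apply: (near_open oU Ux) => y Uy.
  by rewrite -[in LHS](Gs y Uy) mxE.
have uG : G x \in unitmx by rewrite unitmxE unitfE.
have HS : (invmx (G x))^T = invmx (G x) by rewrite trmx_inv Gs.
have E j k : (Gam *m G x) j k = 2%:R^-1 * (partial i (fun y => G y j k) x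
    + partial j (fun y => G y i k) x - partial k (fun y => G y i j) x).
  pose P m := partial i (fun y => G y j m) x + partial j (fun y => G y i m) x
     - partial m (fun y => G y i j) x.
  rewrite -/(P k) mxE.
  transitivity (2%:R^-1 * \sum_m P m * (invmx (G x) *m G x) m k).
    rewrite mulr_sumr; under [RHS]eq_bigr do rewrite mxE mulr_sumr mulr_sumr.
    rewrite [RHS]exchange_big; apply: eq_bigr => l _ /=.
    rewrite !mxE /christoffel -mulrA mulr_suml mulr_sumr; apply: eq_bigr => m _.
    by rewrite -/(P m) -[in LHS]HS mxE; ring.
  congr (_ * _); rewrite mulVmx // (bigD1 k) //= mxE eqxx mulr1.
  by rewrite big1 ?addr0 // => m mk; rewrite mxE (negbTE mk) mulr0.
apply/matrixP => j k; rewrite [LHS]mxE.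
have -> : G x *m Gam^T = (Gam *m G x)^T by rewrite trmx_mul Gs.
rewrite [RHS]mxE [(_ ^T) j k]mxE !E (pS i k j) (pS k i j) (pS j i k).
by apply: (mulfI (_ : 2%:R != 0)); [rewrite pnatr_eq0|field].
Qed.

Section Calculus.
Context (R : realType) (n : nat) (T : R) (U : set 'rV[R]_n).
Hypothesis oU : open U.
Local Notation V := (R * 'rV[R]_n)%type.
Local Notation sm := (sm T U).

Lemma sm_partial f i : sm f -> sm (fun t => partial i (f t)).
Proof. exact: sm_derive. Qed.

Lemma sm_time : sm (fun t _ => t).
Proof.
move=> z Sz; exists setT, (fun z : V => z.1); split=> //; first exact: openT.
have D (x v : V) : is_derive x v (fun z : V => z.1) v.1.
  have C : (h^-1 *: (((fun z : V => z.1) \o shift x) (h *: v) - x.1))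
      @[h --> (0 : R)^'] --> v.1.
    have : (fun _ : R => v.1) @ (0 : R)^' --> v.1 by exact: cvg_cst.
    apply: cvg_trans; apply: near_eq_cvg.
    have : \forall h \near (0 : R)^', h != 0 by exact: nbhs_dnbhs_neq.
    apply: filterS => h h0 /=; rewrite addrK; apply/esym.
    by rewrite [h^-1 *: _]mulrA mulVf // mul1r.
  by split; [apply/cvg_ex; exists v.1|exact: cvg_lim].
have Dc : forall v : V, 'D_v (fun z : V => z.1) = (fun=> v.1).
  by move=> v; apply/funext => x; have [_ ->] := D x v.
have ct (x : V) : {for x, continuous (fun z : V => z.1)} by exact: cvg_fst.
case=> [|k]; split=> // v; split=> [x _|]; first by have [] := D x v.
by rewrite Dc; apply: Ck_cst; exact: openT.
Qed.

Definition space_time : set V := [set z | 0 < z.1 < T /\ U z.2].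

Lemma open_space_time : open space_time.
Proof.
have -> : space_time = [set z : V | 0 < z.1] `&` [set z : V | z.1 < T]
    `&` [set z : V | U z.2].
  by apply/seteqP; split=> z /=; rewrite /space_time /= => -[];
    [move=> /andP[]|move=> [-> ->]].
apply: openI; first apply: openI.
- by apply: (@open_comp _ _ (fun z : V => z.1) [set t : R | 0 < t]) => [z _|];
    [exact: cvg_fst|exact: open_gt].
- by apply: (@open_comp _ _ (fun z : V => z.1) [set t : R | t < T]) => [z _|];
    [exact: cvg_fst|exact: open_lt].
- by apply: (@open_comp _ _ (fun z : V => z.2) U) => // z _; exact: cvg_snd.
Qed.

Lemma space_timeP z : space_time z -> 0 <= z.1 <= T /\ U z.2.
Proof. by move=> [/andP[t0 tT] Uz]; rewrite !ltW. Qed.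

Lemma sm_smooth f : sm f -> smooth_open space_time (fun z : V => f z.1 z.2).
Proof.
move=> fs; apply: (smooth_on_open open_space_time _ fs) => z /space_timeP[zT Uz].
by split=> //=; rewrite in_itv.
Qed.

(* An abstract ring of smooth functions on [space_time]: keeping it abstract
   stops unification from unfolding its concrete operations. *)
Record calculus := Calculus {
  fring :> comPzRingType;
  tf : (R -> 'rV[R]_n -> R) -> fring;
  dx : 'I_n -> {additive fring -> fring};
  dt : {additive fring -> fring};
  tev : forall z, space_time z -> {rmorphism fring -> R};
  tev_ext : forall a b, (forall z (Nz : space_time z), tev Nz a = tev Nz b) -> a = b;
  tf_ev : forall f z (Nz : space_time z), sm f -> tev Nz (tf f) = f z.1 z.2;
  dxM : forall i a b, dx i (a * b) = dx i a * b + a * dx i b;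
  dtM : forall a b, dt (a * b) = dt a * b + a * dt b;
  dxC : forall i j a, dx i (dx j a) = dx j (dx i a);
  dtxC : forall i a, dt (dx i a) = dx i (dt a);
  dx_tf : forall i f, sm f -> dx i (tf f) = tf (fun t => partial i (f t));
  dt_tf : forall f z (Nz : space_time z), sm f ->
    is_derive z.1 (1 : R) (f ^~ z.2) (tev Nz (dt (tf f))) }.

Lemma derive_time_is (f : R -> 'rV[R]_n -> R) t x :
  derivable (fun z : V => f z.1 z.2) (t, x) (1 : R, 0 : 'rV[R]_n) ->
  is_derive t (1 : R) (f ^~ x)
    ('D_(1 : R, 0 : 'rV[R]_n) (fun z : V => f z.1 z.2) (t, x)).
Proof.
rewrite derive_time => df; split; last exact: erefl.
move: df.
rewrite /derivable; set g1 := fun h => h^-1 *: _; set g2 := fun h => h^-1 *: _.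
suff -> : g1 = g2 by [].
by apply/funext => h; rewrite /g1 /g2 /= scaler0 add0r.
Qed.

Definition sfun_calculus : calculus.
Proof.
pose oN := open_space_time.
pose tf0 f : sfun oN := germ oN (fun z : V => f z.1 z.2).
have tfE f z : sm f -> space_time z -> tf0 f z = f z.1 z.2.
  by move=> fs Nz; rewrite /tf0 germE //; exact: sm_smooth.
refine (@Calculus (sfun oN : comPzRingType) tf0
  (fun i => der (0 : R, delta_mx 0 i : 'rV[R]_n) : {additive sfun oN -> sfun oN})
  (der (1 : R, 0 : 'rV[R]_n) : {additive sfun oN -> sfun oN})
  (fun z Nz => ev Nz : {rmorphism sfun oN -> R}) _ _ _ _ _ _ _ _).
- by move=> a b H; apply: sfun_ext => z Nz; exact: (H z Nz).
- by move=> f z Nz fs; exact: tfE.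
- by move=> i a b; exact: derM.
- by move=> a b; exact: derM.
- by move=> i j a; exact: derC.
- by move=> i a; exact: derC.
- move=> i f fs; apply: sfun_ext => -[t x] Nz.
  rewrite (tfE (fun t => partial i (f t))) //; last exact: sm_partial.
  transitivity ('D_(0 : R, delta_mx 0 i : 'rV[R]_n) (tf0 f) (t, x)); first exact: derE.
  rewrite (derive_near oN _ Nz (g := fun z : V => f z.1 z.2)); last by move=> z; exact: tfE.
  by rewrite /partial (derive_slice (fun z : V => f z.1 z.2)).
- move=> f [t x] Nz fs /=.
  have -> : ev Nz (der (1 : R, 0 : 'rV[R]_n) (tf0 f)) =
      'D_(1 : R, 0 : 'rV[R]_n) (fun z : V => f z.1 z.2) (t, x).
    transitivity ('D_(1 : R, 0 : 'rV[R]_n) (tf0 f) (t, x)); first exact: derE.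
    by apply: (derive_near oN _ Nz) => z; exact: tfE.
  by apply: derive_time_is; exact: (Ck_derivable (sm_smooth fs 1)).
Defined.

End Calculus.

(** * Evolution of the barrier quantities in a chart *)

Definition gradsq (R : realType) (n : nat) (B : 'rV[R]_n -> 'M[R]_n)
    (f : 'rV[R]_n -> R) x : R :=
  ((\row_k partial k f x) *m invmx (B x) *m (\row_k partial k f x)^T) 0 0.

Section LocalFlow.
Context (R : realType) (n : nat) (T : R) (U : set 'rV[R]_n).
Hypothesis oU : open U.
Context (G : R -> 'rV[R]_n -> 'M[R]_n) (u : R -> 'rV[R]_n -> R).
Local Notation V := (R * 'rV[R]_n)%type.
Local Notation sm := (sm T U).
Local Notation N := (space_time T U).

Hypothesis G_smooth : forall i j, sm (fun t x => G t x i j).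
Hypothesis G_sym : forall t x, 0 <= t <= T -> U x -> (G t x)^T = G t x.
Hypothesis G_pos : forall t x, 0 <= t <= T -> U x -> posdef (G t x).
Hypothesis u_smooth : sm u.
Hypothesis u_pos : forall t x, 0 <= t <= T -> U x -> 0 < u t x.

Let smp i f : sm f -> sm (fun t => partial i (f t)).
Proof. exact: sm_partial. Qed.

Let SP (z : V) : (`[0, T]%classic `*` U) z -> 0 <= z.1 <= T /\ U z.2.
Proof. by case=> /=; rewrite in_itv. Qed.

Lemma sm_invmx i j : sm (fun t x => invmx (G t x) i j).
Proof.
apply: (smooth_on_invmx (A := fun z : V => G z.1 z.2)).
  exact: G_smooth.
by move=> z /SP[zT Uz]; apply/posdef_det/G_pos.
Qed.

Lemma sm_christoffel k i j : sm (fun t => christoffel (G t) k i j).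
Proof.
rewrite /sm /christoffel; apply: smooth_on_mul; first exact: smooth_on_cst.
apply: smooth_on_sum => l _; apply: smooth_on_mul; first exact: sm_invmx.
apply: smooth_on_sub; last exact: (smp _ (G_smooth i j)).
apply: smooth_on_add; first exact: (smp _ (G_smooth j l)).
exact: (smp _ (G_smooth i l)).
Qed.

Lemma sm_gradient i : sm (fun t x => gradient (G t) (u t) x 0 i).
Proof.
apply: (@sm_eq _ _ _ _ (fun t x => \sum_j invmx (G t x) i j * partial j (u t) x)).
  by move=> t x _ _; rewrite mxE.
apply: smooth_on_sum => j _; apply: smooth_on_mul; first exact: sm_invmx.
exact: (smp _ u_smooth).
Qed.

Lemma sm_laplacian : sm (fun t => laplacian (G t) (u t)).
Proof.
rewrite /sm /laplacian /divergence; apply: smooth_on_sum => i _.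
apply: smooth_on_add; first exact: (smp _ (sm_gradient i)).
apply: smooth_on_sum => k _; apply: smooth_on_mul; first exact: sm_christoffel.
exact: sm_gradient.
Qed.

Lemma sm_gradsq : sm (fun t => gradsq (G t) (u t)).
Proof.
apply: (@sm_eq _ _ _ _ (fun t x => \sum_j (\sum_i partial i (u t) x * invmx (G t x) i j)
    * partial j (u t) x)).
  move=> t x _ _; rewrite /gradsq !mxE; apply: eq_bigr => j _; rewrite !mxE.
  by congr (_ * _); apply: eq_bigr => i _; rewrite !mxE.
apply: smooth_on_sum => j _; apply: smooth_on_mul; last exact: (smp _ u_smooth).
apply: smooth_on_sum => i _; apply: smooth_on_mul; last exact: sm_invmx.
exact: (smp _ u_smooth).
Qed.

Lemma sm_uinv : sm (fun t x => (u t x)^-1).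
Proof. by apply: smooth_on_inv => // z /SP[zT Uz]; rewrite gt_eqF // u_pos. Qed.

Lemma sm_ln A : 0 < A -> sm (fun t x => ln (A / u t x)).
Proof.
move=> A0; apply: smooth_on_ln => [z /SP[zT Uz]|].
  by rewrite divr_gt0 // u_pos.
by apply: smooth_on_mul; [exact: smooth_on_cst|exact: sm_uinv].
Qed.

(** * The metric, its connection and curvature, and the solution as ring elements *)

Context (C : calculus T U).
Local Notation dx := (dx C).
Local Notation dt := (dt C).
Local Notation tf := (tf C).
Local Notation tev := (tev C).

Lemma tf_ext f (a : C) : sm f ->
  (forall z (Nz : N z), tev Nz a = f z.1 z.2) -> a = tf f.
Proof. by move=> fs H; apply: tev_ext => z Nz; rewrite H tf_ev. Qed.

Lemma mx_tev_ext (p q : nat) (X Y : 'M[C]_(p, q)) :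
  (forall z (Nz : N z), map_mx (tev Nz) X = map_mx (tev Nz) Y) -> X = Y.
Proof.
move=> H; apply/matrixP => i j; apply: tev_ext => z Nz.
by have /matrixP/(_ i j) := H z Nz; rewrite !mxE.
Qed.

Lemma two_inj (a : C) : a *+ 2 = 0 -> a = 0.
Proof.
move=> a0; apply: tev_ext => z Nz; rewrite rmorph0.
have : tev Nz (a *+ 2) = 0 by rewrite a0 rmorph0.
by rewrite rmorphMn => /eqP; rewrite mulrn_eq0 /= => /eqP.
Qed.

Definition tG : 'M[C]_n := \matrix_(i, j) tf (fun t x => G t x i j).
Definition tH : 'M[C]_n := \matrix_(i, j) tf (fun t x => invmx (G t x) i j).
Definition tGam i : 'M[C]_n :=
  \matrix_(j, k) tf (fun t => christoffel (G t) k i j).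

Lemma tev_tG z (Nz : N z) : map_mx (tev Nz) tG = G z.1 z.2.
Proof. by apply/matrixP => i j; rewrite !mxE tf_ev. Qed.

Lemma tev_tH z (Nz : N z) : map_mx (tev Nz) tH = invmx (G z.1 z.2).
Proof. by apply/matrixP => i j; rewrite !mxE (tf_ev C Nz (sm_invmx i j)). Qed.

Lemma tev_tGam z (Nz : N z) i : map_mx (tev Nz) (tGam i) =
  \matrix_(j, k) christoffel (G z.1) k i j z.2.
Proof. by apply/matrixP => j k; rewrite !mxE (tf_ev C Nz (sm_christoffel k i j)). Qed.

Lemma tG_sym : tG^T = tG.
Proof.
apply: mx_tev_ext => z Nz; rewrite -map_trmx tev_tG.
by have [zT Uz] := space_timeP Nz; exact: G_sym.
Qed.

Lemma G_unit z : N z -> G z.1 z.2 \in unitmx.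
Proof.
by move=> /space_timeP[zT Uz]; rewrite unitmxE unitfE; exact/posdef_det/G_pos.
Qed.

Lemma tGH : tG *m tH = 1%:M.
Proof.
by apply: mx_tev_ext => z Nz; rewrite map_mxM map_mx1 tev_tG tev_tH mulmxV // G_unit.
Qed.

Lemma tHG : tH *m tG = 1%:M.
Proof.
by apply: mx_tev_ext => z Nz; rewrite map_mxM map_mx1 tev_tG tev_tH mulVmx // G_unit.
Qed.

Lemma tGam_sym i j k : tGam i j k = tGam j i k.
Proof.
rewrite !mxE; apply: tev_ext => z Nz; rewrite !(tf_ev C Nz (sm_christoffel _ _ _)).
have [zT Uz] := space_timeP Nz.
by apply: (christoffel_sym _ _ _ oU) => // y Uy; exact: G_sym.
Qed.

Lemma dtG i : map_mx (dx i) tG = tGam i *m tG + tG *m (tGam i)^T.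
Proof.
apply: mx_tev_ext => z Nz; have [zT Uz] := space_timeP Nz.
rewrite map_mxD !map_mxM -map_trmx tev_tG tev_tGam.
rewrite -(christoffel_metric _ oU) //.
- apply/matrixP => j k; rewrite !mxE dx_tf; last exact: G_smooth.
  by rewrite (tf_ev C Nz (smp _ (G_smooth j k))).
- by move=> y Uy; exact: G_sym.
- exact/posdef_det/G_pos.
Qed.

Lemma tev_dtGam z (Nz : N z) i j : map_mx (tev Nz) (map_mx (dx i) (tGam j)) =
  \matrix_(k, l) partial i (christoffel (G z.1) l j k) z.2.
Proof.
apply/matrixP => k l; rewrite !mxE (dx_tf C _ (sm_christoffel _ _ _)).
exact: (tf_ev C Nz (smp _ (sm_christoffel _ _ _))).
Qed.

Lemma tev_curv z (Nz : N z) i j : map_mx (tev Nz) (curv dx tGam i j) =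
  \matrix_(k, l) riemann (G z.1) i j k l z.2.
Proof.
rewrite map_curv !tev_dtGam !tev_tGam.
apply/matrixP => k l; rewrite !mxE /riemann -!addrA; congr (_ + (_ + _)).
rewrite -sumrN -big_split; apply: eq_bigr => m _ /=; rewrite !mxE; ring.
Qed.

Lemma tev_ric z (Nz : N z) :
  map_mx (tev Nz) (ric dx tGam) = ricci (G z.1) z.2.
Proof.
apply/matrixP => j k; rewrite mxE map_ric [RHS]mxE; apply: eq_bigr => i _.
by rewrite tev_curv mxE.
Qed.

Definition tu : C := tf u.
Definition tv : C := tf (fun t x => (u t x)^-1).

Lemma tev_tu z (Nz : N z) : tev Nz tu = u z.1 z.2.
Proof. exact: tf_ev. Qed.

Lemma tev_tv z (Nz : N z) : tev Nz tv = (u z.1 z.2)^-1.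
Proof. exact: (tf_ev C Nz sm_uinv). Qed.

Lemma tuv : tu * tv = 1.
Proof.
apply: tev_ext => z Nz; rewrite rmorphM rmorph1 tev_tu tev_tv mulfV //.
by have [zT Uz] := space_timeP Nz; rewrite gt_eqF // u_pos.
Qed.

Lemma tev_gr z (Nz : N z) f : sm f ->
  map_mx (tev Nz) (gr dx (tf f)) = \col_k partial k (f z.1) z.2.
Proof.
by move=> fs; apply/matrixP => i j; rewrite !mxE dx_tf // (tf_ev C Nz (smp _ fs)).
Qed.

Lemma tev_ip z (Nz : N z) : tev Nz (ip dx tH tu tu) = gradsq (G z.1) (u z.1) z.2.
Proof.
rewrite map_ip tev_tH tev_gr // /gradsq.
by congr (fun_of_matrix (_ *m _ *m _) 0 0); apply/matrixP => i j; rewrite !mxE.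
Qed.

Lemma gradient_tH i : tf (fun t x => gradient (G t) (u t) x 0 i) = (tH *m gr dx tu) i 0.
Proof.
apply/esym/tf_ext; first exact: sm_gradient.
move=> z Nz; rewrite map_Hgr [RHS]mxE; apply: eq_bigr => j _; rewrite mxE dx_tf //.
by rewrite (tf_ev C Nz (sm_invmx i j)) (tf_ev C Nz (smp _ u_smooth)).
Qed.

(** Matches the trace form of the Laplacian in the ring with the divergence form in coordinates, by
    way of [lap_div]. *)
Lemma lap_tu : lap dx tH tGam tu = tf (fun t => laplacian (G t) (u t)).
Proof.
apply: tf_ext; first exact: sm_laplacian.
move=> z Nz; rewrite (map_lap_div (dxM (c := C)) tGH tHG dtG); apply: eq_bigr => i _.
rewrite -gradient_tH (dx_tf C _ (sm_gradient i)).
rewrite (tf_ev C Nz (smp _ (sm_gradient i))); congr (_ + _).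
apply: eq_bigr => k _; rewrite -gradient_tH (tf_ev C Nz (sm_gradient k)) mxE.
by rewrite (tf_ev C Nz (sm_christoffel _ _ _)).
Qed.

Hypothesis G_flow : forall t x, 0 < t < T -> U x -> forall i j,
  is_derive t (1 : R) (fun s => G s x i j) (- 2%:R * ricci (G t) x i j).
Hypothesis u_heat : forall t x, 0 < t < T -> U x ->
  is_derive t (1 : R) (u ^~ x) (laplacian (G t) (u t) x).

Lemma tev_dt f z (Nz : N z) (l : R) : sm f -> is_derive z.1 (1 : R) (f ^~ z.2) l ->
  tev Nz (dt (tf f)) = l.
Proof. by move=> fs [_ <-]; have [_ <-] := dt_tf C Nz fs. Qed.

Lemma t_flow : map_mx dt tG = - (ric dx tGam *+ 2).
Proof.
apply: mx_tev_ext => z Nz; rewrite map_mxN mulr2n map_mxD tev_ric.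
have [tT Uz] := Nz.
apply/matrixP => i j.
rewrite 3!mxE (tev_dt Nz (G_smooth i j) (G_flow tT Uz i j)).
by move: (ricci _ _) => Y; rewrite !mxE; ring.
Qed.

Lemma t_heat : dt tu = lap dx tH tGam tu.
Proof.
apply: tev_ext => z Nz; have [tT Uz] := Nz; rewrite lap_tu (tf_ev C Nz sm_laplacian).
exact: (tev_dt Nz u_smooth (u_heat tT Uz)).
Qed.

Definition cst (c : R) : C := tf (fun _ _ => c).

Lemma sm_cst c : sm (fun _ _ => c).
Proof. exact: smooth_on_cst. Qed.

Lemma tev_cst z (Nz : N z) c : tev Nz (cst c) = c.
Proof. exact: (tf_ev C Nz (sm_cst c)). Qed.

Lemma dx_cst i c : dx i (cst c) = 0.
Proof.
apply: tev_ext => z Nz; rewrite rmorph0 (dx_tf C _ (sm_cst c)).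
rewrite (tf_ev C Nz (smp _ (sm_cst c))) /=.
by rewrite /partial derive_cst.
Qed.

Lemma dt_cst c : dt (cst c) = 0.
Proof.
apply: tev_ext => z Nz; rewrite rmorph0; apply: (tev_dt Nz (sm_cst c)).
exact: is_derive_cst.
Qed.

Let smt : sm (fun t _ => t).
Proof. exact: sm_time. Qed.

Definition tau : C := tf (fun t _ => t).

Lemma tev_tau z (Nz : N z) : tev Nz tau = z.1.
Proof. exact: (tf_ev C Nz smt). Qed.

Lemma dx_tau i : dx i tau = 0.
Proof.
apply: tev_ext => z Nz; rewrite rmorph0 (dx_tf C _ smt).
by rewrite (tf_ev C Nz (smp _ smt)) /partial derive_cst.
Qed.

Lemma dt_tau : dt tau = 1.
Proof.
apply: tev_ext => z Nz; rewrite rmorph1; exact: (tev_dt Nz smt).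
Qed.

Context (A : R).
Hypothesis A_pos : 0 < A.

Definition tL : C := tf (fun t x => ln (A / u t x)).

Lemma is_derive_ln_div (W : normedModType R) (f : W -> R) x v :
  0 < f x -> derivable f x v ->
  is_derive x v (fun y => ln (A / f y)) (- ((f x)^-1 * 'D_v f x)).
Proof.
move=> f0 df; have fn0 : f x != 0 by rewrite gt_eqF.
have dfi := derivableV fn0 df.
have dAf : derivable (fun y => A / f y) x v.
  exact: (derivableM (derivable_cst A x v) dfi).
have DAf : 'D_v (fun y => A / f y) x = A * (- (f x) ^- 2 * 'D_v f x).
  rewrite (deriveM (derivable_cst A x v) dfi) derive_cst scaler0 addr0.
  exact: (congr1 (fun z => A * z) (deriveV fn0 df)).
have [||dl Dl] := @is_derive_ln _ _ (fun y => A / f y) x v => //.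
  by rewrite divr_gt0.
split=> //; rewrite Dl DAf; field; by rewrite fn0 gt_eqF.
Qed.

Lemma dx_tL i : dx i tL = - (tv * dx i tu).
Proof.
apply: tev_ext => z Nz; have [zT Uz] := space_timeP Nz.
rewrite rmorphN rmorphM tev_tv (dx_tf C _ (sm_ln A_pos)) (dx_tf C _ u_smooth).
rewrite (tf_ev C Nz (smp _ (sm_ln A_pos))) (tf_ev C Nz (smp _ u_smooth)).
have du : derivable (u z.1) z.2 (delta_mx 0 i).
  exact: (Ck_derivable (sm_slice oU u_smooth zT 1) Uz).
by have [_ e] := is_derive_ln_div (u_pos zT Uz) du; exact: e.
Qed.

Lemma dt_tL : dt tL = - (tv * dt tu).
Proof.
apply: tev_ext => z Nz; have [zT Uz] := space_timeP Nz; have [tT _] := Nz.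
rewrite rmorphN rmorphM tev_tv (tev_dt Nz u_smooth (u_heat tT Uz)).
apply: (tev_dt Nz (sm_ln A_pos)); have [du Du] := u_heat tT Uz.
have [dl Dl] := is_derive_ln_div (f := u ^~ z.2) (u_pos zT Uz) du.
by split; rewrite // Dl Du.
Qed.

(** At a spatial maximum the first derivatives vanish and the matrix of second derivatives is
    nonpositive, hence so is the Laplacian. The comparison with earlier times bounds the time
    derivative below by [e]. *)
Lemma box_at_max f t0 x0 (e : R) (Nz : N (t0, x0)) : sm f ->
  (forall x, U x -> f t0 x <= f t0 x0) ->
  (forall s, 0 < s <= t0 -> f s x0 - e * s <= f t0 x0 - e * t0) ->
  e <= tev Nz (box dx tH tGam dt (tf f)).
Proof.
move=> fs qmax qslope; have [/= t0T Ux0] := Nz; have /andP[t00 t0lt] := t0T.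
have [/= t0T' _] := space_timeP Nz.
pose phi := f t0.
have phis k : Ck k U phi by exact: (sm_slice oU fs t0T' k).
have crit (w : 'rV[R]_n) : 'D_w phi x0 = 0 /\ 'D_w ('D_w phi) x0 <= 0.
  exact: (@second_derivative_at_max R _ U phi x0 w oU Ux0 (phis 2) qmax).
have expand F (w : 'rV[R]_n) y : U y -> Ck 1 U F ->
    'D_w F y = \sum_i w 0 i * partial i F y.
  by move=> Uy Fs; rewrite {1}[w]row_sum_delta (@derive_sum_dir R _ _ _ _ _ U F y oU Uy Fs).
pose M := \matrix_(i, j) partial j (partial i phi) x0.
have quad (w : 'rV[R]_n) : (w *m M *m w^T) 0 0 <= 0.
  have -> : (w *m M *m w^T) 0 0 = 'D_w ('D_w phi) x0; last by have [] := crit w.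
  rewrite (expand _ w x0 Ux0 (Ck_derive w (phis 2))) mxE; apply: eq_bigr => j _.
  rewrite [w^T _ _]mxE mulrC; congr (_ * _).
  rewrite /partial (derive_comm _ _ oU Ux0 (phis 2)).
  rewrite (expand _ w x0 Ux0 (Ck_derive _ (phis 2))) mxE; apply: eq_bigr => i _.
  by rewrite mxE /partial (derive_comm _ _ oU Ux0 (phis 2)).
have lapq : tev Nz (lap dx tH tGam (tf f)) <= 0.
  have -> : tev Nz (lap dx tH tGam (tf f)) = \tr (invmx (G t0 x0) *m M).
    rewrite map_lap tev_tH; congr (\tr (_ *m _)).
    apply/matrixP => i j; rewrite [LHS]mxE map_hess [RHS]mxE big1 ?subr0.
      rewrite (dx_tf C _ fs) (dx_tf C _ (smp _ fs)).
      by rewrite (tf_ev C Nz (smp _ (smp _ fs))).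
    move=> p _; rewrite (dx_tf C _ fs) (tf_ev C Nz (smp _ fs)) /=.
    have -> : partial p (f t0) x0 = 0 by have [e0 _] := crit (delta_mx 0 p); exact: e0.
    by rewrite mulr0.
  (* With the inverse metric written as [E^T *m E], the trace is the sum of the values of the
     quadratic form [M] on the rows of [E]. *)
  rewrite (inv_frame (G_sym t0T' Ux0) (G_pos t0T' Ux0) (mulVmx (G_unit Nz))).
  set E := get _; rewrite -mulmxA mxtrace_mulC /mxtrace sumr_le0 // => k _.
  have -> : (E *m M *m E^T) k k = (row k E *m M *m (row k E)^T) 0 0.
    rewrite -row_mul !mxE; apply: eq_bigr => l _.
    by rewrite [(row k E)^T _ _]mxE [row k E _ _]mxE [E^T _ _]mxE [row _ _ _ _]mxE.
  exact: quad.
have dtq : e <= tev Nz (dt (tf f)).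
  have [df <-] := dt_tf C Nz fs; rewrite /= in df *.
  rewrite leNgt; apply/negP => lt_e.
  have : (h^-1 *: (f (h *: (1 : R) + t0) x0 - f t0 x0))
    @[h --> (0 : R)^'] --> 'D_1 (f ^~ x0) t0 by exact: df.
  move=> /cvgr_lt /(_ _ lt_e); rewrite near_withinE => /nbhs_ballP[r /= r0 rP].
  have [h /and3P[h0 hr ht]] : exists h : R, [&& 0 < h, h < r & h < t0].
    exists (Num.min r t0 / 2%:R).
    have m0 : 0 < Num.min r t0 by rewrite lt_min r0 t00.
    have hm : Num.min r t0 / 2%:R < Num.min r t0.
      by rewrite ltr_pdivrMr // ltr_pMr // ltr1n.
    move: hm; rewrite lt_min => /andP[-> ->].
    by rewrite divr_gt0.
  (* Only earlier times are controlled by [qslope], so the difference quotient is taken at a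
     negative increment. *)
  have := rP (- h); rewrite -ball_normE /ball_ /= sub0r opprK gtr0_norm // => /(_ hr).
  rewrite oppr_eq0 gt_eqF // => /(_ isT).
  have -> : - h *: (1 : R) + t0 = t0 - h by rewrite [_ *: _]mulr1 addrC.
  have := qslope (t0 - h); rewrite subr_gt0 ht lerBlDr lerDl ltW // => /(_ isT) sl.
  move=> lt2; have : (- h)^-1 * (f (t0 - h) x0 - f t0 x0) < e by [].
  rewrite invrN mulNr -mulrN mulrC ltr_pdivrMr //.
  by move: sl; rewrite mulrBr; lra.
by rewrite map_box; lra.
Qed.

(** * The two barriers as functions in a chart *)

Definition lapu t x := laplacian (G t) (u t) x.
Definition wf t x := gradsq (G t) (u t) x / u t x.
Definition ulf t x := u t x * ln (A / u t x).
Definition q2f t x := t * wf t x - ulf t x.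
Definition q3f be K t x := t * lapu t x + (t / 2%:R + be * K * t ^+ 2) * wf t x
  - (n%:R + be * K * t) * u t x
  - (5%:R / 2%:R + (2%:R + be) * K * t) * ulf t x.

Lemma sm_lapu : sm lapu.
Proof. exact: sm_laplacian. Qed.

Lemma sm_wf : sm wf.
Proof. by apply: smooth_on_mul; [exact: sm_gradsq|exact: sm_uinv]. Qed.

Lemma sm_ulf : sm ulf.
Proof. by apply: smooth_on_mul; [exact: u_smooth|exact: sm_ln]. Qed.

Lemma sm_q2f : sm q2f.
Proof.
apply: smooth_on_sub; last exact: sm_ulf.
by apply: smooth_on_mul; [exact: smt|exact: sm_wf].
Qed.

Lemma sm_q3f be K : sm (q3f be K).
Proof.
have lin a b : sm (fun t _ => a + b * t).
  apply: smooth_on_add; first exact: smooth_on_cst.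
  by apply: smooth_on_mul; [exact: smooth_on_cst|exact: smt].
rewrite /sm /q3f; apply: smooth_on_sub; last first.
  by apply: smooth_on_mul; [exact: lin|exact: sm_ulf].
apply: smooth_on_sub; last first.
  by apply: smooth_on_mul; [exact: lin|exact: u_smooth].
apply: smooth_on_add.
  by apply: smooth_on_mul; [exact: smt|exact: sm_lapu].
apply: smooth_on_mul; last exact: sm_wf.
apply: smooth_on_add.
  by apply: smooth_on_mul; [exact: smt|exact: smooth_on_cst].
apply: smooth_on_mul; first exact: smooth_on_cst.
by apply: smooth_on_mul; exact: smt.
Qed.

Local Notation twq := (wq dx tH tu tv).
Local Notation thq := (hq dx tGam tu tv).

Lemma tev_wq z (Nz : N z) : tev Nz twq = wf z.1 z.2.
Proof. by rewrite map_wq tev_tv tev_ip mulrC. Qed.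

Lemma tev_uL z (Nz : N z) : tev Nz (uL tu tL) = ulf z.1 z.2.
Proof. by rewrite map_uL tev_tu (tf_ev C Nz (sm_ln A_pos)). Qed.

Lemma tev_lap z (Nz : N z) : tev Nz (lap dx tH tGam tu) = lapu z.1 z.2.
Proof. by rewrite lap_tu (tf_ev C Nz sm_laplacian). Qed.

Lemma tev_normsq z (Nz : N z) : tev Nz (normsq tH thq) =
  tensor_norm (G z.1 z.2) (map_mx (tev Nz) thq) ^+ 2.
Proof.
have [zT Uz] := space_timeP Nz; rewrite map_normsq tev_tH.
rewrite (trHH_norm (G_sym zT Uz) (G_pos zT Uz) (mulVmx (G_unit Nz))) //.
exact: (map_hq_sym (dxC (c := C)) tGam_sym).
Qed.

Lemma tf_q2 : tf q2f = tau * twq - uL tu tL.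
Proof.
apply/esym/tf_ext; first exact: sm_q2f.
by move=> z Nz; rewrite map_q2 tev_tau tev_wq tev_uL.
Qed.

Lemma tev_box_q2 z (Nz : N z) : tev Nz (box dx tH tGam dt (tf q2f)) =
  - (z.1 * (u z.1 z.2)^-1 *
     tensor_norm (G z.1 z.2) (map_mx (tev Nz) thq) ^+ 2 *+ 2).
Proof.
rewrite tf_q2 (map_box_q2 (dxM (c := C)) (dxC (c := C)) tG_sym tGH tHG tGam_sym dtG
  (dtM (c := C)) (dtxC (c := C)) t_flow t_heat tuv dx_tL dt_tL _ dx_tau dt_tau).
by rewrite tev_tau tev_tv tev_normsq.
Qed.

(** The heat operator of the barrier is nonpositive everywhere, whereas [box_at_max] would make it
    at least [e]. *)
Lemma no_max_q2 t0 x0 (e : R) : 0 < e -> N (t0, x0) ->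
  (forall x, U x -> q2f t0 x <= q2f t0 x0) ->
  (forall s, 0 < s <= t0 -> q2f s x0 - e * s <= q2f t0 x0 - e * t0) -> False.
Proof.
move=> e0 Nz qmax qslope; have := box_at_max Nz sm_q2f qmax qslope.
apply/negP; rewrite -ltNge tev_box_q2; apply: le_lt_trans e0.
have [zT Uz] := space_timeP Nz.
rewrite oppr_le0 mulrn_wge0 // mulr_ge0 ?sqr_ge0 // mulr_ge0 //.
  by case/andP: zT.
by rewrite invr_ge0 ltW // u_pos.
Qed.

Context (be K : R).

Definition tc : C := cst 2%:R^-1 * tau + cst (be * K) * (tau * tau).
Definition ta : C := cst n%:R + cst (be * K) * tau.
Definition tb : C := cst (5%:R / 2%:R) + cst ((2%:R + be) * K) * tau.

Lemma tf_q3 : tf (q3f be K) = q3 dx tH tGam tu tv tL tc ta tb tau.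
Proof.
apply/esym/tf_ext; first exact: sm_q3f.
move=> z Nz; rewrite map_q3 tev_tau tev_wq tev_uL tev_tu tev_lap.
rewrite /tc /ta /tb !(rmorphD, rmorphM) !tev_cst tev_tau /q3f; ring.
Qed.

Lemma dx_tc i : dx i tc = 0.
Proof. by rewrite raddfD /= !dxM dx_tau !dx_cst; ring. Qed.
Lemma dx_ta i : dx i ta = 0.
Proof. by rewrite raddfD /= !dxM dx_tau !dx_cst; ring. Qed.
Lemma dx_tb i : dx i tb = 0.
Proof. by rewrite raddfD /= !dxM dx_tau !dx_cst; ring. Qed.

Lemma tev_dt_tc z (Nz : N z) : tev Nz (dt tc) = 1 / 2%:R + 2%:R * be * K * z.1.
Proof.
rewrite /tc raddfD /= !dtM dt_tau !dt_cst !(rmorphD, rmorphM) rmorph0 rmorph1.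
by rewrite !tev_cst tev_tau; field.
Qed.
Lemma tev_dt_ta z (Nz : N z) : tev Nz (dt ta) = be * K.
Proof.
rewrite /ta raddfD /= !dtM dt_tau !dt_cst !(rmorphD, rmorphM) rmorph0 rmorph1.
by rewrite !tev_cst; ring.
Qed.
Lemma tev_dt_tb z (Nz : N z) : tev Nz (dt tb) = (2%:R + be) * K.
Proof.
rewrite /tb raddfD /= !dtM dt_tau !dt_cst !(rmorphD, rmorphM) rmorph0 rmorph1.
by rewrite !tev_cst; ring.
Qed.

Lemma tev_box_q3 z (Nz : N z) : tev Nz (box dx tH tGam dt (tf (q3f be K))) =
  lapu z.1 z.2 + z.1 * (tev Nz (ricS dx tH tGam thq)
     + (u z.1 z.2)^-1 * tev Nz (ricq dx tH tGam tu)) *+ 2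
  + (1 / 2%:R + 2%:R * be * K * z.1) * wf z.1 z.2
  - (z.1 / 2%:R + be * K * z.1 ^+ 2) * ((u z.1 z.2)^-1 *
     tensor_norm (G z.1 z.2) (map_mx (tev Nz) thq) ^+ 2) *+ 2
  - be * K * u z.1 z.2 - (2%:R + be) * K * ulf z.1 z.2
  - (5%:R / 2%:R + (2%:R + be) * K * z.1) * wf z.1 z.2.
Proof.
rewrite tf_q3 (map_box_q3 (dxM (c := C)) (dxC (c := C)) tG_sym tGH tHG tGam_sym dtG
  (dtM (c := C)) (dtxC (c := C)) two_inj t_flow t_heat tuv dx_tL dt_tL _
  dx_tc dx_ta dx_tb dx_tau dt_tau).
rewrite tev_tau tev_tv tev_normsq tev_dt_tc tev_dt_ta tev_dt_tb tev_wq tev_tu tev_uL tev_lap.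
by rewrite /tc /tb !(rmorphD, rmorphM) !tev_cst tev_tau expr2 [z.1 / _]mulrC.
Qed.

Lemma no_max_q3 t0 x0 (e : R) : 0 < e -> N (t0, x0) ->
  0 <= K -> 0 < be -> 2%:R * be ^+ 2 = 1 ->
  tensor_norm (G t0 x0) (ricci (G t0) x0) <= K ->
  q2f t0 x0 <= 0 -> 0 < q3f be K t0 x0 ->
  (forall x, U x -> q3f be K t0 x <= q3f be K t0 x0) ->
  (forall s, 0 < s <= t0 -> q3f be K s x0 - e * s <= q3f be K t0 x0 - e * t0) -> False.
Proof.
move=> e0 Nz K0 be0 be2 ricK q20 q30 qmax qslope.
have := box_at_max Nz (sm_q3f be K) qmax qslope.
apply/negP; rewrite -ltNge tev_box_q3 /=; apply: le_lt_trans e0.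
have [/= zT Uz] := space_timeP Nz; have [/= /andP[t00 _] _] := Nz.
have Gs := G_sym zT Uz; have Gp := G_pos zT Uz; have HG := mulVmx (G_unit Nz).
have u0 := u_pos zT Uz.
have hs := map_hq_sym (dxC (c := C)) tGam_sym tu tv (tev Nz).
have gE : (map_mx (tev Nz) (gr dx tu))^T *m invmx (G t0 x0) *m map_mx (tev Nz) (gr dx tu)
    = (gradsq (G t0) (u t0) x0)%:M.
  by rewrite [LHS]mx11_scalar -(tev_tH Nz) -map_ip tev_ip.
have g0 : 0 <= gradsq (G t0) (u t0) x0.
  have := posdef_inv Gs Gp HG (map_mx (tev Nz) (gr dx tu)).
  by rewrite gE mxE mulr1n.
apply: (@box_q3_le0 R n K be t0 (u t0 x0) (u t0 x0)^-1 (lapu t0 x0) (wf t0 x0)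
  (tensor_norm (G t0 x0) (map_mx (tev Nz) thq)) (lapu t0 x0 - wf t0 x0)) => //.
- by rewrite mulfV // gt_eqF.
- by rewrite divr_ge0 // ltW.
- exact: sqrtr_ge0.
- have := trH_sqr_le Gs Gp HG hs; rewrite -(tev_tH Nz) map_tr_hq.
  by rewrite tev_lap tev_wq.
- rewrite map_ricS (tev_tH Nz) (tev_ric Nz); apply: le_trans (ler_norm _) _.
  apply: le_trans (trHH_le Gs Gp HG _ hs) _.
  by rewrite ler_wpM2r // sqrtr_ge0.
- rewrite map_ricq (tev_tH Nz) (tev_ric Nz) /wf mulrA [leRHS]mulrC.
  rewrite ler_wpM2l ?invr_ge0 ?(ltW u0) //.
  apply: le_trans (quadH_le Gs Gp HG _ _) _.
  by rewrite gE mxE mulr1n ler_wpM2r.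
- by rewrite -subr_le0.
Qed.

End LocalFlow.

(** * The parabolic maximum principle *)

Lemma gradsq_congr (R : realType) (n : nat) (B B' J : 'M[R]_n) (w w' : 'rV[R]_n) :
  B = J *m B' *m J^T -> B \in unitmx -> w = w' *m J^T ->
  (w *m invmx B *m w^T) 0 0 = (w' *m invmx B' *m w'^T) 0 0.
Proof.
move=> BE uB ->.
have uJ : J \in unitmx.
  move: uB; rewrite BE !unitmxE !det_mulmx !unitrM => /andP[/andP[-> _] _] //.
have uB' : B' \in unitmx.
  by move: uB; rewrite BE !unitmxE !det_mulmx !unitrM => /andP[/andP[_ ->] _].
have e : J^T *m invmx B *m J = invmx B'.
  have e1 : B' *m (J^T *m invmx B *m J) = 1%:M.
    have e0 : J *m (B' *m (J^T *m invmx B *m J)) = J.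
      by rewrite !mulmxA -BE mulmxV // mul1mx.
    by rewrite -[LHS]mul1mx -{1}(mulVmx uJ) -[LHS]mulmxA e0 mulVmx.
  by rewrite -[LHS]mul1mx -(mulVmx uB') -[LHS]mulmxA e1 mulmx1.
rewrite -e trmx_mul trmxK; congr (fun_of_matrix _ 0 0).
by rewrite !mulmxA.
Qed.

Section Manifold.
Context (R : realType) (n : nat) (M : topologicalType) (S : smooth_atlas R n M).

Lemma near_overlap (c c' : chart R n M) p : cdom c p -> cdom c' p ->
  \forall z \near cmap c p, overlap c c' z.
Proof.
move=> cp c'p; have Ux := cmap_img cp; apply: filterI.
  by apply: open_nbhs_nbhs; split; first exact: cimg_open.
have cc := cinv_continuous Ux; apply: cc; apply: open_nbhs_nbhs.
by split; [exact: cdom_open|rewrite cmapK].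
Qed.

(** The chain rule along [phi], the image of a coordinate line of [c] under the transition map. *)
Lemma partial_transition (c c' : chart R n M) (f : M -> R) p (i : 'I_n) :
  charts S c -> charts S c' -> cdom c p -> cdom c' p ->
  Ck 1 (cimg c') (f \o cinv c') ->
  partial i (f \o cinv c) (cmap c p) =
  \sum_k partial i (fun y => transition c c' y 0 k) (cmap c p)
     * partial k (f \o cinv c') (cmap c' p).
Proof.
move=> cS c'S cp c'p fs; set x := cmap c p.
have Ux : cimg c x by exact: cmap_img.
have ox : overlap c c' x by split=> //=; rewrite /x cmapK.
have tx : transition c c' x = cmap c' p by rewrite /transition /= /x cmapK.
have dtr : derivable (transition c c') x (delta_mx 0 i).
  have [_ /(_ (delta_mx 0 i))[d _]] := charts_compatible cS c'S 1; exact: d.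
pose phi (h : R) := transition c c' (h *: (delta_mx 0 i : 'rV[R]_n) + x).
have phi0 : phi 0 = cmap c' p by rewrite /phi scale0r add0r.
have dphi : derivable phi 0 1 := proj1 (derivable1P _ _ _) dtr.
have Dphi k : ('D_1 phi 0) 0 k = partial i (fun y => transition c c' y 0 k) x.
  have -> : 'D_1 phi 0 = 'D_(delta_mx 0 i) (transition c c') x.
    rewrite /derive; set g1 := fun h => h^-1 *: _; set g2 := fun h => h^-1 *: _.
    suff -> : g1 = g2 by [].
    apply/funext => h; rewrite /g1 /g2 /phi /= scale0r add0r addr0.
    by rewrite [h *: (1 : R)]mulr1.
  have /matrixP/(_ 0 k) := derive_mx dtr; rewrite [X in _ = X -> _]mxE => e.
  exact: e.
transitivity ('D_(delta_mx 0 i) (f \o cinv c' \o transition c c') x).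
  apply: near_eq_derive; apply: filterS (near_overlap cp c'p) => z [Uz c'z] /=.
  by rewrite /transition /= cmapK.
rewrite derive_line.
have Uy : cimg c' (phi 0) by rewrite phi0; exact: cmap_img.
have [_ e] := derive_along_curve (@cimg_open _ _ _ c') fs Uy dphi.
rewrite -[LHS]/('D_1 ((f \o cinv c') \o phi) 0) e; apply: eq_bigr => k _.
by rewrite Dphi phi0.
Qed.

Lemma gradsq_chart (g : tensor_field R n M) (f : M -> R) (c c' : chart R n M) p :
  riemannian_metric S g -> charts S c -> charts S c' -> cdom c p -> cdom c' p ->
  Ck 1 (cimg c') (f \o cinv c') ->
  gradsq (g c) (f \o cinv c) (cmap c p) = gradsq (g c') (f \o cinv c') (cmap c' p).
Proof.
move=> gR cS c'S cp c'p fs; set x := cmap c p.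
have Ux : cimg c x by exact: cmap_img.
have ox : overlap c c' x by split=> //=; rewrite /x cmapK.
have /= gE := metric_change gR cS c'S ox.
rewrite /transition /= {2}/x cmapK // in gE.
apply: (gradsq_congr gE).
  by rewrite unitmxE unitfE; apply: posdef_det; exact: (metric_posdef gR cS Ux).
apply/matrixP => a i; rewrite !mxE (partial_transition _ cS c'S cp c'p fs).
by apply: eq_bigr => k _; rewrite !mxE mulrC.
Qed.

(** The penalty [e * t] turns a nonpositive heat operator into a contradiction: where q - e t is
    maximal on the compact cylinder, q has slope at least [e] in time. The last hypothesis may
    assume [q] positive there, which is what makes an inequality known only where [q3 > 0]
    sufficient. *)
Lemma max_principle (M_compact : compact [set: M]) (t1 : R) (q : R -> M -> R) :
  0 <= t1 ->
  {within `[0, t1]%classic `*` [set: M], continuous (fun z : R * M => q z.1 z.2)} ->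
  (forall p, q 0 p <= 0) ->
  (forall e t0 p0, 0 < e -> 0 < t0 <= t1 -> 0 < q t0 p0 ->
    (forall p, q t0 p <= q t0 p0) ->
    (forall s, 0 < s <= t0 -> q s p0 - e * s <= q t0 p0 - e * t0) -> False) ->
  forall t p, 0 <= t <= t1 -> q t p <= 0.
Proof.
move=> t10 qc q0 H t p tt1; rewrite leNgt; apply/negP => qpos.
(* So small that [e * t] is less than half of [q t p], hence the maximum of q - e t stays positive;
   the added 1 covers [t1 = 0]. *)
pose e := q t p / (2%:R * (t1 + 1)).
have t11 : 0 < 2%:R * (t1 + 1) by rewrite mulr_gt0 // ltr_wpDl.
have e0 : 0 < e by rewrite divr_gt0.
pose A := `[0, t1]%classic `*` [set: M].
have Atp : A (t, p) by split=> //=; rewrite in_itv.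
have cA : compact A by apply: compact_setX => //; exact: segment_compact.
have [||[t0 p0]] := @compact_EVT_max _ R (fun z : R * M => q z.1 z.2 - e * z.1) A _ cA.
- by exists (t, p).
- apply/subspace_continuousP => z Az; apply: cvgB.
    exact: (proj1 (subspace_continuousP _ _) qc z Az).
  apply: cvgM; first exact: cvg_cst.
  by apply: cvg_within_filter; exact: cvg_fst.
rewrite inE => -[/= t0t1 _] max0; move: t0t1; rewrite in_itv /= => /andP[t00 t0t1].
have max (s : R) p' : 0 <= s <= t1 -> q s p' - e * s <= q t0 p0 - e * t0.
  by move=> st1; apply: (max0 (s, p')); rewrite inE; split=> //=; rewrite in_itv.
have pos : 0 < q t0 p0 - e * t0.
  apply: lt_le_trans (max t p tt1); case/andP: tt1 => t0' tt1.
  have e1 : e * (2%:R * (t1 + 1)) = q t p by rewrite /e divfK // gt_eqF.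
  have e2 : e * t <= e * t1 by rewrite ler_wpM2l // ltW.
  have e3 : 0 <= e * t1 by rewrite mulr_ge0 // ltW.
  rewrite -e1; nra.
have q0pos : 0 < q t0 p0.
  by apply: lt_le_trans pos _; rewrite lerBlDr lerDl mulr_ge0 // ltW.
have t0pos : 0 < t0.
  rewrite lt_neqAle t00 andbT eq_sym; apply/eqP => t0E; move: q0pos.
  by rewrite t0E ltNge q0.
apply: (H e t0 p0) => //; first by rewrite t0pos.
  by move=> p'; have := max t0 p'; rewrite t00 t0t1 => /(_ isT); rewrite lerD2r.
by move=> s /andP[s0 st0]; apply: max; rewrite (ltW s0) (le_trans st0).
Qed.

(** A function on M is assembled by choosing a chart at each point; chart independence then lets
    continuity and maximality be checked in one fixed chart. For each t < T the principle is applied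
    on [0, t], so that only interior positive times occur in the last hypothesis. *)
Lemma parabolic_max (M_compact : compact [set: M]) (T : R)
    (L : chart R n M -> R -> 'rV[R]_n -> R) :
  (forall c, charts S c -> sm T (cimg c) (L c)) ->
  (forall c c' p t, charts S c -> charts S c' -> cdom c p -> cdom c' p ->
    0 <= t < T -> L c t (cmap c p) = L c' t (cmap c' p)) ->
  (forall c x, charts S c -> cimg c x -> L c 0 x <= 0) ->
  (forall c t0 x0 e, charts S c -> cimg c x0 -> 0 < t0 < T -> 0 < e ->
    0 < L c t0 x0 -> (forall x, cimg c x -> L c t0 x <= L c t0 x0) ->
    (forall s, 0 < s <= t0 -> L c s x0 - e * s <= L c t0 x0 - e * t0) -> False) ->
  forall c t x, charts S c -> cimg c x -> 0 <= t < T -> L c t x <= 0.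
Proof.
move=> Lsm Lchart L0 H.
have exch p : exists c, charts S c /\ cdom c p.
  by have [c cS cp] := charts_cover S p; exists c.
have [ch chP] := choice exch.
pose q t p := L (ch p) t (cmap (ch p) p).
have qE c t p : charts S c -> cdom c p -> 0 <= t < T -> q t p = L c t (cmap c p).
  by move=> cS cp tT; have [chS chp] := chP p; exact: Lchart.
move=> c t x cS Ux tT; have [t0 tlt] := andP tT.
rewrite -(cinvK Ux) -qE //; last exact: cinv_dom.
apply: (@max_principle M_compact t q t0 _ _ _ t (cinv c x)); last by rewrite t0 lexx.
- apply/subspace_continuousP => -[s p] [/=]; rewrite in_itv /= => /andP[s0 st] _.
  have [chS chp] := chP p; set d := ch p.
  have sT : 0 <= s < T by rewrite s0 (le_lt_trans st).
  pose y := cmap d p; have Uy : cimg d y by exact: cmap_img.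
  have Sy : (`[0, T]%classic `*` cimg d) (s, y).
    by split=> //=; rewrite in_itv /= s0 (ltW (le_lt_trans st tlt)).
  have Lc := smooth_on_cvg Sy (Lsm d chS).
  have qsp : q s p = L d s y by exact: qE.
  set F := within _ _; pose F' := within (`[0, T]%classic `*` cimg d) (nbhs (s, y)).
  suff : (fun z : R * M => q z.1 z.2) @ F --> L d s y by rewrite -qsp.
  (* Near [(s, p)] every point lies in the domain of the single chart [d], so the function equals
     [L d] there whatever charts were chosen. *)
  have nd : \forall z \near nbhs (s, p), cdom d z.2.
    have : {for (s, p), continuous (fun z : R * M => z.2)} by exact: cvg_snd.
    by apply; apply: open_nbhs_nbhs; split; [exact: cdom_open|].
  have cm : (fun z : R * M => (z.1, cmap d z.2)) @ F --> F'.
    have h1 : (fun z : R * M => z.1) @ nbhs (s, p) --> s by exact: cvg_fst.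
    have h2 : (fun z : R * M => cmap d z.2) @ nbhs (s, p) --> y.
      have c2 : {for (s, p), continuous (fun z : R * M => z.2)} by exact: cvg_snd.
      have c1 : {for p, continuous (cmap d)} by exact: cmap_continuous.
      exact: (@continuous_comp _ _ _ (fun z : R * M => z.2) (cmap d) (s, p) c2 c1).
    have c0 : (fun z : R * M => (z.1, cmap d z.2)) @ nbhs (s, p) --> nbhs (s, y).
      exact: (cvg_pair h1 h2).
    move=> P PF'.
    have h : nbhs (s, p) (fun z : R * M => (`[0, T]%classic `*` cimg d)
        (z.1, cmap d z.2) -> P (z.1, cmap d z.2)) := c0 _ PF'.
    suff : nbhs (s, p) (fun z : R * M => (`[0, t]%classic `*` [set: M]) z ->
      P (z.1, cmap d z.2)) by [].
    apply: filterS (filterI nd h) => z [dz hz] [/= z1 _]; apply: hz.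
    split=> /=; last exact: cmap_img.
    by move: z1; rewrite !in_itv /= => /andP[-> /le_trans ->] //; exact: ltW.
  have := cvg_comp _ _ cm Lc; apply: cvg_trans; apply: near_eq_cvg.
  rewrite near_withinE; apply: (filterS _ nd) => z dz -[/=].
  by rewrite in_itv /= => /andP[z0 zt] _; rewrite (qE d) // z0 (le_lt_trans zt).
- move=> p; have [chS chp] := chP p; apply: L0 => //; exact: cmap_img.
- move=> e t0' p0 e0 /andP[t0'0 t0't] qpos qmax qslope.
  have [chS chp] := chP p0; set d := ch p0.
  have t0'T : t0' < T by exact: le_lt_trans tlt.
  apply: (H d t0' (cmap d p0) e) => //; first exact: cmap_img.
  + by rewrite t0'0.
  + move=> z Uz; have := qmax (cinv d z); rewrite (qE d _ (cinv d z)) ?cinvK //.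
      exact: cinv_dom.
    by rewrite (ltW t0'0).
Qed.

End Manifold.

(** * The estimate on the manifold *)

(** [parabolic_max] stops short of T; smoothness up to the end time carries the sign to the
    limit. *)
Lemma sm_le0_closed (R : realType) (n : nat) (T : R) (U : set 'rV[R]_n)
    (f : R -> 'rV[R]_n -> R) x :
  0 < T -> sm T U f -> U x -> (forall t, 0 <= t < T -> f t x <= 0) -> f T x <= 0.
Proof.
move=> T0 fs Ux f0; rewrite leNgt; apply/negP => fT.
have STx : (`[0, T]%classic `*` U) (T, x).
  by split=> //=; rewrite in_itv /= lexx ltW.
have := smooth_on_cvg STx fs; move=> /cvgr_gt /(_ _ fT) /=; rewrite near_withinE.
move=> nz.
have ct : (fun s : R => (s, x)) @ nbhs T --> nbhs (T, x).
  have h1 : (fun s : R => s) @ nbhs T --> T by exact: cvg_id.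
  have h2 : (fun _ : R => x) @ nbhs T --> x by exact: cvg_cst.
  exact: (cvg_pair h1 h2).
have : nbhs T (fun s : R => (`[0, T]%classic `*` U) (s, x) -> 0 < f s x) := ct _ nz.
move=> /nbhs_ballP[r /= r0 rP].
have m0 : 0 < Num.min r T by rewrite lt_min r0 T0.
have [h /and3P[h0 hr hT]] : exists h : R, [&& 0 < h, h < r & h < T].
  exists (Num.min r T / 2%:R).
  have hm : Num.min r T / 2%:R < Num.min r T by rewrite ltr_pdivrMr // ltr_pMr // ltr1n.
  by move: hm; rewrite lt_min => /andP[-> ->]; rewrite divr_gt0.
have Th0 : 0 <= T - h by rewrite subr_ge0 ltW.
have ThT : T - h < T by rewrite ltrBlDr ltrDl.
have := rP (T - h); rewrite -ball_normE /ball_ /= opprB addrC subrK gtr0_norm // => /(_ hr).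
rewrite ltNge f0; last by rewrite Th0.
by move=> /(_ _)/negP; apply=> //; split=> //=; rewrite in_itv /= Th0 ltW.
Qed.

Section Flow.
Context (R : realType) (n : nat) (M : topologicalType) (S : smooth_atlas R n M).
Context (T : R) (g : R -> tensor_field R n M) (u : R -> M -> R) (A K : R).
Hypothesis M_compact : compact [set: M].
Hypothesis g_flow : ricci_flow S T g.
Hypothesis u_heat : heat_solution S T g u.
Hypothesis u_pos : forall t p, 0 <= t <= T -> 0 < u t p.
Hypothesis A_pos : 0 < A.
Hypothesis u0_le : forall p, u 0 p <= A.
Hypothesis K_ge0 : 0 <= K.
Hypothesis Ric_le : forall t c p, 0 <= t <= T -> charts S c -> cdom c p ->
  ricci_norm (g t) c p <= K.
Hypothesis T_gt0 : 0 < T.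

Let Gc (c : chart R n M) t := g t c.
Let uc (c : chart R n M) t := u t \o cinv c.

Section Chart.
Context (c : chart R n M).
Hypothesis cS : charts S c.

Let oU : open (cimg c).
Proof. exact: cimg_open. Qed.

Let Gc_smooth i j : sm T (cimg c) (fun t x => Gc c t x i j).
Proof. exact: (flow_smooth g_flow). Qed.

Let Gc_sym t x : 0 <= t <= T -> cimg c x -> (Gc c t x)^T = Gc c t x.
Proof. by move=> tT Ux; exact: (Defs.metric_sym (flow_metric g_flow tT) cS Ux). Qed.

Let Gc_pos t x : 0 <= t <= T -> cimg c x -> posdef (Gc c t x).
Proof. by move=> tT Ux; exact: (metric_posdef (flow_metric g_flow tT) cS Ux). Qed.

Let uc_smooth : sm T (cimg c) (uc c).
Proof. exact: (heat_smooth u_heat). Qed.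

Let uc_pos t x : 0 <= t <= T -> cimg c x -> 0 < uc c t x.
Proof. by move=> tT _; exact: u_pos. Qed.

Let Gc_flow t x : 0 < t < T -> cimg c x -> forall i j,
  is_derive t (1 : R) (fun s => Gc c s x i j) (- 2%:R * ricci (Gc c t) x i j).
Proof.
move=> tT Ux i j; apply: (has_derivative_within_derive tT).
by apply: (flow_eq g_flow) => //; case/andP: tT => t0 tT; rewrite !ltW.
Qed.

Let uc_heat t x : 0 < t < T -> cimg c x ->
  is_derive t (1 : R) (uc c ^~ x) (laplacian (Gc c t) (uc c t) x).
Proof.
move=> tT Ux; apply: (has_derivative_within_derive tT).
have tT' : 0 <= t <= T by case/andP: tT => t0 tT; rewrite !ltW.
have := heat_eq u_heat cS tT' (cinv_dom Ux).
by rewrite /laplace_beltrami cinvK.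
Qed.

Lemma sm_q2c : sm T (cimg c) (q2f (Gc c) (uc c) A).
Proof. exact: (sm_q2f oU Gc_smooth Gc_pos uc_smooth uc_pos A_pos). Qed.

Lemma sm_q3c be : sm T (cimg c) (q3f (Gc c) (uc c) A be K).
Proof. exact: (sm_q3f oU Gc_smooth Gc_pos uc_smooth uc_pos A_pos). Qed.

Lemma no_max_q2c t0 x0 e : cimg c x0 -> 0 < t0 < T -> 0 < e ->
  (forall x, cimg c x -> q2f (Gc c) (uc c) A t0 x <= q2f (Gc c) (uc c) A t0 x0) ->
  (forall s, 0 < s <= t0 -> q2f (Gc c) (uc c) A s x0 - e * s
     <= q2f (Gc c) (uc c) A t0 x0 - e * t0) -> False.
Proof.
move=> Ux0 t0T e0; exact: (no_max_q2 oU Gc_smooth Gc_sym Gc_pos uc_smooth uc_pos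
  (sfun_calculus T oU) Gc_flow uc_heat A_pos e0).
Qed.

Lemma no_max_q3c be t0 x0 e : 0 < be -> 2%:R * be ^+ 2 = 1 ->
  cimg c x0 -> 0 < t0 < T -> 0 < e ->
  q2f (Gc c) (uc c) A t0 x0 <= 0 -> 0 < q3f (Gc c) (uc c) A be K t0 x0 ->
  (forall x, cimg c x -> q3f (Gc c) (uc c) A be K t0 x
     <= q3f (Gc c) (uc c) A be K t0 x0) ->
  (forall s, 0 < s <= t0 -> q3f (Gc c) (uc c) A be K s x0 - e * s
     <= q3f (Gc c) (uc c) A be K t0 x0 - e * t0) -> False.
Proof.
move=> be0 be2 Ux0 t0T e0; apply: (no_max_q3 oU Gc_smooth Gc_sym Gc_pos uc_smooth uc_pos
  (sfun_calculus T oU) Gc_flow uc_heat A_pos e0) => //.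
have t0T' : 0 <= t0 <= T by case/andP: t0T => a b; rewrite !ltW.
by have := Ric_le t0T' cS (cinv_dom Ux0); rewrite /ricci_norm cinvK.
Qed.

Lemma gradsq_ge0 t x : 0 <= t <= T -> cimg c x -> 0 <= gradsq (Gc c t) (uc c t) x.
Proof.
move=> tT Ux; have uG : Gc c t x \in unitmx.
  by rewrite unitmxE unitfE; exact/posdef_det/Gc_pos.
have := posdef_inv (Gc_sym tT Ux) (Gc_pos tT Ux) (mulVmx uG)
  (\row_k partial k (uc c t) x)^T.
by rewrite trmxK.
Qed.

End Chart.

Lemma ucE c t p : cdom c p -> uc c t (cmap c p) = u t p.
Proof. by move=> cp; rewrite /uc /= cmapK. Qed.

Lemma wf_chart c c' p t : charts S c -> charts S c' -> cdom c p -> cdom c' p ->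
  0 <= t <= T -> wf (Gc c) (uc c) t (cmap c p) = wf (Gc c') (uc c') t (cmap c' p).
Proof.
move=> cS c'S cp c'p tT; rewrite /wf !ucE //; congr (_ / _).
have us : Ck 1 (cimg c') (u t \o cinv c').
  have us : sm T (cimg c') (uc c') by exact: (heat_smooth u_heat c'S).
  exact: (sm_slice (@cimg_open _ _ _ c') us tT 1).
exact: (gradsq_chart (flow_metric g_flow tT) cS c'S cp c'p us).
Qed.

Lemma ulf_chart c c' p t : cdom c p -> cdom c' p ->
  ulf (uc c) A t (cmap c p) = ulf (uc c') A t (cmap c' p).
Proof. by move=> cp c'p; rewrite /ulf !ucE. Qed.

(** Both sides are the time derivative of [u] at [p], an expression free of charts, so no
    transformation law for second derivatives is involved. *)
Lemma lapu_chart c c' p t : charts S c -> charts S c' -> cdom c p -> cdom c' p ->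
  0 < t < T -> lapu (Gc c) (uc c) t (cmap c p) = lapu (Gc c') (uc c') t (cmap c' p).
Proof.
move=> cS c'S cp c'p tT; have tT' : 0 <= t <= T by case/andP: tT => a b; rewrite !ltW.
have [_ h] := has_derivative_within_derive tT (heat_eq u_heat cS tT' cp).
have [_ h'] := has_derivative_within_derive tT (heat_eq u_heat c'S tT' c'p).
exact: etrans (esym h) h'.
Qed.

Lemma q2c_chart c c' p t : charts S c -> charts S c' -> cdom c p -> cdom c' p ->
  0 <= t < T ->
  q2f (Gc c) (uc c) A t (cmap c p) = q2f (Gc c') (uc c') A t (cmap c' p).
Proof.
move=> cS c'S cp c'p /andP[t0 tT]; rewrite /q2f (ulf_chart _ cp c'p).
by rewrite (wf_chart cS c'S cp c'p) // t0 ltW.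
Qed.

Lemma q3c_chart be c c' p t : charts S c -> charts S c' -> cdom c p -> cdom c' p ->
  0 <= t < T -> q3f (Gc c) (uc c) A be K t (cmap c p)
              = q3f (Gc c') (uc c') A be K t (cmap c' p).
Proof.
move=> cS c'S cp c'p /andP[t0 tT]; rewrite /q3f (ulf_chart _ cp c'p).
rewrite (wf_chart cS c'S cp c'p) ?t0 ?ltW // !ucE //.
have -> // : t * lapu (Gc c) (uc c) t (cmap c p) = t * lapu (Gc c') (uc c') t (cmap c' p).
(* [lapu_chart] covers positive times; at t = 0 both sides vanish through the factor [t]. *)
move: t0; rewrite le_eqVlt => /predU1P[<-|t0]; first by rewrite !mul0r.
by rewrite (lapu_chart cS c'S cp c'p) // t0.
Qed.

(** Here the initial bound enters: it makes the logarithm nonnegative at time 0, hence both barriers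
    nonpositive there. *)
Lemma ulf0_ge0 c x : 0 <= ulf (uc c) A 0 x.
Proof.
have u0 : 0 < uc c 0 x by apply: u_pos; rewrite lexx ltW.
by rewrite /ulf mulr_ge0 ?(ltW u0) // ln_ge0 // ler_pdivlMr // mul1r u0_le.
Qed.

Lemma q2c_le0 c t x : charts S c -> cimg c x -> 0 <= t < T ->
  q2f (Gc c) (uc c) A t x <= 0.
Proof.
apply: (parabolic_max M_compact (L := fun c => q2f (Gc c) (uc c) A)) => {c t x}.
- exact: sm_q2c.
- by move=> c c' p t; exact: q2c_chart.
- by move=> c x cS Ux; rewrite /q2f mul0r sub0r oppr_le0 ulf0_ge0.
- by move=> c t0 x0 e cS Ux0 t0T e0 _; exact: (no_max_q2c cS Ux0 t0T e0).
Qed.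

Lemma q3c_le0 be c t x : 0 < be -> 2%:R * be ^+ 2 = 1 ->
  charts S c -> cimg c x -> 0 <= t < T -> q3f (Gc c) (uc c) A be K t x <= 0.
Proof.
move=> be0 be2.
apply: (parabolic_max M_compact (L := fun c => q3f (Gc c) (uc c) A be K)) => {c t x}.
- by move=> c cS; exact: sm_q3c.
- by move=> c c' p t; exact: q3c_chart.
(* At t = 0 only - n u - (5/2) u log (A / u) is left. *)
- move=> c x cS Ux; rewrite /q3f expr0n /= !(mul0r, mulr0, add0r, addr0).
  have u0 : 0 < uc c 0 x by apply: u_pos; rewrite lexx ltW.
  have h1 : 0 <= n%:R * uc c 0 x by rewrite mulr_ge0 ?ler0n // ltW.
  have h2 := ulf0_ge0 c x; lra.
- move=> c t0 x0 e cS Ux0 t0T e0; apply: (no_max_q3c cS be0 be2 Ux0 t0T e0).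
  by apply: q2c_le0 => //; case/andP: t0T => a b; rewrite ltW.
Qed.

End Flow.

Theorem theorem2 (R : realType) (n : nat) (M : topologicalType)
    (S : smooth_atlas R n M)
    (M_hausdorff : hausdorff_space M)
    (M_compact : compact [set: M])
    (M_connected : connected [set: M])
    (T : R) (g : R -> tensor_field R n M) (u : R -> M -> R) (A K : R)
    (g_flow : ricci_flow S T g)
    (u_heat : heat_solution S T g u)
    (u_pos : forall t p, 0 <= t <= T -> 0 < u t p)
    (A_pos : 0 < A)
    (u0_le : forall p, u 0 p <= A)
    (K_ge0 : 0 <= K)
    (Ric_le : forall t c p, 0 <= t <= T -> charts S c -> cdom c p ->
       ricci_norm (g t) c p <= K) :
  forall t c p, 0 < t <= T -> charts S c -> cdom c p ->
    laplace_beltrami (g t) (u t) c p / u t p <=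
      (n%:R / t + K / Num.sqrt 2%:R)
      + (5%:R / (2%:R * t) + (2%:R + 1 / Num.sqrt 2%:R) * K)
        * ln (A / u t p).
Proof.
move=> t c p /andP[t0 tT] cS cp.
have T0 : 0 < T by exact: lt_le_trans tT.
have tT' : 0 <= t <= T by rewrite ltW.
have Ux := cmap_img cp; set x := cmap c p in Ux *.
have s2 : 0 < Num.sqrt 2%:R :> R by rewrite sqrtr_gt0 ltr0n.
(* The value 1 / sqrt 2 is the positive solution of [2%:R * be ^+ 2 = 1], as required by the AM-GM
   step. *)
pose be : R := (Num.sqrt 2%:R)^-1.
have be0 : 0 < be by rewrite invr_gt0.
have be2 : 2%:R * be ^+ 2 = 1.
  by rewrite /be exprVn sqr_sqrtr ?ler0n // mulfV // pnatr_eq0.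
have q3t : q3f (fun t => g t c) (fun t => u t \o cinv c) A be K t x <= 0.
  have lt s : 0 <= s < T -> q3f (fun t => g t c) (fun t => u t \o cinv c) A be K s x <= 0.
    exact: (q3c_le0 M_compact g_flow u_heat u_pos A_pos u0_le K_ge0 Ric_le T0 be0 be2 cS Ux).
  (* The end time is obtained as a limit of the earlier ones. *)
  move: tT; rewrite le_eqVlt => /predU1P[->|tT]; last by apply: lt; rewrite ltW.
  apply: (sm_le0_closed T0 _ Ux lt).
  exact: (sm_q3c K g_flow u_heat u_pos A_pos cS be).
have w0 : 0 <= wf (fun t => g t c) (fun t => u t \o cinv c) t x.
  rewrite divr_ge0 //; first exact: (gradsq_ge0 u g_flow cS tT' Ux).
  by rewrite ltW // u_pos.
have v0 := u_pos t p tT'.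
have ux : u t (cinv c x) = u t p by rewrite /x cmapK.
move: q3t w0; rewrite /q3f /ulf /lapu /laplace_beltrami -/x /= ux.
set l := ln (A / u t p); set X := laplacian _ _ _; set w := wf _ _ _ _ => q3t w0.
move: (u t p) v0 l X w q3t w0 => v v0 l X w q3t w0.
(* Clearing the denominators u and t turns the claim into [q3 <= 0] without its gradient term. *)
rewrite ler_pdivrMr // -/be -(ler_pM2l t0).
have -> : 1 / Num.sqrt 2%:R = be by rewrite div1r.
have -> : t * ((n%:R / t + K * be + (5%:R / (2%:R * t) + (2%:R + be) * K) * l) * v) =
    (n%:R + be * K * t) * v + (5%:R / 2%:R + (2%:R + be) * K * t) * (v * l).
  by field; rewrite gt_eqF.
(* The gradient term has a nonnegative coefficient, so dropping it from [q3 <= 0] preserves the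
   bound. *)
have cw : 0 <= (t / 2%:R + be * K * t ^+ 2) * w.
  by rewrite mulr_ge0 // addr_ge0 ?mulr_ge0 ?sqr_ge0 ?divr_ge0 // ltW.
lra.
Qed.
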